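(* For modified conformal extensions of $2$-dimensional projective structures, the dimension of the space of almost Einstein scales is $0$, $1$, $3$ or $6$.
   Context: All considerations are local. Let $M$ be an oriented manifold of dimension $n=2$. $\mathcal{E}(w)=(\Lambda^nTM)^{w/(n+1)}$ is the bundle of densities of projective weight $w$. Torsion-free affine connections $D,\widehat D$ are projectively equivalent if $\widehat D_A\xi^B=D_A\xi^B+\delta_A^B\Upsilon_C\xi^C+\Upsilon_A\xi^B$ for a 1-form $\Upsilon_A$; a projective structure is an equivalence class. A connection is special if it preserves a volume form. Modified conformal extension: for a special torsion-free connection $D$ in the projective class let $\pi:\widetilde M\to M$, $\widetilde M=T^*M\otimes\mathcal{E}(2)$, be identified with $T^*M$ by the $D$-parallel volume form; $T\widetilde M=V\oplus H$ with $V\cong\pi^*T^*M$ vertical, $H\cong\pi^*TM$ the horizontal distribution of $D$. $\widetilde g$ is the split-signature metric making $V$ and $H$ isotropic and pairing them naturally; in coordinates $\widetilde g=2\,dx^A\odot dp_A-2\Gamma_A{}^C{}_Bp_C\,dx^A\odot dx^B$ with $a\odot b=\frac12(a\otimes b+b\otimes a)$. For $\Phi_{AB}\in S^2T^*M\otimes\mathcal{E}(2)$ put $\overline g=\widetilde g+\pi^*\Phi$; its conformal class depends only on the projective class $[D]$ and $\Phi$ and is the modified conformal extension (here of dimension $4$). Almost Einstein scales: sections $\sigma$ of $(\Lambda^{2n}T\widetilde M)^{1/(2n)}$ (functions, in the trivialization given by $\overline g$) such that $\sigma^{-2}\overline g$ is Einstein off the zero set of $\sigma$; equivalently, solutions of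 the linear equation that the trace-free part (w.r.t. $\overline g$) of $(\overline D_a\overline D_b+\overline{\mathrm{P}}_{ab})\sigma$ vanishes, where $\overline D$, $\overline{\mathrm{P}}$ are the Levi-Civita connection and Schouten tensor of $\overline g$. *)

(* Defs.v *)
From HB Require Import structures.
From mathcomp Require Import all_boot all_order all_algebra.
From mathcomp Require Import all_classical all_reals all_analysis.

Set Implicit Arguments.
Unset Strict Implicit.
Unset Printing Implicit Defensive.

Import Order.TTheory GRing.Theory Num.Theory.
Import numFieldNormedType.Exports.

Local Open Scope classical_set_scope.
Local Open Scope ring_scope.

(** * Smooth functions on an open subset of R^m *)

Definition partial (R : realType) (m : nat) (i : 'I_m) (f : 'rV[R]_m -> R) :
    'rV[R]_m -> R :=
  fun x => 'D_(delta_mx 0 i) f x.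

(* C^infinity: the iterated partial derivatives of all orders exist and are
   (Frechet) differentiable at every point of the open set [U]; what [f] does
   outside [U] is irrelevant. *)
Definition smooth_on (R : realType) (m : nat) (U : set 'rV[R]_m)
    (f : 'rV[R]_m -> R) : Prop :=
  forall (s : seq 'I_m) (x : 'rV[R]_m), U x ->
    differentiable (foldr (@partial R m) f s) x.

(** * Affine connections and projective structures on an open subset of R^n *)

(* [G x A C B] is the Christoffel symbol $\Gamma_A{}^C{}_B(x)$, that is
   $D_A \xi^C = \partial_A \xi^C + \Gamma_A{}^C{}_B \xi^B$. *)
Definition affine_connection (R : realType) (n : nat) : Type :=
  'rV[R]_n -> 'I_n -> 'I_n -> 'I_n -> R.

Definition torsion_free_connection (R : realType) (n : nat)
    (U : set 'rV[R]_n) (G : affine_connection R n) : Prop :=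
  (forall A C B, smooth_on U (fun x => G x A C B)) /\
  (forall x A C B, U x -> G x A C B = G x B C A).

(* $\widehat D_A \xi^B
     = D_A \xi^B + \delta_A^B \Upsilon_C \xi^C + \Upsilon_A \xi^B$ *)
Definition projectively_equivalent (R : realType) (n : nat)
    (U : set 'rV[R]_n) (G G' : affine_connection R n) : Prop :=
  exists Y : 'rV[R]_n -> 'I_n -> R,
    (forall A, smooth_on U (Y ^~ A)) /\
    (forall x A B C, U x ->
       G' x A B C = G x A B C + (A == B)%:R * Y x C + (B == C)%:R * Y x A).

Definition projective_structure (R : realType) (n : nat)
    (U : set 'rV[R]_n) (P : set (affine_connection R n)) : Prop :=
  exists2 G, torsion_free_connection U G &
    P = [set G' | torsion_free_connection U G' /\
                  projectively_equivalent U G G'].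

(* [G] preserves the volume form $v\, dx^1 \wedge \dots \wedge dx^n$. *)
Definition special_connection (R : realType) (n : nat)
    (U : set 'rV[R]_n) (G : affine_connection R n) : Prop :=
  exists2 v : 'rV[R]_n -> R, smooth_on U v &
    forall x, U x ->
      v x != 0 /\ (forall A, partial A v x - (\sum_C G x A C C) * v x = 0).

Definition symmetric_tensor (R : realType) (n : nat)
    (U : set 'rV[R]_n) (Phi : 'rV[R]_n -> 'M[R]_n) : Prop :=
  (forall A B, smooth_on U (fun x => Phi x A B)) /\
  (forall x, U x -> (Phi x)^T = Phi x).

(** * The modified conformal extension *)

(* The parallel volume form of a special connection trivializes every
   $\mathcal E(w)$, so that $T^*U \otimes \mathcal E(2)$ is $T^*U$ and
   [Phi] is an ordinary symmetric form.  A point of $T^*U$ is the row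
   [row_mx x p] of its base coordinates $x^A$ (indices [lshift n A]) and
   fibre coordinates $p_A$ (indices [rshift n A]). *)
Definition cotangent (R : realType) (n : nat) (U : set 'rV[R]_n) :
    set 'rV[R]_(n + n) :=
  [set z | U (lsubmx z)].

(* Gram matrix, in the frame $\partial_{x^A}, \partial_{p_A}$, of
   $2\,dx^A \odot dp_A - 2\Gamma_A{}^C{}_B\, p_C\, dx^A \odot dx^B
     + \Phi_{AB}\, dx^A \odot dx^B$
   with $a \odot b = (a \otimes b + b \otimes a)/2$. *)
Definition modified_extension (R : realType) (n : nat)
    (G : affine_connection R n) (Phi : 'rV[R]_n -> 'M[R]_n) :
    'rV[R]_(n + n) -> 'M[R]_(n + n) :=
  fun z =>
    let x := lsubmx z in let p := rsubmx z in
    block_mx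
      (\matrix_(A, B) (- (2 * \sum_C G x A C B * p 0 C) + Phi x A B)) 1%:M
      1%:M                                                             0.

(** * Pseudo-Riemannian geometry in coordinates *)

(* [christoffel g x k i j] is $\Gamma^k_{ij}$. *)
Definition christoffel (R : realType) (m : nat) (g : 'rV[R]_m -> 'M[R]_m)
    (x : 'rV[R]_m) (k i j : 'I_m) : R :=
  2^-1 * \sum_l invmx (g x) k l *
    (partial i (fun y => g y j l) x + partial j (fun y => g y i l) x
     - partial l (fun y => g y i j) x).

(* Sign convention: the round sphere has positive Ricci curvature. *)
Definition ricci (R : realType) (m : nat) (g : 'rV[R]_m -> 'M[R]_m)
    (x : 'rV[R]_m) : 'M[R]_m :=
  \matrix_(i, j)
    (\sum_k partial k (fun y => christoffel g y k i j) x
     - \sum_k partial j (fun y => christoffel g y k i k) x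
     + \sum_k \sum_l christoffel g x k k l * christoffel g x l i j
     - \sum_k \sum_l christoffel g x k j l * christoffel g x l i k).

Definition metric_trace (R : realType) (m : nat) (g T : 'M[R]_m) : R :=
  \sum_i \sum_j invmx g i j * T i j.

Definition trace_free_part (R : realType) (m : nat) (g T : 'M[R]_m) :
    'M[R]_m :=
  T - (metric_trace g T / m%:R) *: g.

Definition schouten (R : realType) (m : nat) (g : 'rV[R]_m -> 'M[R]_m)
    (x : 'rV[R]_m) : 'M[R]_m :=
  (m%:R - 2)^-1 *:
    (ricci g x - (metric_trace (g x) (ricci g x) / (2 * (m%:R - 1))) *: g x).

Definition hessian (R : realType) (m : nat) (g : 'rV[R]_m -> 'M[R]_m)
    (s : 'rV[R]_m -> R) (x : 'rV[R]_m) : 'M[R]_m :=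
  \matrix_(i, j)
    (partial i (partial j s) x - \sum_k christoffel g x k i j * partial k s x).

(* Densities of conformal weight one are functions, in the trivialization
   given by [g].  A function on [W] is represented by its extension by zero to
   all of R^m, so that equality on [W] is equality. *)
Definition almost_einstein_scales (R : realType) (m : nat)
    (W : set 'rV[R]_m) (g : 'rV[R]_m -> 'M[R]_m) : set ('rV[R]_m -> R^o) :=
  [set s | [/\ smooth_on W s,
    forall x, W x ->
      trace_free_part (g x) (hessian g s x + s x *: schouten g x) = 0 &
    forall x, ~ W x -> s x = 0]].

(** * Dimension of a linear subspace of a possibly infinite-dimensional space *)

Definition has_dimension (R : realType) (V : lmodType R) (S : set V)
    (d : nat) : Prop :=
  exists2 f : {linear 'rV[R]_d -> V}, injective f & range f = S.

(* Main.v *)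
Require Import Defs.
From HB Require Import structures.
From mathcomp Require Import all_boot all_order all_algebra.
From mathcomp Require Import all_classical all_reals all_analysis.
From mathcomp Require Import ring lra.

Set Implicit Arguments.
Unset Strict Implicit.
Unset Printing Implicit Defensive.

Import Order.TTheory GRing.Theory Num.Theory.
Import numFieldNormedType.Exports.

Local Open Scope classical_set_scope.
Local Open Scope ring_scope.

(** Write a scale in the coordinates $x^A$, $p_A$ of the cotangent bundle. The
    vertical-vertical components of the metric, of its Levi-Civita connection
    and of its Schouten tensor vanish, so that these components of the almost
    Einstein equation say that the scale is affine along the fibres,
    $\sigma = f + \xi^A p_A$ ([einstein_scale_affine]). Since the Schouten
    tensor of the extension is the pull-back of the Schouten tensor $P$ of $D$
    ([schouten_extension]), the mixed components say that $D_A \xi^B =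
    \lambda \delta_A^B$ for a function $\lambda$, and the horizontal ones are an
    equation of second order for $f$ with source terms made of $\xi$, $\lambda$
    and $\Phi$ ([einstein_equationsP]).

    With $\mu = df$ the unknowns $(\xi, \lambda, f, \mu)$ satisfy a closed
    linear system of first order. Almost Einstein scales are therefore the
    parallel sections of a connection of rank six ([almost_einstein_scalesE]).
    On a convex domain a parallel section is determined by its value at one
    point ([parallel_section_unique]), and every value is attained when the
    connection is flat ([flat_parallel_section]); both follow from the theory
    of linear differential equations along segments.

    A parallel section is annihilated by the curvature. In dimension two the
    curvature consists of the Cotton tensor $y$ of the projective structure and
    of one function $k$ that depends on $\Phi$ ([scale_curvature_action]), and
    the resulting conditions ([scale_integrability]) are
    $y_E \xi^E = 0$, $k \xi^1 + y_0 f = 0$ and $- k \xi^0 + y_1 f = 0$.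
    - If $y$ does not vanish at some point, then these conditions and their
      first derivatives show that a single component of $\xi$ at this point
      determines the section: the dimension is 0 or 1.
    - If $y$ vanishes identically and $k$ does not, then $\xi$ and $\lambda$
      vanish. What remains is the system for $f$ and $\mu$, which is that of
      $\Phi = 0$; there the connection is flat, and the dimension is 3.
    - If $y$ and $k$ vanish identically, the connection is flat and the
      dimension is 6. *)

(** * Linear differential equations on the unit interval *)

Lemma derive_le_increment (R : realType) (f g df dg : R -> R) (T : R) :
  (forall t, 0 <= t <= T -> is_derive t 1 f (df t)) ->
  (forall t, 0 <= t <= T -> is_derive t 1 g (dg t)) ->
  (forall t, 0 <= t <= T -> df t <= dg t) ->
  forall t, 0 <= t <= T -> f t - f 0 <= g t - g 0.
Proof.
move=> hf hg hfg t /andP[t0 tT].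
have hd s : 0 <= s <= T -> is_derive s 1 (g - f) (dg s - df s).
  by move=> hs; apply: is_deriveB; [exact: hg | exact: hf].
have [||c hc] := @MVT_segment R (g - f) (fun s => dg s - df s) 0 t t0.
- move=> s; rewrite in_itv/= => /andP[s0 st]; apply: hd.
  by rewrite (ltW s0) (le_trans (ltW st)).
- apply: derivable_within_continuous => s; rewrite in_itv/= => /andP[s0 st].
  by apply: ex_derive; apply: hd; rewrite s0 (le_trans st).
rewrite !fctE subr0 => E.
move: hc; rewrite in_itv/= => /andP[c0 ct].
have : 0 <= (dg c - df c) * t.
  by rewrite mulr_ge0// subr_ge0 hfg// c0 (le_trans ct).
by rewrite -E; lra.
Qed.

(** The mean value inequality, from the monotonicity of [g - f] and [g + f]. *)
Lemma derive_abs_le_increment (R : realType) (f g df dg : R -> R) (T : R) :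
  (forall t, 0 <= t <= T -> is_derive t 1 f (df t)) ->
  (forall t, 0 <= t <= T -> is_derive t 1 g (dg t)) ->
  (forall t, 0 <= t <= T -> `|df t| <= dg t) ->
  forall t, 0 <= t <= T -> `|f t - f 0| <= g t - g 0.
Proof.
move=> hf hg hfg t tT.
rewrite ler_norml; apply/andP; split; last first.
  apply: (derive_le_increment hf hg) => // s sT.
  by apply: le_trans (hfg _ sT); exact: ler_norm.
have hN s : 0 <= s <= T -> is_derive s 1 (- f) (- df s).
  by move=> hs; apply: is_deriveN; exact: hf.
have := derive_le_increment hN hg _ tT.
rewrite !fctE => H.
suff : - f t - - f 0 <= g t - g 0 by lra.
apply: H => s sT; apply: le_trans (hfg _ sT).
by rewrite -normrN; exact: ler_norm.
Qed.

(** Composition with [clamp] extends a function from [[0, 1]] to a function that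
    is continuous on the whole line. *)
Definition clamp (R : realType) (t : R) : R := Num.max 0 (Num.min t 1).

(** A primitive of the function equal to [g] on [[0, 1]] and constant on both
    sides: being based at [- 1], it is two-sided differentiable at the end
    points of the interval as well. *)
Definition primitive (R : realType) (g : R -> R) (t : R) : R :=
  parameterized_integral (@lebesgue_measure R) (-1) t (g \o @clamp R)
  - parameterized_integral (@lebesgue_measure R) (-1) 0 (g \o @clamp R).

Lemma clamp_itv (R : realType) (t : R) : 0 <= clamp t <= 1.
Proof.
by rewrite /clamp le_max lexx/= ge_max ler01 ge_min lexx orbT.
Qed.

Lemma clamp_id (R : realType) (t : R) : 0 <= t <= 1 -> clamp t = t.
Proof.
by move=> /andP[t0 t1]; rewrite /clamp (min_idPl t1) (max_idPr t0).
Qed.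

Lemma clamp_continuous (R : realType) : continuous (@clamp R).
Proof.
move=> t; have -> : @clamp R = cst 0 \max ((id : R -> R) \min cst 1) by [].
apply: continuous_max; first exact: cvg_cst.
by apply: continuous_min; [exact: cvg_id|exact: cvg_cst].
Qed.

Lemma primitive0 (R : realType) (g : R -> R) : primitive g 0 = 0.
Proof. by rewrite /primitive subrr. Qed.

Lemma is_derive_primitive (R : realType) (g : R -> R) :
  (forall t : R, 0 <= t <= 1 -> {for t, continuous g}) ->
  forall t : R, 0 <= t <= 1 -> is_derive t 1 (primitive g) (g t).
Proof.
move=> cg t t01.
have cgc : continuous (g \o @clamp R).
  move=> s; apply: continuous_comp; first exact: clamp_continuous.
  by apply: cg; exact: clamp_itv.
have := @continuous_FTC1_closed R (g \o @clamp R) (-1) t (t + 1).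
case.
- by rewrite ltrDl.
- apply: continuous_compact_integrable; first exact: segment_compact.
  exact: continuous_subspaceT.
- by case/andP: t01 => t0 _; apply: lt_le_trans t0; rewrite oppr_lt0.
- exact: cgc.
move=> h1 h2.
have -> : g t = g t - 0 by rewrite subr0.
apply: (@is_deriveB _ _ _ _ (cst _)).
apply: DeriveDef => //.
by rewrite -derive1E h2/= clamp_id.
Qed.

(** The limit is the supremum of the increasing sequence
    [a n - 2 * K / 2 ^+ n], which the decreasing sequence
    [a n + 2 * K / 2 ^+ n] bounds from above. *)
Lemma geometric_limit (R : realType) (a : nat -> R) (K : R) :
  (forall n, `|a n.+1 - a n| <= K / 2 ^+ n) ->
  exists l, forall n, `|l - a n| <= 2 * K / 2 ^+ n.
Proof.
move=> ha.
pose e n : R := 2 * K / 2 ^+ n.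
have eS n : e n = e n.+1 + K / 2 ^+ n.
  by rewrite /e exprS invfM; field; rewrite expf_neq0.
have K0 : 0 <= K by have := ha 0%N; rewrite expr0 divr1; apply: le_trans.
have e0 n : 0 <= e n by rewrite /e divr_ge0 ?mulr_ge0 ?exprn_ge0.
have up : {homo (fun n => a n - e n) : m n / (m <= n)%N >-> m <= n}.
  apply: (homo_leq (@lexx _ _) (@le_trans _ _)) => n.
  by have := ha n; rewrite ler_norml eS => /andP[]; lra.
have dn : {homo (fun n => - (a n + e n)) : m n / (m <= n)%N >-> m <= n}.
  apply: (homo_leq (@lexx _ _) (@le_trans _ _)) => n.
  by have := ha n; rewrite ler_norml eS => /andP[]; lra.
have cross m n : a m - e m <= a n + e n.
  have := up _ _ (leq_maxl m n); have := dn _ _ (leq_maxr m n).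
  by have := e0 (maxn m n); lra.
pose E := [set a n - e n | n in [set: nat]].
have supE : has_sup E.
  split; first by exists (a 0%N - e 0%N); exists 0%N.
  by exists (a 0%N + e 0%N) => _ [n _ <-]; exact: cross.
exists (sup E) => n; rewrite -/(e n).
have h1 : a n - e n <= sup E by apply: ub_le_sup => //; [exact: supE.2|exists n].
have h2 : sup E <= a n + e n.
  by apply: ge_sup => [|_ [m _ <-]]; [exact: supE.1|exact: cross].
by rewrite ler_norml; apply/andP; split; lra.
Qed.

(** Cauchy-Schwarz against the constant vector, from
    [2 * `|w i| * `|w j| <= w i ^+ 2 + w j ^+ 2]. *)
Lemma sqr_sum_norm_le (R : realType) (N : nat) (w : 'I_N -> R) :
  (\sum_i `|w i|) ^+ 2 <= N%:R * \sum_i (w i) ^+ 2.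
Proof.
have -> : N%:R * \sum_i (w i) ^+ 2
    = \sum_i \sum_j ((w i) ^+ 2 + (w j) ^+ 2) / 2.
  under [RHS]eq_bigr => i _.
    rewrite -mulr_suml big_split/= sumr_const card_ord.
  over.
  rewrite -mulr_suml big_split/= sumr_const card_ord sumrMnl -mulr_natl.
  by field.
rewrite expr2 mulr_suml; apply: ler_sum => i _.
rewrite mulr_sumr; apply: ler_sum => j _.
have := sqr_ge0 (`|w i| - `|w j|).
by rewrite -[in X in _ -> X](real_normK (num_real (w i)))
  -[in X in _ -> X](real_normK (num_real (w j))); nra.
Qed.

(** The sum of squares [E] satisfies [E' <= K * E + e ^+ 2], so that
    [E t * expR (- K * t)] grows at most like [e ^+ 2 * t]; squares are used
    because they are differentiable where norms are not. *)
Lemma gronwall (R : realType) (N : nat) (w dw : 'I_N -> R -> R) (L e : R) :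
  0 <= L -> 0 <= e ->
  (forall i (t : R), 0 <= t <= 1 -> is_derive t 1 (w i) (dw i t)) ->
  (forall i (t : R), 0 <= t <= 1 -> `|dw i t| <= L * (\sum_j `|w j t|) + e) ->
  (forall i, w i 0 = 0) ->
  forall i (t : R), 0 <= t <= 1 -> `|w i t| <= e * expR ((2 * L + 1) * N%:R).
Proof.
move=> L0 e0 hw hdw w0 i t t01.
(* The factor [N%:R] bounds the square of the sum of norms by [E]; the summand 1
   comes from [2 * S * e <= S ^+ 2 + e ^+ 2], for that sum [S]. *)
pose K := (2 * L + 1) * N%:R.
have K0 : 0 <= K by rewrite mulr_ge0// addr_ge0// mulr_ge0.
pose E (s : R) := \sum_j (w j s) ^+ 2.
pose dE (s : R) := \sum_j (2 * w j s * dw j s).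
have hE (s : R) : 0 <= s <= 1 -> is_derive s 1 E (dE s).
  move=> hs; rewrite /E /dE.
  rewrite (_ : (fun s => _) = \sum_j (fun s => (w j s) ^+ 2)); last first.
    by apply/funext => r; rewrite fct_sumE.
  apply: is_derive_sum => j.
  have := hw j s hs => hj.
  apply: is_derive_eq.
  by rewrite /GRing.scale/=; ring.
have dE_le (s : R) : 0 <= s <= 1 -> dE s <= K * E s + e ^+ 2.
  move=> hs; pose S := \sum_j `|w j s|.
  have S0 : 0 <= S by apply: sumr_ge0.
  have : dE s <= \sum_j (2 * `|w j s| * (L * S + e)).
    apply: ler_sum => j _.
    apply: le_trans (ler_norm _) _; rewrite !normrM (ger0_norm (ler0n _ 2)).
    by apply: ler_wpM2l; [rewrite mulr_ge0|exact: hdw].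
  rewrite -mulr_suml -mulr_sumr -/S.
  have := sqr_sum_norm_le (fun j => w j s); rewrite -/S -/(E s) /K.
  have := sqr_ge0 (S - e); nra.
pose F (s : R) := E s * expR (- K * s).
have hF (s : R) : 0 <= s <= 1 -> is_derive s 1 F
    (dE s * expR (- K * s) - E s * (K * expR (- K * s))).
  move=> hs; have hEs := hE s hs.
  rewrite /F; apply: is_derive_eq.
  by rewrite /GRing.scale/= ; ring.
have hG (s : R) : 0 <= s <= 1 -> is_derive s 1 (fun s : R => e ^+ 2 * s) (e ^+ 2).
  by move=> hs; apply: is_derive_eq; rewrite /GRing.scale/= mulr1.
have := derive_le_increment hF hG _ t01; rewrite /F /= !mulr0 expR0 mulr1 subr0.
have -> : E 0 = 0.
  by rewrite /E big1// => j _; rewrite w0 expr0n.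
rewrite subr0 => H.
have {}H : E t * expR (- K * t) <= e ^+ 2 * t.
  apply: H => s hs; have := dE_le s hs.
  have x0 := expR_gt0 (- K * s).
  have x1 : expR (- K * s) <= 1.
    rewrite -expR0 ler_expR mulNr oppr_le0 mulr_ge0//; by case/andP: hs.
  have := sqr_ge0 e; nra.
have wE : (w i t) ^+ 2 <= E t.
  rewrite /E (bigD1 i)//= lerDl; apply: sumr_ge0 => j _; exact: sqr_ge0.
have E1 : E t <= e ^+ 2 * expR K.
  have -> : E t = E t * expR (- K * t) * expR (K * t).
    by rewrite -mulrA -expRD mulNr addNr expR0 mulr1.
  apply: ler_pM => //.
  - by rewrite mulr_ge0 ?expR_ge0// /E sumr_ge0// => j _; exact: sqr_ge0.
  - apply: le_trans H _; case/andP: t01 => t0 t1.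
    by rewrite ler_piMr// sqr_ge0.
  - by rewrite ler_expR; case/andP: t01 => t0 t1; rewrite ler_piMr.
rewrite -ler_sqr ?nnegrE// ?mulr_ge0 ?expR_ge0//.
rewrite real_normK ?num_real// (le_trans wE)// (le_trans E1)// exprMn.
apply: ler_wpM2l; first exact: sqr_ge0.
rewrite expr2 ler_peMl ?expR_ge0//.
by rewrite -[leLHS]expR0 ler_expR.
Qed.

Lemma eq0_geometric (R : realType) (a c : R) :
  (forall n, `|a| <= c / 2 ^+ n) -> a = 0.
Proof.
move=> ha; apply/eqP; rewrite -normr_le0 leNgt; apply/negP => a0.
have c0 : 0 <= c / `|a|.
  by rewrite divr_ge0//; have := ha 0%N; rewrite expr0 divr1; apply: le_trans.
have := archi_boundP c0; set n := Num.bound _ => hn.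
have := ha n; rewrite ler_pdivlMr ?exprn_gt0// mulrC -ler_pdivlMr//.
apply/negP; rewrite -ltNge (lt_trans hn)// -natrX ltr_nat.
exact: ltn_expl.
Qed.

Lemma bounded_itv01 (R : realType) (g : R -> R) :
  (forall t : R, 0 <= t <= 1 -> {for t, continuous g}) ->
  exists C : R, forall t : R, 0 <= t <= 1 -> `|g t| <= C.
Proof.
move=> cg.
have [|c _ hc] := @EVT_max R (fun t => `|g t|) 0 1 (@ler01 R).
  apply: continuous_in_subspaceT => t.
  rewrite inE/= in_itv/= => t01.
  by apply: continuous_comp; [exact: cg|exact: norm_continuous].
by exists `|g c| => t t01; apply: hc; rewrite in_itv.
Qed.

Lemma continuous_lin_sum (R : realType) (N : nat) (b u : 'I_N -> R -> R)
    (t : R) :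
  (forall j, {for t, continuous (b j)}) ->
  (forall j, {for t, continuous (u j)}) ->
  {for t, continuous (fun s => \sum_j b j s * u j s)}.
Proof.
move=> cb cu.
rewrite (_ : (fun s => _) = \sum_j (fun s => b j s * u j s)); last first.
  by apply/funext => r; rewrite fct_sumE.
elim/big_ind: _ => [|f g cf cg|j _]; first exact: cvg_cst.
  exact: continuousD.
by apply: continuousM; [exact: cb|exact: cu].
Qed.

Lemma norm_lin_sum_le (R : realType) (N : nat) (b u : 'I_N -> R) (C m : R) :
  (forall j, `|b j| <= C) -> (forall j, `|u j| <= m) ->
  `|\sum_j b j * u j| <= N%:R * (C * m).
Proof.
move=> hb hu; apply: le_trans (ler_norm_sum _ _ _) _.
apply: (@le_trans _ _ (\sum_(j < N) C * m)).
  by apply: ler_sum => j _; rewrite normrM ler_pM.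
by rewrite sumr_const card_ord mulr_natl.
Qed.

Lemma uniform_limit_continuous_at (R : realType) (S : R -> R) (t : R) :
  (forall e : R, 0 < e -> exists2 f : R -> R, {for t, continuous f} &
      forall s, `|S s - f s| <= e) ->
  {for t, continuous S}.
Proof.
move=> hS; apply/cvgrPdist_le => e e0.
have [|f cf hf] := hS (e / 3); first by rewrite divr_gt0.
move/cvgrPdist_le : cf => /(_ (e / 3)); rewrite divr_gt0// => /(_ isT).
apply: filterS => s hs.
have := hf s; have := hf t; move: hs; rewrite !ler_norml.
by move=> /andP[? ?] /andP[? ?] /andP[? ?]; apply/andP; split; lra.
Qed.

Fixpoint picard (R : realType) (N : nat) (B : 'I_N -> 'I_N -> R -> R)
    (v : 'I_N -> R) (n : nat) : 'I_N -> R -> R :=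
  fun i => if n is n'.+1 then
    fun t => v i + primitive (fun s => \sum_j B i j s * picard B v n' j s) t
  else cst (v i).

Lemma is_derive_integral_curve (R : realType) (N : nat)
    (b u : 'I_N -> R -> R) (v : R) :
  (forall j (t : R), 0 <= t <= 1 -> {for t, continuous (b j)}) ->
  (forall j (t : R), 0 <= t <= 1 -> {for t, continuous (u j)}) ->
  forall t : R, 0 <= t <= 1 ->
  is_derive t 1 (fun t => v + primitive (fun s => \sum_j b j s * u j s) t)
    (\sum_j b j t * u j t).
Proof.
move=> cb cu t t01.
have -> : \sum_j b j t * u j t = 0 + \sum_j b j t * u j t by rewrite add0r.
apply: (@is_deriveD _ _ _ (cst v)).
apply: is_derive_primitive => // s s01; apply: continuous_lin_sum => j.
  exact: cb.
exact: cu.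
Qed.

Lemma is_derive_continuous (R : realType) (f : R -> R) (t df : R) :
  is_derive t 1 f df -> {for t, continuous f}.
Proof.
by move=> [df1 _]; apply: differentiable_continuous; apply/derivable1_diffP.
Qed.

(** The Picard iterates converge geometrically because the weight
    [expR (2 * L * t)] makes the Picard operator a contraction of ratio 1/2.
    Their limit [S] is continuous, hence integrable, and the integral [U] of
    [B * S] has the required derivative; [U = S] since both are limits of the
    iterates. *)
Lemma linear_ode (R : realType) (N : nat) (B : 'I_N -> 'I_N -> R -> R)
    (v : 'I_N -> R) :
  (forall i j (t : R), 0 <= t <= 1 -> {for t, continuous (B i j)}) ->
  exists U : 'I_N -> R -> R, (forall i, U i 0 = v i) /\
    forall i (t : R), 0 <= t <= 1 ->
      is_derive t 1 (U i) (\sum_j B i j t * U j t).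
Proof.
move=> cB.
have [C hC] : exists C : R, forall i j (t : R), 0 <= t <= 1 -> `|B i j t| <= C.
  have [c hc] := choice (fun p : 'I_N * 'I_N =>
    bounded_itv01 (fun t => cB p.1 p.2 t)).
  exists (\sum_p `|c p|) => i j t t01.
  apply: le_trans (hc (i, j) t t01) _; apply: le_trans (ler_norm _) _.
  by rewrite (bigD1 (i, j))//= lerDl sumr_ge0.
pose P := picard B v.
have cP n : forall i (t : R), 0 <= t <= 1 -> {for t, continuous (P n i)}.
  elim: n => [|n IH] i t t01; first exact: cvg_cst.
  apply: is_derive_continuous.
  by apply: is_derive_integral_curve t01 => j s s01; [exact: cB|exact: IH].
have dP n i (t : R) : 0 <= t <= 1 ->
    is_derive t 1 (P n.+1 i) (\sum_j B i j t * P n j t).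
  move=> t01.
  by apply: is_derive_integral_curve t01 => j s s01; [exact: cB|exact: cP].
have P0 n i : P n i 0 = v i by case: n => // n; rewrite /P/= primitive0 addr0.
pose V : R := \sum_j `|v j|.
have hV i : `|v i| <= V by rewrite /V (bigD1 i)//= lerDl sumr_ge0.
have V0 : 0 <= V by exact: sumr_ge0.
pose L : R := N%:R * `|C|.
have {}hC i j (t : R) : 0 <= t <= 1 -> `|B i j t| <= `|C|.
  by move=> t01; apply: le_trans (hC i j t t01) (ler_norm _).
have L0 : 0 <= L by rewrite mulr_ge0.
have de (c t : R) : is_derive t 1 (fun t : R => c * expR (2 * L * t))
    (c * (2 * L * expR (2 * L * t))).
  by apply: is_derive_eq; rewrite /GRing.scale/=; ring.
(* Integration of the weight against the factor [L] of the Picard operator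
   gains the ratio 1/2. *)
have PS n : forall i (t : R), 0 <= t <= 1 ->
    `|P n.+1 i t - P n i t| <= V / 2 ^+ n * expR (2 * L * t).
  elim: n => [|n IH] i t t01.
    have := @derive_abs_le_increment R (P 1%N i) _ _ _ 1 (dP 0%N i)
      (fun s _ => de V s) _ t t01.
    rewrite P0 expr0 divr1 mulr0 expR0 mulr1 => H.
    apply: le_trans (H _) _; last by rewrite lerBlDr lerDl.
    move=> s s01; apply: le_trans (norm_lin_sum_le (fun j => hC i j s s01) hV) _.
    have /andP[s0 s1] := s01.
    have h : 1 <= expR (2 * L * s) by rewrite -[leLHS]expR0 ler_expR !mulr_ge0.
    have h2 : 0 <= L * V by rewrite mulr_ge0.
    by rewrite mulrA -/L; nra.
  have dd (s : R) : 0 <= s <= 1 -> is_derive s 1 (P n.+2 i - P n.+1 i)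
      (\sum_j B i j s * (P n.+1 j s - P n j s)).
    move=> s01; under eq_bigr do rewrite mulrBr.
    by rewrite sumrB; exact: (is_deriveB (dP n.+1 i s s01) (dP n i s s01)).
  have := derive_abs_le_increment dd (fun s _ => de (V / 2 ^+ n.+1) s) _ t01.
  rewrite !fctE !P0 subrr subr0 mulr0 expR0 mulr1 => H.
  apply: le_trans (H _) _; last by rewrite lerBlDr lerDl divr_ge0 ?exprn_ge0.
  move=> s s01; apply: le_trans (norm_lin_sum_le (fun j => hC i j s s01) (fun j => IH j s s01)) _.
  rewrite mulrA -/L exprS invfM.
  rewrite [leRHS](_ : _ = L * (V / 2 ^+ n * expR (2 * L * s)))//.
  by field; rewrite expf_neq0.
pose K : R := V * expR (2 * L).
have K0 : 0 <= K by rewrite mulr_ge0 ?expR_ge0.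
have lim i (t : R) : 0 <= t <= 1 ->
    exists l, forall n, `|l - P n i t| <= 2 * K / 2 ^+ n.
  move=> t01; apply: geometric_limit => n; apply: le_trans (PS n i t t01) _.
  rewrite /K mulrAC ler_wpM2r// ler_wpM2l// ler_expR.
  by case/andP: t01 => _ t1; rewrite ler_piMr// mulr_ge0.
have [S hS] : exists S : 'I_N -> R -> R, forall i t n,
    `|S i t - P n i (clamp t)| <= 2 * K / 2 ^+ n.
  have [S hS] := choice (fun p : 'I_N * R => lim p.1 _ (clamp_itv p.2)).
  by exists (fun i t => S (i, t)) => i t; exact: hS.
have small (c e : R) : 0 < e -> exists n, c / 2 ^+ n <= e.
  move=> e0; apply: contrapT => /forallNP h.
  have c0 : 0 < c.
    by have /negP := h 0%N; rewrite expr0 divr1 -ltNge; apply: lt_trans.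
  have := @eq0_geometric R e c; rewrite gtr0_norm// => H.
  have : e = 0 by apply: H => n; have /negP := h n; rewrite -ltNge => /ltW.
  by move=> e00; rewrite e00 ltxx in e0.
have cS i t : {for t, continuous (S i)}.
  apply: uniform_limit_continuous_at => e e0.
  have [n hn] := small (2 * K) e e0.
  exists (P n i \o @clamp R); last by move=> s; apply: le_trans (hS i s n) hn.
  apply: continuous_comp; first exact: clamp_continuous.
  by apply: cP; exact: clamp_itv.
pose U i t := v i + primitive (fun s => \sum_j B i j s * S j s) t.
have dU i (t : R) : 0 <= t <= 1 -> is_derive t 1 (U i) (\sum_j B i j t * S j t).
  by move=> t01; apply: is_derive_integral_curve (t01) => j s s01; [exact: cB|exact: cS].
have U0 i : U i 0 = v i by rewrite /U primitive0 addr0.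
have US i (t : R) : 0 <= t <= 1 -> U i t = S i t.
  move=> t01; apply/eqP; rewrite -subr_eq0; apply/eqP.
  apply: (@eq0_geometric _ _ (L * (2 * K) + K)) => n.
  clearbody U.
  have dd (s : R) : 0 <= s <= 1 -> is_derive s 1 (U i - P n.+1 i)
      (\sum_j B i j s * (S j s - P n j s)).
    move=> s01; under eq_bigr do rewrite mulrBr.
    by rewrite sumrB; exact: (is_deriveB (dU i s s01) (dP n i s s01)).
  have dl (s : R) : 0 <= s <= 1 ->
      is_derive s 1 (fun s => L * (2 * K / 2 ^+ n) * s) (L * (2 * K / 2 ^+ n)).
    by move=> s01; apply: is_derive_eq; rewrite /GRing.scale/= mulr1.
  have := derive_abs_le_increment dd dl _ t01.
  rewrite !fctE U0 !P0 subrr subr0 mulr0 subr0 => H.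
  have /H {}H : forall s : R, 0 <= s <= 1 ->
      `|\sum_j B i j s * (S j s - P n j s)| <= L * (2 * K / 2 ^+ n).
    move=> s s01; have hSn j : `|S j s - P n j s| <= 2 * K / 2 ^+ n.
      by have := hS j s n; rewrite clamp_id.
    apply: le_trans (norm_lin_sum_le (fun j => hC i j s s01) hSn) _.
    by rewrite mulrA.
  have := hS i t n.+1; rewrite clamp_id// exprS invfM => HS.
  rewrite -(subrK (P n.+1 i t) (U i t)) -addrA.
  apply: le_trans (ler_normD _ _) _; rewrite [X in _ + X]distrC.
  have h1 : 0 <= L * (2 * K / 2 ^+ n) by rewrite !mulr_ge0// invr_ge0 exprn_ge0.
  have /andP[t0 t1] := t01.
  have -> : (L * (2 * K) + K) / 2 ^+ n
     = L * (2 * K / 2 ^+ n) + 2 * K * (2^-1 / 2 ^+ n).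
    by field; rewrite expf_neq0.
  by apply: lerD => //; apply: le_trans H _; rewrite ler_piMr.
exists U; split; first exact: U0.
move=> i t t01.
have -> : \sum_j B i j t * U j t = \sum_j B i j t * S j t.
  by apply: eq_bigr => j _; rewrite US.
exact: dU.
Qed.

(** * Parallel sections of a linear connection on a convex domain *)

Lemma diff_partial (R : realType) (n : nat) (f : 'rV[R]_n -> R)
    (x h : 'rV[R]_n) :
  differentiable f x -> 'd f x h = \sum_a h 0 a * partial a f x.
Proof.
move=> df; rewrite {1}[h]row_sum_delta linear_sum; apply: eq_bigr => a _.
by rewrite linearZ /partial deriveE.
Qed.

Lemma is_derive_line (R : realType) (n : nat) (f : 'rV[R]_n -> R)
    (y h : 'rV[R]_n) (t : R) :
  differentiable f (y + t *: h) ->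
  is_derive t 1 (fun s => f (y + s *: h))
    (\sum_a h 0 a * partial a f (y + t *: h)).
Proof.
move=> df.
have hl : is_diff t (fun s : R => y + s *: h) (fun s : R => s *: h).
  have -> : (fun s : R => s *: h) = 0 + ( *:%R^~ h) by apply/funext => s; rewrite fctE add0r.
  apply: (@is_diffD _ _ _ (cst y)).
have hc : is_diff t (f \o (fun s : R => y + s *: h))
   ('d f (y + t *: h) \o (fun s : R => s *: h)).
  apply: is_diff_comp; exact: differentiableP.
apply: DeriveDef.
  by apply/derivable1_diffP; case: hc.
rewrite deriveE; last by case: hc.
have -> : 'd (fun s : R => f (y + s *: h)) t = 'd f (y + t *: h) \o (fun s : R => s *: h) :> (R -> R).
  by have [_] := hc.
by rewrite /= scale1r diff_partial.
Qed.

Lemma convex_segment (R : realType) (n : nat) (M : set 'rV[R]_n)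
    (x y : 'rV[R]_n) (t : R) :
  convex_set M -> M x -> M y -> 0 <= t <= 1 -> M (x + t *: (y - x)).
Proof.
move=> cM Mx My /andP[t0 t1].
have := cM y x (Itv01 t0 t1) (mem_set My) (mem_set Mx).
rewrite inE; congr M.
rewrite /conv/=/isConvexSpace.conv/= /unstable.onem scalerBl scalerBr scale1r.
by rewrite addrCA.
Qed.

(** A linear approximation is the Frechet derivative; this is how the functions
    constructed below are shown to be differentiable. *)
Lemma differentiable_of_linear_approx (R : realType) (n : nat)
    (f : 'rV[R]_n -> R) (x : 'rV[R]_n) (l : 'I_n -> R) :
  (forall e : R, 0 < e -> \forall h \near (0 : 'rV[R]_n),
     `|f (x + h) - f x - \sum_a h 0 a * l a| <= e * `|h|) ->
  differentiable f x /\ forall a, partial a f x = l a.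
Proof.
move=> hf.
pose L (h : 'rV[R]_n) : R := \sum_a h 0 a * l a.
have linL : linear L.
  move=> c u v; rewrite /L scaler_sumr -big_split/=; apply: eq_bigr => a _.
  by rewrite !mxE mulrDl /GRing.scale/= mulrA.
pose lL := GRing.isLinear.Build R _ R _ L linL.
pose FL : {linear 'rV[R]_n -> R} := HB.pack L lL.
have cL : continuous (FL : 'rV[R]_n -> R).
  move=> y; rewrite /= (_ : L = \sum_a (fun h : 'rV[R]_n => h 0 a * l a)); last first.
    by apply/funext => r; rewrite fct_sumE.
  apply: differentiable_continuous; apply: differentiable_sum => a.
  by apply: differentiableM => //; exact: differentiable_coord.
have E : f \o shift x = cst (f x) + FL +o_ (0 : 'rV[R]_n) id.
  apply/eqaddoP => e e0; have := hf e e0; apply: filterS => h.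
  by rewrite !fctE /= (addrC h x) opprD addrA.
have dE := diff_unique cL E.
have df : differentiable f x.
  apply/diff_locallyP; split; first by rewrite dE.
  by rewrite dE.
split => // a; rewrite /partial deriveE// dE/= /L (bigD1 a)//= big1 ?addr0.
  by rewrite mxE !eqxx mul1r.
by move=> b ba; rewrite mxE (negbTE ba) andbF mul0r.
Qed.

Lemma segment_mx_continuous (R : realType) (n : nat) (x k : 'rV[R]_n) (t : R) :
  {for t, continuous (fun t : R => x + t *: k)}.
Proof. by apply: cvgD; [exact: cvg_cst|exact: scalel_continuous]. Qed.

Lemma norm_coord_le (R : realType) (n : nat) (h : 'rV[R]_n) (a : 'I_n) :
  `|h 0 a| <= `|h|.
Proof.
by rewrite [leRHS]/Num.Def.normr/= mx_normrE; apply: (le_bigmax _ _ (0, a)).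
Qed.

Lemma taylor_segment (R : realType) (n : nat) (f : 'rV[R]_n -> R)
    (y k : 'rV[R]_n) (l : 'I_n -> R) (e : R) :
  (forall s : R, 0 <= s <= 1 -> differentiable f (y + s *: k)) ->
  (forall a (s : R), 0 <= s <= 1 -> `|partial a f (y + s *: k) - l a| <= e) ->
  `|f (y + k) - f y - \sum_a k 0 a * l a| <= n%:R * (`|k| * e).
Proof.
move=> df hl.
pose g (s : R) := f (y + s *: k) - (\sum_a k 0 a * l a) * s.
have dg (s : R) : 0 <= s <= 1 -> is_derive s 1 g
    (\sum_a k 0 a * (partial a f (y + s *: k) - l a)).
  move=> s01; under eq_bigr do rewrite mulrBr.
  rewrite sumrB; apply: is_deriveB; first exact: is_derive_line (df s s01).
  by apply: is_derive_eq; rewrite /GRing.scale/= mulr1.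
have dl (s : R) : 0 <= s <= 1 ->
    is_derive s 1 (fun s => n%:R * (`|k| * e) * s) (n%:R * (`|k| * e)).
  by move=> s01; apply: is_derive_eq; rewrite /GRing.scale/= mulr1.
have := derive_abs_le_increment dg dl; rewrite /g => H.
have := H _ 1; rewrite ler01 lexx scale1r scale0r addr0 !mulr0 !mulr1 !subr0.
move=> {}H; rewrite addrAC; apply: H => // s s01.
by apply: norm_lin_sum_le => a; [exact: norm_coord_le|exact: hl].
Qed.

(** The first order expansion along a curve is uniform by compactness of
    [[0, 1]]: near each [t0] the partial derivatives vary by less than [e'], and
    finitely many such neighbourhoods cover the interval. *)
Lemma uniform_taylor (R : realType) (n : nat) (M : set 'rV[R]_n)
    (f : 'rV[R]_n -> R) (c : R -> 'rV[R]_n) (e : R) :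
  open M -> (forall x, M x -> differentiable f x) ->
  (forall a x, M x -> {for x, continuous (partial a f)}) ->
  (forall t : R, 0 <= t <= 1 -> {for t, continuous c}) ->
  (forall t : R, 0 <= t <= 1 -> M (c t)) -> 0 < e ->
  \forall h \near (0 : 'rV[R]_n), forall t : R, 0 <= t <= 1 ->
    `|f (c t + t *: h) - f (c t)
      - t * \sum_a h 0 a * partial a f (c t)| <= e * `|h|.
Proof.
move=> oM df cdf cc Mc e0.
have := (compact_near_coveringP `[0, 1 : R]).1 (@segment_compact R 0 1).
move=> /(_ 'rV[R]_n (nbhs (0 : 'rV[R]_n)) (fun h t => 0 <= t <= 1 ->
    `|f (c t + t *: h) - f (c t)
      - t * \sum_a h 0 a * partial a f (c t)| <= e * `|h|) _) H.
apply: filterS (H _); first by move=> h hh t t01; apply: hh => //=; rewrite in_itv.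
move=> t0; rewrite /= in_itv/= => t001.
pose e' := e / (2 * (n%:R + 1)).
have e'0 : 0 < e' by rewrite divr_gt0// mulr_gt0// ltr_wpDl.
have near_y : \forall z \near c t0, M z /\
    forall a, `|partial a f (c t0) - partial a f z| <= e'.
  have h1 : \forall z \near c t0, M z.
    by apply: open_nbhs_nbhs; split => //; exact: Mc.
  have h2 : \forall z \near c t0,
      forall a, `|partial a f (c t0) - partial a f z| <= e'.
    apply: (@filter_forall _ 'I_n
      (fun a z => `|partial a f (c t0) - partial a f z| <= e')
      _ (nbhs_filter (c t0))) => a.
    by have /cvgrPdist_le := cdf a _ (Mc _ t001); apply.
  by apply: filterS2 h1 h2 => z.
move/nbhs_normP: near_y => [r /= r0 hr].
have ballc : \forall t \near t0, `|c t0 - c t| < r / 2.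
  by have /cvgrPdist_lt := cc t0 t001; apply; rewrite divr_gt0.
have ballh : \forall h \near (0 : 'rV[R]_n), `|h| < r / 2.
  by apply: nbhs0_lt; rewrite divr_gt0.
exists ([set t | `|c t0 - c t| < r / 2], [set h | `|h| < r / 2]) => //.
move=> [t h] /= [ht hh] t01.
have inr (s : R) : 0 <= s <= 1 -> `|c t0 - (c t + s *: (t *: h))| < r.
  move=> /andP[s0 s1]; have /andP[t0' t1] := t01.
  rewrite opprD addrA (le_lt_trans (ler_normB _ _))// (splitr r) ltrD//.
  rewrite scalerA normrZ (le_lt_trans _ hh)// ler_piMl//.
  by rewrite normrM !ger0_norm// mulr_ile1.
have inr0 : `|c t0 - c t| < r.
  by rewrite (lt_trans ht)// ltr_pdivrMr// ltr_pMr// ltr1n.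
rewrite mulr_sumr (_ : \sum_a _ = \sum_a (t *: h) 0 a * partial a f (c t)); last first.
  by apply: eq_bigr => a _; rewrite mxE mulrA.
apply: le_trans (@taylor_segment _ _ f (c t) (t *: h) _ (e' + e') _ _) _.
- by move=> s s01; apply: df; have [] := hr _ (inr s s01).
- move=> a s s01; rewrite -(subrKA (partial a f (c t0))).
  apply: le_trans (ler_normD _ _) _.
  apply: lerD; last by have [_] := hr _ inr0; exact.
  by rewrite distrC; have [_] := hr _ (inr s s01); exact.
- have /andP[t0' t1] := t01.
  apply: (@le_trans _ _ (n%:R * (`|h| * (e' + e')))).
    apply: ler_wpM2l => //; apply: ler_wpM2r; first by rewrite addr_ge0// ltW.
    by rewrite normrZ ler_piMl// ger0_norm.
  have -> : e' + e' = e / (n%:R + 1).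
    by rewrite /e'; field; rewrite lt0r_neq0// ltr_wpDl.
  rewrite mulrCA mulrC ler_wpM2r// mulrCA ler_piMr ?(ltW e0)//.
  by rewrite ler_pdivrMr ?ltr_wpDl// mul1r lerDl.
Qed.

Definition connection_along (R : realType) (n N : nat)
    (A : 'I_n -> 'rV[R]_n -> 'M[R]_N) (k y : 'rV[R]_n) : 'M[R]_N :=
  \sum_a k 0 a *: A a y.

Definition derive_connection (R : realType) (n N : nat)
    (A : 'I_n -> 'rV[R]_n -> 'M[R]_N) (h k y : 'rV[R]_n) : 'M[R]_N :=
  \matrix_(i, j)
    \sum_a h 0 a * \sum_b k 0 b * partial b (fun z => A a z i j) y.

Definition parallel_section (R : realType) (n N : nat) (M : set 'rV[R]_n)
    (A : 'I_n -> 'rV[R]_n -> 'M[R]_N) (u : 'rV[R]_n -> 'cV[R]_N) : Prop :=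
  forall x, M x -> forall i, differentiable (fun y => u y i 0) x /\
    forall a, partial a (fun y => u y i 0) x = (A a x *m u x) i 0.

(** The integrability condition of the system [partial a u = A a *m u]. *)
Definition flat_connection (R : realType) (n N : nat) (M : set 'rV[R]_n)
    (A : 'I_n -> 'rV[R]_n -> 'M[R]_N) : Prop :=
  forall x, M x -> forall a b i j,
    partial a (fun y => A b y i j) x - partial b (fun y => A a y i j) x
    = (A a x *m A b x - A b x *m A a x) i j.

Lemma connection_alongE (R : realType) (n N : nat)
    (A : 'I_n -> 'rV[R]_n -> 'M[R]_N) (k y : 'rV[R]_n) (i j : 'I_N) :
  connection_along A k y i j = \sum_a k 0 a * A a y i j.
Proof. by rewrite /connection_along summxE; apply: eq_bigr => a _; rewrite mxE. Qed.

Lemma is_derive_mulmx_col (R : realType) (N : nat) (B dB : R -> 'M[R]_N)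
    (u du : R -> 'cV[R]_N) (t : R) (i : 'I_N) :
  (forall j, is_derive t 1 (fun s => B s i j) (dB t i j)) ->
  (forall j, is_derive t 1 (fun s => u s j 0) (du t j 0)) ->
  is_derive t 1 (fun s => (B s *m u s) i 0)
    ((dB t *m u t + B t *m du t) i 0).
Proof.
move=> hB hu.
rewrite (_ : (fun s => _) = \sum_j (fun s => B s i j * u s j 0)); last first.
  by apply/funext => s; rewrite mxE fct_sumE.
rewrite !mxE -big_split/=; apply: is_derive_sum => j.
have h1 := hB j; have h2 := hu j.
by apply: is_derive_eq; rewrite /GRing.scale/=; ring.
Qed.

Lemma is_derive_connection_along (R : realType) (n N : nat)
    (A : 'I_n -> 'rV[R]_n -> 'M[R]_N) (h y k : 'rV[R]_n) (t : R) (i j : 'I_N) :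
  (forall a, differentiable (fun z => A a z i j) (y + t *: k)) ->
  is_derive t 1 (fun s => connection_along A h (y + s *: k) i j)
    (derive_connection A h k (y + t *: k) i j).
Proof.
move=> dA.
rewrite (_ : (fun s => _)
    = \sum_a (fun s : R => h 0 a * A a (y + s *: k) i j)); last first.
  by apply/funext => s; rewrite connection_alongE fct_sumE.
rewrite mxE; apply: is_derive_sum => a.
have hd := is_derive_line (dA a).
exact: is_deriveZ.
Qed.

(** The form in which flatness enters the error equation of [flat_variation]: it
    extends from coordinate directions to arbitrary ones by bilinearity. *)
Lemma flat_connection_along (R : realType) (n N : nat) (M : set 'rV[R]_n)
    (A : 'I_n -> 'rV[R]_n -> 'M[R]_N) (h k y : 'rV[R]_n) :
  flat_connection M A -> M y ->
  derive_connection A h k y = derive_connection A k h y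
    + connection_along A k y *m connection_along A h y
    - connection_along A h y *m connection_along A k y.
Proof.
move=> fA My; apply/matrixP => i j.
pose X (k h : 'rV[R]_n) := (\sum_b \sum_a (k 0 b * h 0 a) *: (A b y *m A a y)).
have cc (k' h' : 'rV[R]_n) :
    connection_along A k' y *m connection_along A h' y = X k' h'.
  rewrite /connection_along mulmx_suml; apply: eq_bigr => b _.
  rewrite mulmx_sumr; apply: eq_bigr => a _.
  by rewrite -scalemxAl -scalemxAr scalerA.
rewrite !cc.
have XE (k' h' : 'rV[R]_n) : X k' h' i j
    = \sum_b \sum_a k' 0 b * h' 0 a * (A b y *m A a y) i j.
  rewrite /X summxE; apply: eq_bigr => b _; rewrite summxE.
  by apply: eq_bigr => a _; rewrite mxE.
have dE (k' h' : 'rV[R]_n) : derive_connection A k' h' y i j =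
    \sum_b \sum_a k' 0 b * h' 0 a * partial a (fun z => A b z i j) y.
  rewrite mxE; apply: eq_bigr => b _; rewrite mulr_sumr.
  by apply: eq_bigr => a _; rewrite mulrA.
have addE (D Y Z : 'M[R]_N) : (D + Y - Z) i j = D i j + Y i j - Z i j.
  by rewrite !mxE.
rewrite addE !dE !XE [X in _ = X + _ - _]exchange_big/=.
rewrite [X in _ = _ + X - _]exchange_big/= -big_split/= -sumrB.
apply: eq_bigr => a _; rewrite -big_split/= -sumrB; apply: eq_bigr => b _.
have subE (Y Z : 'M[R]_N) : (Y - Z) i j = Y i j - Z i j by rewrite !mxE.
have := fA y My b a i j; rewrite subE => H.
have -> : partial b (fun y => A a y i j) y = partial a (fun y => A b y i j) y
    + ((A b y *m A a y) i j - (A a y *m A b y) i j) by rewrite -H; ring.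
by ring.
Qed.

(** The restriction of [u] to a segment issued from [x0] solves a linear
    differential equation with zero initial value, so Gronwall's inequality
    applies to it. *)
Lemma parallel_section_unique (R : realType) (n N : nat) (M : set 'rV[R]_n)
    (A : 'I_n -> 'rV[R]_n -> 'M[R]_N) (u : 'rV[R]_n -> 'cV[R]_N)
    (x0 : 'rV[R]_n) :
  convex_set M ->
  (forall a i j x, M x -> differentiable (fun y => A a y i j) x) ->
  parallel_section M A u -> M x0 -> u x0 = 0 -> forall x, M x -> u x = 0.
Proof.
move=> cM dA pu Mx0 u0 x Mx.
pose k := x - x0.
have Mc (t : R) : 0 <= t <= 1 -> M (x0 + t *: k).
  by move=> t01; exact: convex_segment.
pose w i (t : R) : R := u (x0 + t *: k) i 0.
pose dw i (t : R) : R :=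
  (connection_along A k (x0 + t *: k) *m u (x0 + t *: k)) i 0.
have hw i (t : R) : 0 <= t <= 1 -> is_derive t 1 (w i) (dw i t).
  move=> t01; have [du pdu] := pu _ (Mc t t01) i.
  have := is_derive_line du.
  congr (is_derive _ _ _ _); rewrite /dw /connection_along mulmx_suml summxE.
  by apply: eq_bigr => a _; rewrite pdu -scalemxAl [RHS]mxE.
have cc (p : 'I_N * 'I_N) (t : R) : 0 <= t <= 1 ->
    {for t, continuous (fun s : R => connection_along A k (x0 + s *: k) p.1 p.2)}.
  move=> t01; apply: is_derive_continuous.
  by apply: is_derive_connection_along => a; apply: dA; exact: Mc.
have [C hC] := choice (fun p => bounded_itv01 (cc p)).
pose L : R := \sum_p `|C p|.
have hL i j (t : R) : 0 <= t <= 1 ->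
    `|connection_along A k (x0 + t *: k) i j| <= L.
  move=> t01; apply: le_trans (hC (i, j) t t01) _.
  apply: le_trans (ler_norm _) _.
  by rewrite /L (bigD1 (i, j))//= lerDl sumr_ge0.
have L0 : 0 <= L by exact: sumr_ge0.
have := gronwall L0 (lexx 0) hw _ _ => H.
apply/matrixP => i j; rewrite ord1 [RHS]mxE; apply/normr0_eq0.
apply/eqP; rewrite eq_le normr_ge0 andbT.
have -> : u x i 0 = w i 1 by rewrite /w scale1r /k addrC subrK.
rewrite -[leRHS](mul0r (expR ((2 * L + 1) * N%:R))); apply: H.
- move=> {}i t t01; rewrite /dw mxE addr0.
  apply: le_trans (ler_norm_sum _ _ _) _; rewrite mulr_sumr.
  by apply: ler_sum => l _; rewrite normrM ler_wpM2r// hL.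
- by move=> {}i; rewrite /w scale0r addr0 u0 mxE.
- by rewrite ler01 lexx.
Qed.

Lemma nbhs_forall (T : topologicalType) (I : finType) (x : T)
    (P : I -> T -> Prop) :
  (forall i, \forall y \near x, P i y) -> \forall y \near x, forall i, P i y.
Proof. exact: filter_forall. Qed.

Lemma bounded_itv01_fin (R : realType) (I : finType) (g : I -> R -> R) :
  (forall i (t : R), 0 <= t <= 1 -> {for t, continuous (g i)}) ->
  exists2 C : R, 0 <= C & forall i (t : R), 0 <= t <= 1 -> `|g i t| <= C.
Proof.
move=> cg; have [c hc] := choice (fun i => bounded_itv01 (cg i)).
exists (\sum_i `|c i|); first exact: sumr_ge0.
move=> i t t01; apply: le_trans (hc i t t01) _; apply: le_trans (ler_norm _) _.
by rewrite (bigD1 i)//= lerDl sumr_ge0.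
Qed.

(** The connection along the segment to [x + h], compared with the one along
    the segment to [x]: the first bound is the linear approximation, with
    remainder [o(h)] uniformly in [t]; the others are the crude bounds needed to
    absorb the quadratic terms. *)
Lemma connection_along_expansion (R : realType) (n N : nat)
    (M : set 'rV[R]_n) (A : 'I_n -> 'rV[R]_n -> 'M[R]_N) (x0 k : 'rV[R]_n) :
  open M ->
  (forall a i j, smooth_on M (fun y => A a y i j)) ->
  (forall t : R, 0 <= t <= 1 -> M (x0 + t *: k)) ->
  exists2 K : R, 0 <= K & forall e : R, 0 < e -> e <= 1 ->
  \forall h \near (0 : 'rV[R]_n), forall t : R, 0 <= t <= 1 -> forall i j,
    let c := x0 + t *: k in
    [/\ `|(connection_along A (k + h) (c + t *: h) - connection_along A k c
          - connection_along A h c - t *: derive_connection A k h c) i j|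
          <= K * (e * `|h|),
        `|(connection_along A (k + h) (c + t *: h)
          - connection_along A k c) i j| <= K * `|h|,
        `|connection_along A h c i j| <= K * `|h| &
        `|connection_along A (k + h) (c + t *: h) i j| <= K].
Proof.
move=> oM sA Mc.
pose c (t : R) := x0 + t *: k.
have cc (t : R) : 0 <= t <= 1 -> {for t, continuous c}.
  by move=> _; exact: segment_mx_continuous.
have [K0 K00 hK0] : exists2 C : R, 0 <= C &
    forall (p : 'I_n * 'I_N * 'I_N) (t : R), 0 <= t <= 1 ->
      `|A p.1.1 (c t) p.1.2 p.2| <= C.
  apply: (@bounded_itv01_fin R _ (fun p t => A p.1.1 (c t) p.1.2 p.2)).
  move=> [[a i] j] t t01.
  apply: (@continuous_comp _ _ _ c (fun y => A a y i j)); first exact: cc.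
  by apply: differentiable_continuous; apply: (sA a i j [::]); exact: Mc.
have [K1 K10 hK1] : exists2 C : R, 0 <= C &
    forall (p : 'I_n * 'I_n * 'I_N * 'I_N) (t : R), 0 <= t <= 1 ->
      `|partial p.1.1.2 (fun y => A p.1.1.1 y p.1.2 p.2) (c t)| <= C.
  apply: (@bounded_itv01_fin R _ (fun p t =>
    partial p.1.1.2 (fun y => A p.1.1.1 y p.1.2 p.2) (c t))).
  move=> [[[a b] i] j] t t01.
  apply: (@continuous_comp _ _ _ c (partial b (fun y => A a y i j))).
    exact: cc.
  by apply: differentiable_continuous; apply: (sA a i j [:: b]); exact: Mc.
pose m : R := n%:R; have m0 : 0 <= m by exact: ler0n.
pose Ka := m * (`|k| + 1) + m * (m * K1).
pose Kb := Ka + m * K0 + m * (`|k| * (m * K1)).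
have Ka0 : 0 <= Ka by rewrite addr_ge0 ?mulr_ge0 ?addr_ge0.
have Kb0 : 0 <= Kb by rewrite !addr_ge0 ?mulr_ge0.
exists (Kb + m * (`|k| * K0)); first by rewrite addr_ge0 ?mulr_ge0.
move=> e e0 e1.
have he : \forall h \near (0 : 'rV[R]_n), `|h| < e by exact: nbhs0_lt.
have hTp (p : 'I_n * 'I_N * 'I_N) : \forall h \near (0 : 'rV[R]_n),
    forall t : R, 0 <= t <= 1 ->
    `|A p.1.1 (c t + t *: h) p.1.2 p.2 - A p.1.1 (c t) p.1.2 p.2
      - t * \sum_a h 0 a * partial a (fun y => A p.1.1 y p.1.2 p.2) (c t)|
    <= e * `|h|.
  move: p => [[a i] j].
  apply: (@uniform_taylor _ _ M (fun y => A a y i j)) => //.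
  - by move=> x Mx; exact: (sA a i j [::]).
  - move=> b x Mx; apply: differentiable_continuous.
    exact: (sA a i j [:: b]).
have hT := nbhs_forall hTp.
apply: filterS2 he hT => h /ltW he hT t t01 i j.
have /andP[t0 t1] := t01.
have h1 : `|h| <= 1 by exact: le_trans e1.
rewrite -/(c t); move: (c t) (hT ^~ t) (fun p => hK0 p t t01)
  (fun p => hK1 p t t01) => y hTt hK0t hK1t.
pose D b : R := \sum_a h 0 a * partial a (fun z => A b z i j) y.
have hD b : `|D b| <= m * (`|h| * K1).
  apply: norm_lin_sum_le => a; first exact: norm_coord_le.
  exact: (hK1t (b, a, i, j)).
pose T b : R := A b (y + t *: h) i j - A b y i j - t * D b.
have hTb b : `|T b| <= e * `|h| by exact: (hTt (b, i, j) t01).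
have E1 : (connection_along A (k + h) (y + t *: h) - connection_along A k y
    - connection_along A h y - t *: derive_connection A k h y) i j
    = \sum_b (k + h) 0 b * T b + t * \sum_b h 0 b * D b.
  have -> (X Y Z W : 'M[R]_N) : (X - Y - Z - t *: W) i j
    = X i j - Y i j - Z i j - t * W i j by rewrite !mxE.
  rewrite !connection_alongE /derive_connection [X in t * X]mxE !mulr_sumr.
  rewrite -!sumrB -big_split/=; apply: eq_bigr => b _.
  by rewrite !mxE -/(D b) /T; ring.
have hR : `|\sum_b (k + h) 0 b * T b + t * \sum_b h 0 b * D b|
    <= Ka * (e * `|h|).
  apply: le_trans (ler_normD _ _) _; rewrite /Ka mulrDl; apply: lerD.
    rewrite -mulrA; apply: norm_lin_sum_le => // b.
    apply: le_trans (norm_coord_le _ _) _.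
    by apply: le_trans (ler_normD _ _) _; rewrite lerD2l.
  rewrite normrM (ger0_norm t0).
  have := norm_lin_sum_le (norm_coord_le h) hD; rewrite -/m => H.
  have h2 : `|h| * `|h| <= e * `|h| by rewrite ler_wpM2r.
  have h3 : 0 <= m * (m * K1) by rewrite !mulr_ge0.
  have h4 := ler_wpM2l h3 h2.
  apply: le_trans (_ : `|\sum_b h 0 b * D b| <= _); first by rewrite ler_piMl.
  apply: le_trans H _; apply: le_trans h4.
  by rewrite le_eqVlt; apply/orP; left; apply/eqP; ring.
have hH : `|connection_along A h y i j| <= m * K0 * `|h|.
  rewrite connection_alongE -mulrA [K0 * _]mulrC.
  by apply: norm_lin_sum_le => a; [exact: norm_coord_le|exact: (hK0t (a, i, j))].
have hd : `|t * derive_connection A k h y i j|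
    <= m * (`|k| * (m * K1)) * `|h|.
  rewrite normrM (ger0_norm t0).
  apply: le_trans (_ : `|derive_connection A k h y i j| <= _).
    by rewrite ler_piMl.
  rewrite /derive_connection mxE.
  have := norm_lin_sum_le (norm_coord_le k) hD; rewrite -/m => H.
  by apply: le_trans H _; rewrite le_eqVlt; apply/orP; left; apply/eqP; ring.
have hY : `|connection_along A k y i j| <= m * (`|k| * K0).
  rewrite connection_alongE.
  by apply: norm_lin_sum_le => a; [exact: norm_coord_le|exact: (hK0t (a, i, j))].
pose E : R := (connection_along A (k + h) (y + t *: h)
  - connection_along A k y - connection_along A h y
  - t *: derive_connection A k h y) i j.
rewrite -/E in E1 *.
have {}hR : `|E| <= Ka * (e * `|h|) by rewrite E1.
have {}E1 : (connection_along A (k + h) (y + t *: h) - connection_along A k y) i j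
    = E + connection_along A h y i j + t * derive_connection A k h y i j.
  have XYE (X Y Z W : 'M[R]_N) : (X - Y) i j
    = (X - Y - Z - t *: W) i j + Z i j + t * W i j by rewrite !mxE; ring.
  exact: XYE.
have hk0 : 0 <= m * (`|k| * K0) by rewrite !mulr_ge0.
have eh : e * `|h| <= `|h| by rewrite ler_piMl.
have hXY : `|(connection_along A (k + h) (y + t *: h)
    - connection_along A k y) i j| <= Kb * `|h|.
  rewrite E1; apply: le_trans (ler_normD _ _) _.
  apply: le_trans (lerD (ler_normD _ _) (lexx _)) _.
  rewrite /Kb [leRHS]mulrDl [X in _ <= X + _]mulrDl.
  apply: lerD => //; apply: lerD => //.
  by apply: le_trans hR _; rewrite ler_wpM2l.
have KabE : Ka <= Kb by rewrite /Kb -addrA lerDl addr_ge0 ?mulr_ge0.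
split.
- apply: le_trans hR _; rewrite ler_wpM2r ?mulr_ge0 ?(ltW e0)//.
  by apply: le_trans KabE _; rewrite lerDl.
- by apply: le_trans hXY _; rewrite ler_wpM2r// lerDl.
- apply: le_trans hH _; rewrite ler_wpM2r//.
  have : 0 <= m * (`|k| * (m * K1)) by rewrite !mulr_ge0.
  by have := hk0; have := Ka0; rewrite /Kb; lra.
- rewrite (_ : connection_along A (k + h) (y + t *: h) i j
    = (connection_along A (k + h) (y + t *: h) - connection_along A k y) i j
      + connection_along A k y i j); last by rewrite !mxE; ring.
  apply: le_trans (ler_normD _ _) _; apply: lerD => //.
  by apply: le_trans hXY _; rewrite ler_piMr.
Qed.

(** The differential equation of the error term in the construction of parallel
    sections. If [V] and [U] are transported by [A'] and [B], and [U] varies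
    along the segment by [t *: (H *m U)] to first order, the error
    [V - U - t *: (H *m U)] satisfies the transport equation of [A'] up to a
    remainder that is small with [A' - B - H - t *: D] and [A' - B]. *)
Lemma flat_variation (R : realType) (N : nat) (A' B H D : 'M[R]_N)
    (U V : 'cV[R]_N) (t : R) :
  A' *m V - B *m U
    - (H *m U + t *: ((D + B *m H - H *m B) *m U + H *m (B *m U)))
  = A' *m (V - U - t *: (H *m U))
    + ((A' - B - H - t *: D) + t *: ((A' - B) *m H)) *m U.
Proof.
rewrite !(mulmxDl, mulmxBl, mulmxDr, mulmxBr, mulNmx, mulmxN) -!scalemxAl -!scalemxAr.
rewrite !mulmxA !(mulmxDl, mulmxBl, mulNmx).
move: (A' *m V) (B *m U) (H *m U) (D *m U) (B *m H *m U) (H *m B *m U)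
  (A' *m U) (A' *m H *m U) => a b c d e f g h.
by apply/matrixP => i j; rewrite !mxE; ring.
Qed.

Lemma mulmx_entry_le (R : realType) (N p : nat) (X : 'M[R]_N) (Y : 'M[R]_(N, p))
    (C D : R) :
  (forall i j, `|X i j| <= C) -> (forall i j, `|Y i j| <= D) ->
  forall i j, `|(X *m Y) i j| <= N%:R * (C * D).
Proof. by move=> hX hY i j; rewrite mxE; apply: norm_lin_sum_le. Qed.
(** Transport [v] along the segments issued from [x0], and let [u x] be the value
    at the end of the segment to [x]. Flatness implies that
    [t *: (connection_along A h *m U x)] solves the variational equation, so
    that by Gronwall's inequality it differs from [U (x + h) - U x] by [o(h)]
    uniformly in [t]; at [t = 1] this says that [u] is parallel. *)
Lemma flat_parallel_section (R : realType) (n N : nat) (M : set 'rV[R]_n)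
    (A : 'I_n -> 'rV[R]_n -> 'M[R]_N) (x0 : 'rV[R]_n) (v : 'cV[R]_N) :
  open M -> convex_set M ->
  (forall a i j, smooth_on M (fun y => A a y i j)) ->
  flat_connection M A -> M x0 ->
  exists u, parallel_section M A u /\ u x0 = v.
Proof.
move=> oM cM sA fA Mx0.
have dA a i j x : M x -> differentiable (fun y => A a y i j) x.
  by move=> Mx; exact: (sA a i j [::]).
pose c (x : 'rV[R]_n) (t : R) := x0 + t *: (x - x0).
have Mc x (t : R) : M x -> 0 <= t <= 1 -> M (c x t).
  by move=> Mx t01; exact: convex_segment.
pose B (x : 'rV[R]_n) (t : R) := connection_along A (x - x0) (c x t).
have dB h x (t : R) i j : M x -> 0 <= t <= 1 ->
    is_derive t 1 (fun s => connection_along A h (c x s) i j)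
      (derive_connection A h (x - x0) (c x t) i j).
  by move=> Mx t01; apply: is_derive_connection_along => a; apply/dA/Mc.
have ode x : exists U : R -> 'cV[R]_N, M x -> U 0 = v /\
    forall (t : R), 0 <= t <= 1 -> forall i,
      is_derive t 1 (fun s => U s i 0) ((B x t *m U t) i 0).
  have [Mx|nMx] := pselect (M x); last by exists (fun=> 0).
  have cB i j (t : R) : 0 <= t <= 1 -> {for t, continuous (fun s => B x s i j)}.
    by move=> t01; apply: is_derive_continuous; exact: dB.
  have [U [U0 dU]] := linear_ode (fun i => v i 0) cB.
  exists (fun t => \col_i U i t) => _; split.
    by apply/matrixP => i j; rewrite ord1 mxE U0.
  move=> t t01 i.
  rewrite (_ : (fun s => _) = U i); last by apply/funext => s; rewrite mxE.
  have := dU i t t01; congr (is_derive _ _ _ _).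
  by rewrite mxE; apply: eq_bigr => j _; rewrite mxE.
have [U hU] := choice ode.
exists (fun x => U x 1); split; last first.
  have [U0 dU] := hU x0 Mx0.
  apply/matrixP => i j; rewrite ord1 -U0; apply/eqP.
  have d1 (t : R) : 0 <= t <= 1 -> is_derive t 1 (fun s => U x0 s i 0) 0.
    move=> t01; have := dU t t01 i; congr (is_derive _ _ _ _).
    rewrite /B subrr /connection_along big1 ?mul0mx ?mxE// => a _.
    by rewrite mxE scale0r.
  have d0 (t : R) : 0 <= t <= 1 -> is_derive t 1 (fun _ : R => 0 : R) 0.
    by move=> _; exact: is_derive_cst.
  rewrite -subr_eq0 -normr_le0 -[leRHS](subrr (0 : R)).
  apply: (derive_abs_le_increment d1 d0); last by rewrite ler01 lexx.
  by move=> t _; rewrite normr0.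
move=> x Mx i; have [U0 dU] := hU x Mx.
pose k := x - x0.
have cx1 : c x 1 = x by rewrite /c scale1r addrC subrK.
have [K K0 hK] := connection_along_expansion oM sA (fun t => Mc x t Mx).
have [KU KU0 hKU] : exists2 C : R, 0 <= C &
    forall i (t : R), 0 <= t <= 1 -> `|U x t i 0| <= C.
  apply: (@bounded_itv01_fin R _ (fun i t => U x t i 0)) => l t t01.
  exact: is_derive_continuous (dU t t01 l).
apply: differentiable_of_linear_approx => e e0.
(* The remainder of the error equation is at most [C1 * (e1 * `|h|)], and [e1]
   is so small that after Gronwall's inequality it is at most [e * `|h|]. *)
pose C1 : R := N%:R * ((K + N%:R * (K * K)) * KU).
pose C : R := C1 * expR ((2 * K + 1) * N%:R) + 1.
have C10 : 0 <= C1 by rewrite !(mulr_ge0, addr_ge0).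
have C0 : 0 < C by rewrite ltr_wpDl// mulr_ge0// expR_ge0.
pose e1 := Num.min 1 (e / C).
have e10 : 0 < e1 by rewrite lt_min ltr01 divr_gt0.
have e11 : e1 <= 1 by rewrite ge_min lexx.
have e1C : e1 <= e / C by rewrite ge_min lexx orbT.
have nM : \forall h \near (0 : 'rV[R]_n), M (x + h).
  have : \forall y \near x, M y by exact: open_nbhs_nbhs.
  by rewrite (near_shift 0 x)/=; apply: filterS => h; rewrite /= subr0 addrC.
have nh : \forall h \near (0 : 'rV[R]_n), `|h| < e1 by exact: nbhs0_lt.
apply: filterS3 (hK e1 e10 e11) nM nh => h {}hK Mxh /ltW he.
have [V0 dV] := hU (x + h) Mxh.
pose H (t : R) := connection_along A h (c x t).
pose D (t : R) := derive_connection A k h (c x t).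
have cxh (t : R) : c (x + h) t = c x t + t *: h.
  by rewrite /c addrAC scalerDr addrA.
pose w j (t : R) : R := (U (x + h) t - U x t - t *: (H t *m U x t)) j 0.
pose r (t : R) := ((B (x + h) t - B x t - H t - t *: D t)
  + t *: ((B (x + h) t - B x t) *m H t)) *m U x t.
pose W (t : R) := \col_j w j t.
pose dw j (t : R) : R := (B (x + h) t *m W t + r t) j 0.
have hw j (t : R) : 0 <= t <= 1 -> is_derive t 1 (w j) (dw j t).
  move=> t01.
  have dHU : is_derive t 1 (fun s => (H s *m U x s) j 0)
     ((derive_connection A h k (c x t) *m U x t + H t *m (B x t *m U x t)) j 0).
    apply: (@is_derive_mulmx_col _ _ H
      (fun t => derive_connection A h k (c x t)) (U x) (fun t => B x t *m U x t)).
      by move=> l; exact: dB.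
    by move=> l; exact: dU.
  have d1 := dV t t01 j; have d2 := dU t t01 j.
  have d3 : is_derive t 1 (fun s => s * (H s *m U x s) j 0)
     ((H t *m U x t) j 0 + t *
      ((derive_connection A h k (c x t) *m U x t + H t *m (B x t *m U x t)) j 0)).
    by apply: is_derive_eq; rewrite /GRing.scale/= mulr1 addrC.
  have -> : w j = (fun s => U (x + h) s j 0) - (fun s => U x s j 0)
      - (fun s => s * (H s *m U x s) j 0).
    by apply/funext => s; rewrite /w !fctE 5![in LHS]mxE.
  have := is_deriveB (is_deriveB d1 d2) d3; congr (is_derive _ _ _ _).
  rewrite /dw /r (_ : W t = U (x + h) t - U x t - t *: (H t *m U x t)); last first.
    by apply/matrixP => p q; rewrite ord1 mxE.
  rewrite -flat_variation /D /H /B -!/k.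
  rewrite -(flat_connection_along _ _ fA (Mc x t Mx t01)).
  have entryE (p q a b : 'cV[R]_N) : (p - q - (a + t *: b)) j 0
    = p j 0 - q j 0 - (a j 0 + t * b j 0) by rewrite !mxE.
  by rewrite entryE.
have BE (t : R) : B (x + h) t
    = connection_along A (k + h) (x0 + t *: k + t *: h).
  by rewrite /B cxh addrAC.
have hr j (t : R) : 0 <= t <= 1 -> `|r t j 0| <= C1 * (e1 * `|h|).
  move=> t01; have hX p q : `|((B (x + h) t - B x t - H t - t *: D t)
      + t *: ((B (x + h) t - B x t) *m H t)) p q|
      <= (K + N%:R * (K * K)) * (e1 * `|h|).
    have hK' p' q' := hK t t01 p' q'.
    have addE (X Y : 'M[R]_N) : (X + t *: Y) p q = X p q + t * Y p q.
      by rewrite !mxE.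
    rewrite addE mulrDl; apply: le_trans (ler_normD _ _) _; apply: lerD.
      by rewrite BE; have [] := hK' p q.
    have hXY p' q' : `|(B (x + h) t - B x t) p' q'| <= K * `|h|.
      by rewrite BE; have [] := hK' p' q'.
    have hHt p' q' : `|H t p' q'| <= K * `|h| by have [] := hK' p' q'.
    have /andP[t0 t1] := t01.
    rewrite normrM (ger0_norm t0).
    apply: le_trans (_ : `|((B (x + h) t - B x t) *m H t) p q| <= _).
      by rewrite ler_piMl.
    apply: le_trans (mulmx_entry_le hXY hHt p q) _.
    rewrite (_ : N%:R * _ = N%:R * (K * K) * (`|h| * `|h|)); last by ring.
    by rewrite ler_wpM2l ?mulr_ge0// ler_wpM2r.
  have := mulmx_entry_le hX (fun p q => _ : `|U x t p q| <= KU) j 0.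
  rewrite /r => Hr; apply: le_trans (Hr _) _.
    by move=> p q; rewrite ord1; exact: hKU.
  by rewrite le_eqVlt /C1; apply/orP; left; apply/eqP; ring.
have wE1 : w i 1
    = U (x + h) 1 i 0 - U x 1 i 0 - \sum_a h 0 a * (A a x *m U x 1) i 0.
  have subE (p q a : 'cV[R]_N) : (p - q - 1 *: a) i 0 = p i 0 - q i 0 - a i 0.
    by rewrite !mxE mul1r.
  rewrite /w subE /H cx1 /connection_along mulmx_suml summxE; congr (_ - _).
  by apply: eq_bigr => a _; rewrite -scalemxAl [LHS]mxE.
rewrite -wE1.
have eps0 : 0 <= C1 * (e1 * `|h|) by rewrite mulr_ge0// mulr_ge0// ltW.
have w_le : `|w i 1| <= C1 * (e1 * `|h|) * expR ((2 * K + 1) * N%:R).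
  apply: (gronwall K0 eps0 hw); last by rewrite ler01 lexx.
    move=> j t t01; rewrite /dw [X in `|X|]mxE.
    apply: le_trans (ler_normD _ _) _; apply: lerD; last exact: hr.
    rewrite [X in `|X|]mxE; apply: le_trans (ler_norm_sum _ _ _) _.
    rewrite mulr_sumr; apply: ler_sum => l _; rewrite normrM [W t l 0]mxE.
    by rewrite ler_wpM2r// BE; have [] := hK t t01 j l.
  by move=> j; rewrite /w V0 U0 scale0r subrr subr0 mxE.
apply: le_trans w_le _.
have -> : C1 * (e1 * `|h|) * expR ((2 * K + 1) * N%:R)
  = C1 * expR ((2 * K + 1) * N%:R) * e1 * `|h| by ring.
rewrite ler_wpM2r//.
apply: (@le_trans _ _ (C * e1)).
  by rewrite ler_wpM2r ?(ltW e10)// /C lerDl.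
by rewrite mulrC -ler_pdivlMr.
Qed.

(** * Smooth functions *)

Lemma linear_approx (R : realType) (n : nat) (f : 'rV[R]_n -> R)
    (x : 'rV[R]_n) (e : R) :
  differentiable f x -> 0 < e -> \forall h \near (0 : 'rV[R]_n),
    `|f (x + h) - f x - \sum_a h 0 a * partial a f x| <= e * `|h|.
Proof.
move=> df e0.
have /diff_locallyP[_ /eqaddoP/(_ e e0)] := df.
apply: filterS => h; rewrite !fctE/= diff_partial//.
by rewrite opprD addrA (addrC h x).
Qed.

Lemma eq_on_differentiable (R : realType) (n : nat) (U : set 'rV[R]_n)
    (f g : 'rV[R]_n -> R) (x : 'rV[R]_n) :
  open U -> U x -> (forall y, U y -> f y = g y) -> differentiable f x ->
  differentiable g x /\ forall i, partial i g x = partial i f x.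
Proof.
move=> oU Ux fg df; apply: differentiable_of_linear_approx => e e0.
have nU : \forall h \near (0 : 'rV[R]_n), U (x + h).
  have : \forall y \near x, U y by exact: open_nbhs_nbhs.
  by rewrite (near_shift 0 x)/=; apply: filterS => h; rewrite /= subr0 addrC.
apply: filterS2 nU (linear_approx df e0) => h Uxh.
by rewrite -!fg.
Qed.

Lemma eq_on_partial (R : realType) (n : nat) (U : set 'rV[R]_n)
    (f g : 'rV[R]_n -> R) (x : 'rV[R]_n) (i : 'I_n) :
  open U -> U x -> (forall y, U y -> f y = g y) -> partial i f x = partial i g x.
Proof.
move=> oU Ux fg; apply: near_eq_derive.
have : \forall y \near x, U y by exact: open_nbhs_nbhs.
by apply: filterS => y /fg.
Qed.

(** Iterated partial derivatives are controlled by showing that they stay in such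
    an algebra. *)
Inductive algebra_closure (R : realType) (n : nat)
    (S : set ('rV[R]_n -> R)) : ('rV[R]_n -> R) -> Prop :=
| algebra_base f : S f -> algebra_closure S f
| algebra_add f g : algebra_closure S f -> algebra_closure S g ->
    algebra_closure S (fun x => f x + g x)
| algebra_mul f g : algebra_closure S f -> algebra_closure S g ->
    algebra_closure S (fun x => f x * g x)
| algebra_cst c : algebra_closure S (fun=> c).

Lemma partialD (R : realType) (n : nat) (f g : 'rV[R]_n -> R) x i :
  differentiable f x -> differentiable g x ->
  partial i (fun y => f y + g y) x = partial i f x + partial i g x.
Proof. by move=> df dg; apply: deriveD; exact: diff_derivable. Qed.

Lemma partialM (R : realType) (n : nat) (f g : 'rV[R]_n -> R) x i :
  differentiable f x -> differentiable g x ->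
  partial i (fun y => f y * g y) x = partial i f x * g x + f x * partial i g x.
Proof.
move=> df dg; rewrite /partial [LHS]deriveM; try exact: diff_derivable.
by rewrite /GRing.scale/= addrC mulrC.
Qed.

Lemma partial_cst (R : realType) (n : nat) (c : R) (x : 'rV[R]_n) i :
  partial i (fun=> c) x = 0.
Proof. exact: derive_cst. Qed.

(** An algebra of differentiable functions that is stable under partial
    derivatives consists of smooth functions; it is enough to check both
    conditions on generators. *)
Lemma algebra_closure_smooth (R : realType) (n : nat) (U : set 'rV[R]_n)
    (S : set ('rV[R]_n -> R)) :
  open U -> (forall f, S f -> forall x, U x -> differentiable f x) ->
  (forall f i, S f -> exists2 g, algebra_closure S g &
     forall x, U x -> partial i f x = g x) ->
  forall f, algebra_closure S f -> smooth_on U f.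
Proof.
move=> oU dS pS.
have dC f : algebra_closure S f -> forall x, U x -> differentiable f x.
  elim=> {f} [f Sf|f g _ df _ dg|f g _ df _ dg|c] x Ux.
  - exact: dS.
  - by apply: differentiableD; [exact: df|exact: dg].
  - by apply: differentiableM; [exact: df|exact: dg].
  - exact: differentiable_cst.
have pC f i : algebra_closure S f -> exists2 g, algebra_closure S g &
    forall x, U x -> partial i f x = g x.
  elim=> {f} [f Sf|f g Cf [f' Cf' Ef] Cg [g' Cg' Eg]|
      f g Cf [f' Cf' Ef] Cg [g' Cg' Eg]|c].
  - exact: pS.
  - exists (fun x => f' x + g' x); first exact: algebra_add.
    by move=> x Ux; rewrite partialD ?Ef ?Eg//; exact: dC.
  - exists (fun x => f' x * g x + f x * g' x).
      by apply: algebra_add; apply: algebra_mul.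
    by move=> x Ux; rewrite partialM ?Ef ?Eg//; exact: dC.
  - by exists (fun=> 0); [exact: algebra_cst|move=> x Ux; rewrite partial_cst].
move=> f Cf s.
suff [g Cg fg] : exists2 g, algebra_closure S g &
    forall x, U x -> foldr (@partial R n) f s x = g x.
  have gf y : U y -> g y = foldr (@partial R n) f s y by move/fg.
  by move=> x Ux; have [] := eq_on_differentiable oU Ux gf (dC g Cg x Ux).
elim: s => [|i s [g Cg fg]] /=; first by exists f.
have [h Ch gh] := pC g i Cg; exists h => // x Ux.
by rewrite -gh//; exact: eq_on_partial oU Ux fg.
Qed.

Lemma smooth_differentiable (R : realType) (n : nat) (U : set 'rV[R]_n)
    (f : 'rV[R]_n -> R) x :
  smooth_on U f -> U x -> differentiable f x.
Proof. by move=> sf; exact: (sf [::]). Qed.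

Lemma smooth_partial (R : realType) (n : nat) (U : set 'rV[R]_n)
    (f : 'rV[R]_n -> R) i :
  smooth_on U f -> smooth_on U (partial i f).
Proof.
by move=> sf s x Ux; have := sf (s ++ [:: i]) x Ux; rewrite foldr_cat.
Qed.

Lemma algebra_of_smooth (R : realType) (n : nat) (U : set 'rV[R]_n)
    (f : 'rV[R]_n -> R) :
  open U -> algebra_closure (smooth_on U) f -> smooth_on U f.
Proof.
move=> oU; apply: algebra_closure_smooth => // {}f.
  by move=> sf x; exact: smooth_differentiable.
by move=> i sf; exists (partial i f) => //; apply: algebra_base; exact: smooth_partial.
Qed.

Lemma smoothD (R : realType) (n : nat) (U : set 'rV[R]_n)
    (f g : 'rV[R]_n -> R) : open U ->
  smooth_on U f -> smooth_on U g -> smooth_on U (fun x => f x + g x).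
Proof.
by move=> oU sf sg; apply: algebra_of_smooth => //; apply: algebra_add; exact: algebra_base.
Qed.

Lemma smoothM (R : realType) (n : nat) (U : set 'rV[R]_n)
    (f g : 'rV[R]_n -> R) : open U ->
  smooth_on U f -> smooth_on U g -> smooth_on U (fun x => f x * g x).
Proof.
by move=> oU sf sg; apply: algebra_of_smooth => //; apply: algebra_mul; exact: algebra_base.
Qed.

Lemma smooth_cst (R : realType) (n : nat) (U : set 'rV[R]_n) (c : R) :
  open U -> smooth_on U (fun=> c).
Proof. by move=> oU; apply: algebra_of_smooth => //; exact: algebra_cst. Qed.

Lemma smooth_eq_on (R : realType) (n : nat) (U : set 'rV[R]_n)
    (f g : 'rV[R]_n -> R) : open U ->
  (forall x, U x -> f x = g x) -> smooth_on U f -> smooth_on U g.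
Proof.
move=> oU fg sf s.
have E x : U x -> foldr (@partial R n) f s x = foldr (@partial R n) g s x.
  elim: s x => [|i s IH] x Ux /=; first exact: fg.
  exact: eq_on_partial oU Ux IH.
by move=> x Ux; have [] := eq_on_differentiable oU Ux E (sf s x Ux).
Qed.

Lemma smoothN (R : realType) (n : nat) (U : set 'rV[R]_n)
    (f : 'rV[R]_n -> R) : open U -> smooth_on U f -> smooth_on U (fun x => - f x).
Proof.
move=> oU sf; apply: (@smooth_eq_on _ _ _ (fun x => -1 * f x)) => //.
  by move=> x _; rewrite mulN1r.
by apply: smoothM => //; exact: smooth_cst.
Qed.

Lemma mx_norm_entry_le (R : realType) (n : nat) (h : 'rV[R]_n) (C : R) :
  0 <= C -> (forall i, `|h 0 i| <= C) -> `|h| <= C.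
Proof.
move=> C0 hC; rewrite [leLHS]/Num.Def.normr/= mx_normrE.
by apply: bigmax_le => // -[i j] _ /=; rewrite ord1.
Qed.

Lemma partial_mulmx (R : realType) (n m : nat) (Q : 'M[R]_(n, m))
    (f : 'rV[R]_m -> R) (x : 'rV[R]_n) :
  differentiable f (x *m Q) ->
  differentiable (fun y => f (y *m Q)) x /\
  forall i, partial i (fun y => f (y *m Q)) x
    = \sum_j Q i j * partial j f (x *m Q).
Proof.
move=> df.
pose C : R := n%:R * (\sum_i \sum_j `|Q i j|) + 1.
have sQ : 0 <= \sum_i \sum_j `|Q i j| by apply: sumr_ge0 => i _; exact: sumr_ge0.
have C0 : 0 < C by rewrite ltr_wpDl// mulr_ge0.
have hQ (h : 'rV[R]_n) : `|h *m Q| <= C * `|h|.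
  apply: mx_norm_entry_le => [|j]; first by rewrite mulr_ge0// ltW.
  rewrite mxE; apply: le_trans (@norm_lin_sum_le _ _ _ _ _
    (\sum_i \sum_j `|Q i j|) (norm_coord_le h) _) _.
    move=> i; rewrite (bigD1 i)//= (bigD1 j)//= -addrA lerDl addr_ge0//.
      exact: sumr_ge0.
    by apply: sumr_ge0 => ? _; exact: sumr_ge0.
  by rewrite mulrCA mulrC ler_wpM2r// lerDl.
apply: differentiable_of_linear_approx => e e0.
have eC0 : 0 < e / C by rewrite divr_gt0.
have := linear_approx df eC0 => /nbhs_normP[r /= r0 hr].
have nh : \forall h \near (0 : 'rV[R]_n), `|h| < r / C.
  by apply: nbhs0_lt; rewrite divr_gt0.
apply: filterS nh => h hrC.
have /hr : ball_ Num.norm 0 r (h *m Q).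
  rewrite /ball_/= sub0r normrN; apply: le_lt_trans (hQ h) _.
  by rewrite mulrC -ltr_pdivlMr.
rewrite /= mulmxDl => H.
have -> : \sum_a h 0 a * \sum_j Q a j * partial j f (x *m Q)
    = \sum_j (h *m Q) 0 j * partial j f (x *m Q).
  under eq_bigr do rewrite mulr_sumr.
  rewrite exchange_big/=; apply: eq_bigr => j _; rewrite mxE mulr_suml.
  by apply: eq_bigr => a _; rewrite mulrA.
apply: le_trans H _; apply: le_trans (ler_wpM2l (ltW eC0) (hQ h)) _.
by rewrite mulrA divfK// lt0r_neq0.
Qed.

Lemma algebra_closure_sum (R : realType) (n N : nat)
    (S : set ('rV[R]_n -> R)) (f : 'I_N -> 'rV[R]_n -> R) :
  (forall j, algebra_closure S (f j)) ->
  algebra_closure S (fun x => \sum_j f j x).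
Proof.
elim: N f => [|N IH] f Sf.
  rewrite (_ : (fun x => _) = fun=> 0); first exact: algebra_cst.
  by apply/funext => x; rewrite big_ord0.
rewrite (_ : (fun x => _)
    = fun x => f ord0 x + \sum_j f (lift ord0 j) x); last first.
  by apply/funext => x; rewrite big_ord_recl.
by apply: algebra_add => //; apply: IH.
Qed.

Lemma smooth_mulmx (R : realType) (n m : nat) (Q : 'M[R]_(n, m))
    (U : set 'rV[R]_m) (V : set 'rV[R]_n) (f : 'rV[R]_m -> R) :
  open V -> (forall x, V x -> U (x *m Q)) ->
  smooth_on U f -> smooth_on V (fun x => f (x *m Q)).
Proof.
move=> oV VU sf.
pose S := [set g | exists2 f, smooth_on U f &
  g = fun x : 'rV[R]_n => f (x *m Q)].
apply: (@algebra_closure_smooth _ _ V S) => //.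
- move=> _ [g sg ->] x Vx.
  by have [] := partial_mulmx (smooth_differentiable sg (VU x Vx)).
- move=> _ i [g sg ->].
  exists (fun x => \sum_j Q i j * partial j g (x *m Q)).
    apply: algebra_closure_sum => j.
    apply: (algebra_mul (algebra_cst _ _)); apply: algebra_base.
    by exists (partial j g) => //; exact: smooth_partial.
  by move=> x Vx; have [] := partial_mulmx (smooth_differentiable sg (VU x Vx)).
- by apply: algebra_base; exists f.
Qed.

Lemma partial_coord (R : realType) (n : nat) (i j : 'I_n) (x : 'rV[R]_n) :
  partial j (fun y => y 0 i) x = (j == i)%:R.
Proof.
suff H : differentiable (fun y : 'rV[R]_n => y 0 i) x /\
    forall a, partial a (fun y : 'rV[R]_n => y 0 i) x = (a == i)%:R by case: H.
apply: differentiable_of_linear_approx => e e0.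
apply: (filterS _ (@filterT _ _ (nbhs_filter (0 : 'rV[R]_n)))) => h _.
rewrite (bigD1 i)//= big1 => [|a ai]; last by rewrite (negbTE ai) mulr0.
by rewrite eqxx mulr1 addr0 mxE [x 0 i + _]addrC addrK subrr normr0 mulr_ge0// ltW.
Qed.

Lemma smooth_coord (R : realType) (n : nat) (U : set 'rV[R]_n) (i : 'I_n) :
  open U -> smooth_on U (fun x => x 0 i).
Proof.
move=> oU; pose S := [set (fun x : 'rV[R]_n => x 0 i)].
apply: (@algebra_closure_smooth _ _ U S) => //.
- by move=> _ -> x _; exact: differentiable_coord.
- move=> _ j ->; exists (fun=> (j == i)%:R); first exact: algebra_cst.
  by move=> x _; exact: partial_coord.
- exact: algebra_base.
Qed.

(** The components of a parallel section and the smooth functions generate an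
    algebra stable under partial derivatives. *)
Lemma parallel_section_smooth (R : realType) (n N : nat) (M : set 'rV[R]_n)
    (A : 'I_n -> 'rV[R]_n -> 'M[R]_N) (u : 'rV[R]_n -> 'cV[R]_N) (i : 'I_N) :
  open M -> (forall a i j, smooth_on M (fun y => A a y i j)) ->
  parallel_section M A u -> smooth_on M (fun x => u x i 0).
Proof.
move=> oM sA pu.
pose S := smooth_on M `|` [set f | exists j, f = fun x => u x j 0].
apply: (@algebra_closure_smooth _ _ M S) => //.
- move=> f [sf|[j ->]] x Mx; first exact: smooth_differentiable sf Mx.
  by have [] := pu x Mx j.
- move=> f a [sf|[j ->]].
    exists (partial a f) => //; apply: algebra_base; left.
    exact: smooth_partial.
  exists (fun x => \sum_k A a x j k * u x k 0).
    apply: algebra_closure_sum => k; apply: algebra_mul; apply: algebra_base.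
      by left.
    by right; exists k.
  by move=> x Mx; have [_ ->] := pu x Mx j; rewrite mxE.
- by apply: algebra_base; right; exists i.
Qed.

(** The second difference quotient of [f] at [x] in the directions [i] and [j]
    tends to the [j]-derivative of the [i]-derivative, by the mean value
    inequality in the direction [i]; being symmetric in [i] and [j], it forces
    the two mixed derivatives to agree. *)
Lemma second_difference (R : realType) (n : nat) (U : set 'rV[R]_n)
    (f : 'rV[R]_n -> R) (x : 'rV[R]_n) (i j : 'I_n) (e : R) :
  open U -> U x -> (forall y, U y -> differentiable f y) ->
  differentiable (partial i f) x -> 0 < e ->
  \forall s \near 0^'+,
    `|f (x + s *: delta_mx 0 j + s *: delta_mx 0 i) - f (x + s *: delta_mx 0 i)
      - f (x + s *: delta_mx 0 j) + f x
      - s ^+ 2 * partial j (partial i f) x| <= e * s ^+ 2.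
Proof.
move=> oU Ux df dif e0.
(* Two first order expansions of [partial i f] are used, at distances at most
   [2 * s] and [s]. *)
have e30 : 0 < e / 3 by rewrite divr_gt0.
have := linear_approx dif e30 => /nbhs_normP[r /= r0 hr].
have : \forall y \near x, U y by exact: open_nbhs_nbhs.
move=> /nbhs_normP[r' /= r'0 hr'].
near=> s.
pose a : 'rV[R]_n := s *: delta_mx 0 i.
pose b : 'rV[R]_n := s *: delta_mx 0 j.
rewrite -/a -/b.
have s0 : 0 < s by near: s; exact: nbhs_right_gt.
have sr : s < r / 2 by near: s; apply: nbhs_right_lt; rewrite divr_gt0.
have sr' : s < r' / 2 by near: s; apply: nbhs_right_lt; rewrite divr_gt0.
have na k : `|s *: delta_mx 0 k : 'rV[R]_n| <= s.
  apply: mx_norm_entry_le => [|l]; first exact: ltW.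
  rewrite !mxE eqxx/= normrM (gtr0_norm s0) ler_piMr ?(ltW s0)//.
  by case: (l == k); rewrite ?normr1 ?normr0.
have nta (t : R) : 0 <= t <= 1 -> `|t *: a| <= s.
  move=> /andP[t0 t1]; rewrite normrZ (ger0_norm t0).
  by apply: le_trans (na i); rewrite ler_piMl.
have nbta (t : R) : 0 <= t <= 1 -> `|b + t *: a| <= 2 * s.
  move=> t01; apply: le_trans (ler_normD _ _) _.
  by rewrite mulr_natl mulr2n; apply: lerD; [exact: na|exact: nta].
have inU k : `|k| <= 2 * s -> U (x + k).
  move=> hk; apply: hr'; rewrite /ball_/= opprD addrA subrr add0r normrN.
  by apply: le_lt_trans hk _; rewrite mulrC -ltr_pdivlMr.
have inr k : `|k| <= 2 * s -> `|partial i f (x + k) - partial i f x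
    - \sum_l k 0 l * partial l (partial i f) x| <= e / 3 * `|k|.
  move=> hk; apply: hr; rewrite /ball_/= sub0r normrN.
  by apply: le_lt_trans hk _; rewrite mulrC -ltr_pdivlMr.
have s2 : s <= 2 * s by rewrite ler_peMl ?ler1n// ltW.
pose c := partial j (partial i f) x.
have suma y : \sum_l a 0 l * partial l f y = s * partial i f y.
  rewrite (bigD1 i)//= big1 => [|l li]; last by rewrite !mxE (negbTE li) andbF mulr0 mul0r.
  by rewrite !mxE !eqxx mulr1 addr0.
pose phi (t : R) := f (x + b + t *: a) - f (x + t *: a) - s ^+ 2 * c * t.
pose dphi (t : R) : R := s * (partial i f (x + b + t *: a)
  - partial i f (x + t *: a) - s * c).
have dp (t : R) : 0 <= t <= 1 -> is_derive t 1 phi (dphi t).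
  move=> t01.
  have d1 : is_derive t 1 (fun t => f (x + b + t *: a))
     (s * partial i f (x + b + t *: a)).
    rewrite -suma; apply: is_derive_line; apply: df.
    by rewrite -addrA; apply/inU/nbta.
  have d2 : is_derive t 1 (fun t => f (x + t *: a)) (s * partial i f (x + t *: a)).
    rewrite -suma; apply: is_derive_line; apply: df.
    by apply/inU/(le_trans (nta t t01)).
  apply: is_derive_eq.
  by rewrite /dphi /GRing.scale/=; ring.
have dl (t : R) : 0 <= t <= 1 ->
    is_derive t 1 (fun t => e * s ^+ 2 * t) (e * s ^+ 2).
  by move=> _; apply: is_derive_eq; rewrite /GRing.scale/= mulr1.
have := @derive_abs_le_increment _ _ _ _ _ _ dp dl _ 1.
rewrite ler01 lexx /phi !scale1r !scale0r !addr0 !mulr0 !mulr1 !subr0 => H.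
rewrite (_ : _ - _ = f (x + b + a) - f (x + a) - s ^+ 2 * c - (f (x + b) - f x)).
  2: by rewrite -/c; ring.
apply: H => // t t01; rewrite /dphi normrM (gtr0_norm s0).
have h1 := inr _ (nbta t t01); have h2 := inr _ (le_trans (nta t t01) s2).
have sumE : \sum_l (b + t *: a) 0 l * partial l (partial i f) x
    = s * c + \sum_l (t *: a) 0 l * partial l (partial i f) x.
  transitivity (\sum_l (b 0 l * partial l (partial i f) x
     + (t *: a) 0 l * partial l (partial i f) x)).
    by apply: eq_bigr => l _; rewrite mxE mulrDl.
  rewrite big_split/=; congr (_ + _).
  rewrite (bigD1 j)//= big1 => [|l li]; last by rewrite !mxE (negbTE li) andbF mulr0 mul0r.
  by rewrite !mxE !eqxx mulr1 addr0.
rewrite sumE in h1; move: h1 h2; set S := \sum_l _ => h1 h2.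
rewrite (addrA x b) in h1.
have {}h1 := le_trans h1 (ler_wpM2l (ltW e30) (nbta t t01)).
have {}h2 := le_trans h2 (ler_wpM2l (ltW e30) (nta t t01)).
rewrite expr2 mulrCA ler_wpM2l ?(ltW s0)//.
rewrite (_ : _ - _ - s * c
  = (partial i f (x + b + t *: a) - partial i f x - (s * c + S))
    - (partial i f (x + t *: a) - partial i f x - S)); last by ring.
apply: le_trans (ler_normB _ _) _; apply: le_trans (lerD h1 h2) _.
by rewrite le_eqVlt; apply/orP; left; apply/eqP; field.
Unshelve. all: by end_near. Qed.

(** Schwarz's theorem: both mixed derivatives approximate the same second
    difference. *)
Lemma partialC (R : realType) (n : nat) (U : set 'rV[R]_n)
    (f : 'rV[R]_n -> R) (x : 'rV[R]_n) (i j : 'I_n) :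
  open U -> U x -> smooth_on U f ->
  partial i (partial j f) x = partial j (partial i f) x.
Proof.
move=> oU Ux sf.
have df y : U y -> differentiable f y by exact: smooth_differentiable.
have dp k : differentiable (partial k f) x by exact: (sf [:: k]).
apply/eqP; rewrite -subr_eq0 -normr_le0; apply/ler_addgt0Pr => e e0.
rewrite add0r.
have e20 : 0 < e / 2 by rewrite divr_gt0.
have H1 := second_difference j oU Ux df (dp i) e20.
have H2 := second_difference i oU Ux df (dp j) e20.
have [s [[h1 h2] s0]] := filter_ex (filterI (filterI H1 H2) (nbhs_right_gt 0)).
rewrite (addrAC x (s *: delta_mx 0 i)) in h2.
have s20 : 0 < s ^+ 2 by rewrite exprn_gt0.
rewrite -(ler_pM2r s20) -[X in _ * X](gtr0_norm s20) -normrM.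
move: h1 h2; set F := f (x + _ + _).
move: (partial j (partial i f) x) (partial i (partial j f) x) => P Q.
move: F (f (x + s *: _)) (f (x + s *: _)) => F q p h1 h2.
rewrite (_ : (Q - P) * _ = (F - p - q + f x - s ^+ 2 * P)
  - (F - q - p + f x - s ^+ 2 * Q)); last by ring.
apply: le_trans (ler_normB _ _) _; apply: le_trans (lerD h1 h2) _.
by rewrite -mulrDl -splitr.
Qed.

(** * Functions on the cotangent bundle *)

Lemma lsubmx_mulmx (R : realType) (n : nat) (z : 'rV[R]_(n + n)) :
  z *m col_mx 1%:M 0 = lsubmx z.
Proof. by rewrite -[z in LHS]hsubmxK mul_row_col mulmx1 mulmx0 addr0. Qed.

Lemma cotangent_open (R : realType) (n : nat) (M : set 'rV[R]_n) :
  open M -> open (cotangent M).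
Proof.
move=> oM; have -> : cotangent M = (fun z => z *m col_mx 1%:M 0) @^-1` M.
  by apply/seteqP; split => z; rewrite /cotangent/= lsubmx_mulmx.
apply: open_comp => // z _.
have -> : (fun z : 'rV[R]_(n + n) => z *m col_mx 1%:M 0) = (fun z => lsubmx z).
  by apply/funext => y; rewrite lsubmx_mulmx.
by apply: differentiable_continuous; exact: differentiable_lsubmx.
Qed.

(** The function $a + b^C p_C$ on the cotangent bundle. *)
Definition fibre_affine (R : realType) (n : nat) (a : 'rV[R]_n -> R)
    (b : 'I_n -> 'rV[R]_n -> R) (z : 'rV[R]_(n + n)) : R :=
  a (lsubmx z) + \sum_C b C (lsubmx z) * rsubmx z 0 C.

Lemma partial_lsubmx (R : realType) (n : nat) (a : 'rV[R]_n -> R)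
    (z : 'rV[R]_(n + n)) :
  differentiable a (lsubmx z) ->
  [/\ differentiable (fun z : 'rV[R]_(n + n) => a (lsubmx z)) z,
    forall A, partial (lshift n A) (fun z : 'rV[R]_(n + n) => a (lsubmx z)) z
      = partial A a (lsubmx z) &
    forall A, partial (rshift n A) (fun z : 'rV[R]_(n + n) => a (lsubmx z)) z = 0].
Proof.
rewrite -lsubmx_mulmx => da.
have -> : (fun z : 'rV[R]_(n + n) => a (lsubmx z)) = (fun z : 'rV[R]_(n + n) => a (z *m col_mx 1%:M 0)).
  by apply/funext => y; rewrite lsubmx_mulmx.
have [d p] := partial_mulmx da; split => // A; rewrite p.
  rewrite (bigD1 A)//= big1 => [|j jA]; rewrite col_mxEu mxE.
    by rewrite eqxx mul1r addr0.
  by rewrite eq_sym (negbTE jA) mul0r.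
by apply: big1 => j _; rewrite col_mxEd mxE mul0r.
Qed.

Lemma partial_rsubmx (R : realType) (n : nat) (C : 'I_n) (z : 'rV[R]_(n + n)) :
  [/\ differentiable (fun z : 'rV[R]_(n + n) => rsubmx z 0 C) z,
    forall A, partial (lshift n A) (fun z : 'rV[R]_(n + n) => rsubmx z 0 C) z = 0 &
    forall A, partial (rshift n A) (fun z : 'rV[R]_(n + n) => rsubmx z 0 C) z = (A == C)%:R].
Proof.
have -> : (fun z : 'rV[R]_(n + n) => rsubmx z 0 C) = (fun z => z 0 (rshift n C)).
  by apply/funext => y; rewrite mxE.
split=> [|A|A]; first exact: differentiable_coord.
  by rewrite partial_coord eq_lrshift.
by rewrite partial_coord eq_rshift.
Qed.

Lemma partial_sum (R : realType) (m N : nat) (f : 'I_N -> 'rV[R]_m -> R) x :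
  (forall j, differentiable (f j) x) ->
  differentiable (fun y => \sum_j f j y) x /\
  forall i, partial i (fun y => \sum_j f j y) x = \sum_j partial i (f j) x.
Proof.
move=> df; have -> : (fun y => \sum_j f j y) = \sum_j f j.
  by apply/funext => y; rewrite fct_sumE.
split; first exact: differentiable_sum.
by move=> i; rewrite /partial derive_sum// => j; exact: diff_derivable.
Qed.

Lemma partial_fibre_affine (R : realType) (n : nat) (a : 'rV[R]_n -> R)
    (b : 'I_n -> 'rV[R]_n -> R) (z : 'rV[R]_(n + n)) :
  differentiable a (lsubmx z) -> (forall C, differentiable (b C) (lsubmx z)) ->
  [/\ differentiable (fibre_affine a b) z,
    forall A, partial (lshift n A) (fibre_affine a b) z
      = fibre_affine (partial A a) (fun C => partial A (b C)) z &
    forall A, partial (rshift n A) (fibre_affine a b) z = b A (lsubmx z)].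
Proof.
move=> da db; have [da' al ar] := partial_lsubmx da.
have dbC C : differentiable (fun z : 'rV[R]_(n + n) => b C (lsubmx z) * rsubmx z 0 C) z.
  apply: differentiableM; first by have [] := partial_lsubmx (db C).
  by have [] := partial_rsubmx C z.
have pbC C i : partial i (fun z : 'rV[R]_(n + n) => b C (lsubmx z) * rsubmx z 0 C) z
    = partial i (fun z : 'rV[R]_(n + n) => b C (lsubmx z)) z * rsubmx z 0 C
      + b C (lsubmx z) * partial i (fun z : 'rV[R]_(n + n) => rsubmx z 0 C) z.
  apply: partialM; first by have [] := partial_lsubmx (db C).
  by have [] := partial_rsubmx C z.
have [ds ps] := partial_sum dbC.
split.
- exact: differentiableD.
- move=> A; rewrite /fibre_affine partialD//.
  rewrite al ps; congr (_ + _); apply: eq_bigr => C _.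
  rewrite pbC; have [_ -> _] := partial_lsubmx (db C).
  by have [_ -> _] := partial_rsubmx C z; rewrite mulr0 addr0.
- move=> A; rewrite /fibre_affine partialD//.
  rewrite ar ps add0r (bigD1 A)//= big1 => [|C CA].
    rewrite pbC; have [_ _ ->] := partial_lsubmx (db A).
    by have [_ _ ->] := partial_rsubmx A z; rewrite eqxx mul0r add0r mulr1 addr0.
  rewrite pbC; have [_ _ ->] := partial_lsubmx (db C).
  have [_ _ ->] := partial_rsubmx C z.
  by rewrite eq_sym (negbTE CA) mul0r mulr0 addr0.
Qed.

Lemma smooth_sum (R : realType) (m N : nat) (U : set 'rV[R]_m)
    (f : 'I_N -> 'rV[R]_m -> R) : open U ->
  (forall j, smooth_on U (f j)) -> smooth_on U (fun x => \sum_j f j x).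
Proof.
move=> oU sf; apply: algebra_of_smooth => //.
by apply: algebra_closure_sum => j; exact: algebra_base.
Qed.

Lemma smooth_lsubmx (R : realType) (n : nat) (M : set 'rV[R]_n)
    (a : 'rV[R]_n -> R) : open M ->
  smooth_on M a -> smooth_on (cotangent M) (fun z : 'rV[R]_(n + n) => a (lsubmx z)).
Proof.
move=> oM sa.
have -> : (fun z : 'rV[R]_(n + n) => a (lsubmx z)) = (fun z : 'rV[R]_(n + n) => a (z *m col_mx 1%:M 0)).
  by apply/funext => y; rewrite lsubmx_mulmx.
apply: smooth_mulmx (sa); first exact: cotangent_open.
by move=> z; rewrite lsubmx_mulmx.
Qed.

Lemma smooth_fibre_affine (R : realType) (n : nat) (M : set 'rV[R]_n)
    (a : 'rV[R]_n -> R) (b : 'I_n -> 'rV[R]_n -> R) : open M ->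
  smooth_on M a -> (forall C, smooth_on M (b C)) ->
  smooth_on (cotangent M) (fibre_affine a b).
Proof.
move=> oM sa sb; have oW := cotangent_open oM.
apply: smoothD => //; first exact: smooth_lsubmx.
apply: smooth_sum => // C; apply: smoothM => //; first exact: smooth_lsubmx.
apply: smooth_eq_on (smooth_coord (rshift n C) oW) => // z _.
by rewrite mxE.
Qed.

(** * The Levi-Civita connection of the extension *)

Section Extension.
Context (R : realType) (n : nat) (M : set 'rV[R]_n)
  (G : affine_connection R n) (Phi : 'rV[R]_n -> 'M[R]_n).
Hypotheses (oM : open M) (tG : torsion_free_connection M G)
  (tPhi : symmetric_tensor M Phi).

Local Notation g := (modified_extension G Phi).
Local Notation l := (lshift n).
Local Notation r := (@rshift n n).

Let dG A C B x : M x -> differentiable (fun y => G y A C B) x.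
Proof. by move=> Mx; exact: smooth_differentiable (tG.1 A C B) Mx. Qed.

Let dPhi A B x : M x -> differentiable (fun y => Phi y A B) x.
Proof. by move=> Mx; exact: smooth_differentiable (tPhi.1 A B) Mx. Qed.

Lemma extension_ll A B : (fun z => g z (l A) (l B))
  = fibre_affine (fun x => Phi x A B) (fun C x => - 2 * G x A C B).
Proof.
apply/funext => z; rewrite /modified_extension block_mxEul mxE /fibre_affine.
rewrite addrC mulr_sumr -sumrN; congr (_ + _); apply: eq_bigr => C _.
by rewrite mulrA !mulNr.
Qed.

Lemma extension_lr A B : (fun z => g z (l A) (r B)) = fun=> (A == B)%:R.
Proof. by apply/funext => z; rewrite /modified_extension block_mxEur mxE. Qed.

Lemma extension_rl A B : (fun z => g z (r A) (l B)) = fun=> (A == B)%:R.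
Proof. by apply/funext => z; rewrite /modified_extension block_mxEdl mxE. Qed.

Lemma extension_rr A B : (fun z => g z (r A) (r B)) = fun=> 0.
Proof. by apply/funext => z; rewrite /modified_extension block_mxEdr mxE. Qed.

Lemma dextension_ll A B z : cotangent M z ->
  (forall E, partial (l E) (fun z => g z (l A) (l B)) z
     = fibre_affine (partial E (fun x => Phi x A B))
         (fun C x => - 2 * partial E (fun x => G x A C B) x) z) /\
  (forall E, partial (r E) (fun z => g z (l A) (l B)) z
     = - 2 * G (lsubmx z) A E B).
Proof.
move=> Mz; rewrite extension_ll.
have d2 C : differentiable (fun x => - 2 * G x A C B) (lsubmx z).
  by apply: differentiableM; [exact: differentiable_cst|exact: dG].
have [_ pl pr] := partial_fibre_affine (dPhi A B Mz) d2.
split=> E; rewrite ?pl ?pr//; rewrite /fibre_affine; congr (_ + _).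
apply: eq_bigr => C _; congr (_ * _); rewrite partialM//; last exact: dG.
by rewrite partial_cst mul0r add0r.
Qed.

Lemma dextension_lr A B i z : partial i (fun z => g z (l A) (r B)) z = 0.
Proof. by rewrite extension_lr partial_cst. Qed.

Lemma dextension_rl A B i z : partial i (fun z => g z (r A) (l B)) z = 0.
Proof. by rewrite extension_rl partial_cst. Qed.

Lemma dextension_rr A B i z : partial i (fun z => g z (r A) (r B)) z = 0.
Proof. by rewrite extension_rr partial_cst. Qed.

Lemma invmx_extension z :
  invmx (g z) = block_mx 0 1%:M 1%:M (- ulsubmx (g z)).
Proof.
have gE : g z = block_mx (ulsubmx (g z)) 1%:M 1%:M 0.
  by rewrite {2}/modified_extension block_mxKul.
have gI : g z *m block_mx 0 1%:M 1%:M (- ulsubmx (g z)) = 1%:M.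
  rewrite {1}gE mulmx_block !mulmx0 !mul0mx !mulmx1 !mul1mx !addr0 add0r.
  by rewrite subrr -scalar_mx_block.
have [gu _] := mulmx1_unit gI.
by rewrite -[RHS](mulKmx gu) gI mulmx1.
Qed.

Lemma invmx_extension_ll z A B : invmx (g z) (l A) (l B) = 0.
Proof. by rewrite invmx_extension block_mxEul mxE. Qed.

Lemma invmx_extension_lr z A B : invmx (g z) (l A) (r B) = (A == B)%:R.
Proof. by rewrite invmx_extension block_mxEur mxE. Qed.

Lemma invmx_extension_rl z A B : invmx (g z) (r A) (l B) = (A == B)%:R.
Proof. by rewrite invmx_extension block_mxEdl mxE. Qed.

Lemma invmx_extension_rr z A B : invmx (g z) (r A) (r B) = - g z (l A) (l B).
Proof. by rewrite invmx_extension block_mxEdr !mxE. Qed.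

Lemma sum_delta_l (F : 'I_n -> R) (A : 'I_n) : \sum_B (A == B)%:R * F B = F A.
Proof.
rewrite (bigD1 A)//= big1 => [|B BA]; first by rewrite eqxx mul1r addr0.
by rewrite eq_sym (negbTE BA) mul0r.
Qed.

Lemma extension_llE z A B : g z (l A) (l B)
  = fibre_affine (fun x => Phi x A B) (fun C x => - 2 * G x A C B) z.
Proof. by have := extension_ll A B => /(congr1 (@^~ z)). Qed.

Lemma sum_invmx_extension_l z C (F : 'I_(n + n) -> R) :
  \sum_k invmx (g z) (l C) k * F k = F (r C).
Proof.
rewrite big_split_ord/= big1 => [|E _]; last first.
  by rewrite invmx_extension_ll mul0r.
under eq_bigr do rewrite invmx_extension_lr.
by rewrite add0r sum_delta_l.
Qed.

Lemma sum_invmx_extension_r z C (F : 'I_(n + n) -> R) :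
  \sum_k invmx (g z) (r C) k * F k
  = F (l C) - \sum_E g z (l C) (l E) * F (r E).
Proof.
rewrite big_split_ord/=; congr (_ + _).
  by under eq_bigr do rewrite invmx_extension_rl; rewrite sum_delta_l.
rewrite -sumrN; apply: eq_bigr => E _.
by rewrite invmx_extension_rr mulNr.
Qed.

Lemma christoffel_l z C i j : christoffel g z (l C) i j = 2^-1 *
  (partial i (fun y => g y j (r C)) z + partial j (fun y => g y i (r C)) z
   - partial (r C) (fun y => g y i j) z).
Proof. by congr (_ * _); exact: sum_invmx_extension_l. Qed.

Lemma christoffel_r z C i j : christoffel g z (r C) i j = 2^-1 *
  (partial i (fun y => g y j (l C)) z + partial j (fun y => g y i (l C)) z
   - partial (l C) (fun y => g y i j) z
  - \sum_E g z (l C) (l E) *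
    (partial i (fun y => g y j (r E)) z + partial j (fun y => g y i (r E)) z
     - partial (r E) (fun y => g y i j) z)).
Proof. by congr (_ * _); exact: sum_invmx_extension_r. Qed.

Lemma christoffel_l_ll z C A B : cotangent M z ->
  christoffel g z (l C) (l A) (l B) = G (lsubmx z) A C B.
Proof.
move=> Mz; rewrite christoffel_l !dextension_lr (dextension_ll A B Mz).2.
by move: (G _ _ _ _) => x; field.
Qed.

Lemma christoffel_l_lr z C A B : christoffel g z (l C) (l A) (r B) = 0.
Proof.
by rewrite christoffel_l dextension_lr dextension_rr dextension_lr addr0 subr0 mulr0.
Qed.

Lemma christoffel_l_rl z C A B : christoffel g z (l C) (r A) (l B) = 0.
Proof.
by rewrite christoffel_l dextension_lr dextension_rr dextension_rl addr0 subr0 mulr0.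
Qed.

Lemma christoffel_l_rr z C A B : christoffel g z (l C) (r A) (r B) = 0.
Proof. by rewrite christoffel_l !dextension_rr addr0 subr0 mulr0. Qed.

Lemma christoffel_r_lr z C A B : cotangent M z ->
  christoffel g z (r C) (l A) (r B) = - G (lsubmx z) A B C.
Proof.
move=> Mz; rewrite christoffel_r [X in _ * (_ - X)]big1 => [|E _]; last first.
  by rewrite dextension_rr !dextension_lr addr0 subr0 mulr0.
rewrite dextension_rl (dextension_ll A C Mz).2 dextension_lr.
by move: (G _ _ _ _) => x; field.
Qed.

Lemma christoffel_r_rl z C A B : cotangent M z ->
  christoffel g z (r C) (r A) (l B) = - G (lsubmx z) B A C.
Proof.
move=> Mz; rewrite christoffel_r [X in _ * (_ - X)]big1 => [|E _]; last first.
  by rewrite dextension_rr dextension_lr dextension_rl addr0 subr0 mulr0.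
rewrite dextension_rl (dextension_ll B C Mz).2 dextension_rl.
by move: (G _ _ _ _) => x; field.
Qed.

Lemma christoffel_r_rr z C A B : christoffel g z (r C) (r A) (r B) = 0.
Proof.
rewrite christoffel_r [X in _ * (_ - X)]big1 => [|E _]; last first.
  by rewrite !dextension_rr addr0 subr0 mulr0.
by rewrite !dextension_rl dextension_rr addr0 !subr0 mulr0.
Qed.

(** The components $\Gamma^{C'}_{AB}$ of the Levi-Civita connection of the
    extension, for a fibre index $C'$ and base indices $A$, $B$, are affine
    along the fibres; this is their constant part, and the next definition
    their linear part. *)
Definition fibre_christoffel_cst C A B (x : 'rV[R]_n) : R :=
  2^-1 * (partial A (fun y => Phi y B C) x + partial B (fun y => Phi y A C) x
          - partial C (fun y => Phi y A B) x)
  - \sum_E Phi x C E * G x A E B.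

Definition fibre_christoffel_lin C A B D (x : 'rV[R]_n) : R :=
  - (partial A (fun y => G y B D C) x + partial B (fun y => G y A D C) x
     - partial C (fun y => G y A D B) x)
  + 2 * \sum_E G x C D E * G x A E B.

Lemma fibre_affineD (a a' : 'rV[R]_n -> R) (b b' : 'I_n -> 'rV[R]_n -> R) z :
  fibre_affine a b z + fibre_affine a' b' z
  = fibre_affine (fun x => a x + a' x) (fun C x => b C x + b' C x) z.
Proof.
rewrite /fibre_affine addrACA -big_split/=; congr (_ + _).
by apply: eq_bigr => C _; rewrite mulrDl.
Qed.

Lemma fibre_affineZ (c : R) (a : 'rV[R]_n -> R) (b : 'I_n -> 'rV[R]_n -> R) z :
  c * fibre_affine a b z
  = fibre_affine (fun x => c * a x) (fun C x => c * b C x) z.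
Proof.
rewrite /fibre_affine mulrDr mulr_sumr; congr (_ + _).
by apply: eq_bigr => C _; rewrite mulrA.
Qed.

Lemma eq_fibre_affine (a a' : 'rV[R]_n -> R) (b b' : 'I_n -> 'rV[R]_n -> R) z :
  a (lsubmx z) = a' (lsubmx z) -> (forall C, b C (lsubmx z) = b' C (lsubmx z)) ->
  fibre_affine a b z = fibre_affine a' b' z.
Proof.
move=> ha hb; rewrite /fibre_affine ha; congr (_ + _).
by apply: eq_bigr => C _; rewrite hb.
Qed.

Lemma fibre_affine_sum N (a : 'I_N -> 'rV[R]_n -> R)
    (b : 'I_N -> 'I_n -> 'rV[R]_n -> R) z :
  \sum_E fibre_affine (a E) (b E) z
  = fibre_affine (fun x => \sum_E a E x) (fun C x => \sum_E b E C x) z.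
Proof.
rewrite /fibre_affine big_split/= exchange_big/=; congr (_ + _).
by apply: eq_bigr => C _; rewrite mulr_suml.
Qed.

Lemma christoffel_r_ll z C A B : cotangent M z ->
  christoffel g z (r C) (l A) (l B)
  = fibre_affine (fibre_christoffel_cst C A B) (fibre_christoffel_lin C A B) z.
Proof.
move=> Mz; rewrite christoffel_r !(dextension_ll _ _ Mz).1.
under eq_bigr => E _.
  rewrite !dextension_lr (dextension_ll _ _ Mz).2 extension_llE addr0 sub0r.
  rewrite mulrC fibre_affineZ; over.
rewrite fibre_affine_sum -![- fibre_affine _ _ _]mulN1r.
rewrite !(fibre_affineZ, fibre_affineD).
apply: eq_fibre_affine => [|D].
  rewrite /fibre_christoffel_cst mulrDr mulN1r; congr (_ * _ + _).
  rewrite mulN1r mulrN mulr_sumr -sumrN -sumrN; apply: eq_bigr => E _.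
  by move: (G _ _ _ _) (Phi _ _ _) => x y; field.
rewrite /fibre_christoffel_lin mulrDr; congr (_ + _).
  by move: (partial _ _ _) (partial _ _ _) (partial _ _ _) => x y t; field.
rewrite mulN1r mulrN !mulr_sumr -sumrN; apply: eq_bigr => E _.
by move: (G _ _ _ _) (G _ _ _ _) => x y; field.
Qed.

End Extension.

(** * The Schouten tensor of the extension *)

Lemma partialN (R : realType) (n : nat) (f : 'rV[R]_n -> R) x i :
  differentiable f x -> partial i (fun y => - f y) x = - partial i f x.
Proof. by move=> df; apply: deriveN; exact: diff_derivable. Qed.

Section Ricci.
Context (R : realType) (n : nat) (M : set 'rV[R]_n)
  (G : affine_connection R n) (Phi : 'rV[R]_n -> 'M[R]_n).
Hypotheses (oM : open M) (tG : torsion_free_connection M G)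
  (tPhi : symmetric_tensor M Phi).

Local Notation g := (modified_extension G Phi).
Local Notation l := (lshift n).
Local Notation r := (@rshift n n).

Let oW : open (cotangent M) := cotangent_open oM.

Let dG A C B x : M x -> differentiable (fun y => G y A C B) x.
Proof. by move=> Mx; exact: smooth_differentiable (tG.1 A C B) Mx. Qed.

Let dGl A C B z : cotangent M z ->
  [/\ differentiable (fun z : 'rV[R]_(n + n) => G (lsubmx z) A C B) z,
    forall E, partial (l E) (fun z : 'rV[R]_(n + n) => G (lsubmx z) A C B) z
      = partial E (fun x => G x A C B) (lsubmx z) &
    forall E, partial (r E) (fun z : 'rV[R]_(n + n) => G (lsubmx z) A C B) z = 0].
Proof. by move=> Mz; exact: partial_lsubmx (dG A C B Mz). Qed.

Lemma smooth_fibre_christoffel_cst C A B :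
  smooth_on M (fibre_christoffel_cst G Phi C A B).
Proof.
have sP D E F : smooth_on M (partial D (fun y => Phi y E F)).
  by apply: smooth_partial; exact: tPhi.1.
apply: smoothD => //.
  apply: smoothM => //; first exact: smooth_cst.
  by apply: smoothD => //; [exact: smoothD|exact: smoothN].
apply: smoothN => //; apply: smooth_sum => // E; apply: smoothM => //.
  exact: tPhi.1.
exact: tG.1.
Qed.

Lemma smooth_fibre_christoffel_lin C A B D :
  smooth_on M (fibre_christoffel_lin G C A B D).
Proof.
have sP E F H I : smooth_on M (partial I (fun y => G y E F H)).
  by apply: smooth_partial; exact: tG.1.
apply: smoothD => //.
  apply: smoothN => //.
  by apply: smoothD => //; [exact: smoothD|exact: smoothN].
apply: smoothM => //; first exact: smooth_cst.
by apply: smooth_sum => // E; apply: smoothM => //; exact: tG.1.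
Qed.

Let Gsym x A C B : M x -> G x A C B = G x B C A.
Proof. exact: tG.2. Qed.

Lemma dchristoffel_trace z i j : cotangent M z ->
  \sum_k partial j (fun y => christoffel g y k i k) z = 0.
Proof.
move=> Mz; case: (split_ordP i) => A ->; rewrite big_split_ord/= -big_split/=.
  apply: big1 => C _.
  rewrite (eq_on_partial j oW Mz (fun y => @christoffel_l_ll _ _ _ _ _ tG tPhi y C A C)).
  rewrite (eq_on_partial j oW Mz (fun y => @christoffel_r_lr _ _ _ _ _ tG tPhi y C A C)).
  by rewrite partialN ?subrr//; have [] := dGl A C C Mz.
apply: big1 => C _.
rewrite (_ : (fun y => _) = fun=> 0); last first.
  by apply/funext => y; rewrite christoffel_l_rl.
rewrite [X in _ + partial _ X _](_ : _ = fun=> 0); last first.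
  by apply/funext => y; rewrite christoffel_r_rr.
by rewrite !partial_cst addr0.
Qed.

(** The metric has unit determinant up to sign, so its connection preserves the
    coordinate volume form. *)
Lemma christoffel_trace z i : cotangent M z ->
  \sum_k christoffel g z k k i = 0.
Proof.
move=> Mz; case: (split_ordP i) => A ->; rewrite big_split_ord/= -big_split/=.
  apply: big1 => C _.
  rewrite (christoffel_l_ll tG tPhi)// (christoffel_r_rl tG tPhi)//.
  by rewrite Gsym// subrr.
by apply: big1 => C _; rewrite christoffel_l_lr christoffel_r_rr addr0.
Qed.

Lemma ricciE z i j : cotangent M z ->
  ricci g z i j = \sum_k partial k (fun y => christoffel g y k i j) z
    - \sum_k \sum_p christoffel g z k j p * christoffel g z p i k.
Proof.
move=> Mz; have T3 : \sum_k \sum_p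
    christoffel g z k k p * christoffel g z p i j = 0.
  rewrite exchange_big/= big1// => p _.
  by rewrite -mulr_suml christoffel_trace// mul0r.
rewrite /ricci mxE.
rewrite [X in _ - X + _](dchristoffel_trace i j Mz).
by rewrite [X in _ - 0 + X]T3 subr0 addr0.
Qed.

(** The Ricci tensor of the connection [G], symmetrized; for a special connection
    on a surface it is the projective Schouten tensor. *)
Definition projective_schouten (x : 'rV[R]_n) : 'M[R]_n := \matrix_(A, B)
  (\sum_C partial C (fun y => G y A C B) x
   - 2^-1 * (\sum_C partial A (fun y => G y B C C) x
             + \sum_C partial B (fun y => G y A C C) x)
   + \sum_C \sum_E G x C C E * G x A E B
   - \sum_C \sum_E G x B C E * G x A E C).

(** The symmetrization of the derivative terms comes from the trace over the
    fibre indices, that is from [fibre_christoffel_lin]. *)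
Lemma ricci_ll z A B : cotangent M z ->
  ricci g z (l A) (l B) = 2 * projective_schouten (lsubmx z) A B.
Proof.
move=> Mz; rewrite ricciE// !big_split_ord/=.
have -> : \sum_(k < n) \sum_p christoffel g z (l k) (l B) p * christoffel g z p (l A) (l k)
    = \sum_C \sum_E G (lsubmx z) B C E * G (lsubmx z) A E C.
  apply: eq_bigr => C _; rewrite big_split_ord/= [X in _ + X]big1 => [|E _].
    rewrite addr0; apply: eq_bigr => E _.
    by rewrite !(christoffel_l_ll tG tPhi).
  by rewrite christoffel_l_lr mul0r.
have -> : \sum_(k < n) \sum_p christoffel g z (r k) (l B) p * christoffel g z p (l A) (r k)
    = \sum_C \sum_E G (lsubmx z) B C E * G (lsubmx z) A E C.
  rewrite [RHS]exchange_big/=; apply: eq_bigr => C _.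
  rewrite big_split_ord/= [X in X + _]big1 => [|E _].
    rewrite add0r; apply: eq_bigr => E _.
    by rewrite !(christoffel_r_lr tG tPhi)// mulrNN.
  by rewrite christoffel_l_lr mulr0.
have -> : \sum_(k < n) partial (l k) (fun y => christoffel g y (l k) (l A) (l B)) z
    = \sum_C partial C (fun y => G y A C B) (lsubmx z).
  apply: eq_bigr => C _.
  rewrite (eq_on_partial (l C) oW Mz (fun y => @christoffel_l_ll _ _ _ _ _ tG tPhi y C A B)).
  by have [_ -> _] := dGl A C B Mz.
have -> : \sum_(k < n) partial (r k) (fun y => christoffel g y (r k) (l A) (l B)) z
    = \sum_C fibre_christoffel_lin G C A B C (lsubmx z).
  apply: eq_bigr => C _.
  rewrite (eq_on_partial (r C) oW Mz (fun y => @christoffel_r_ll _ _ _ _ _ tG tPhi y C A B)).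
  have [|D|_ _ ->//] := @partial_fibre_affine _ _ (fibre_christoffel_cst G Phi C A B)
    (fibre_christoffel_lin G C A B) z.
    exact: (smooth_differentiable (smooth_fibre_christoffel_cst C A B) Mz).
  exact: (smooth_differentiable (smooth_fibre_christoffel_lin C A B D) Mz).
rewrite /projective_schouten mxE /fibre_christoffel_lin big_split/= sumrN sumrB big_split/= -mulr_sumr.
set a := \sum_C partial C _ _; set b := \sum_C partial A _ _.
set c := \sum_C partial B _ _; set d := \sum_C \sum_E _; set e := \sum_C \sum_E _.
by move: a b c d e => a b c d e; field.
Qed.

Lemma ricci_lr z A B : cotangent M z -> ricci g z (l A) (r B) = 0.
Proof.
move=> Mz; rewrite ricciE// !big_split_ord/=.
rewrite big1 => [|C _]; last first.
  rewrite (_ : (fun y => _) = fun=> 0) ?partial_cst//.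
  by apply/funext => y; rewrite christoffel_l_lr.
rewrite big1 => [|C _]; last first.
  rewrite (eq_on_partial (r C) oW Mz (fun y => @christoffel_r_lr _ _ _ _ _ tG tPhi y C A B)).
  have [d _ pr] := dGl A B C Mz.
  by rewrite partialN// pr oppr0.
rewrite big1 => [|C _]; last first.
  apply: big1 => p _; case: (split_ordP p) => E ->.
    by rewrite christoffel_l_rl mul0r.
  by rewrite christoffel_l_rr mul0r.
rewrite big1 ?addr0 ?subr0// => C _.
apply: big1 => p _; case: (split_ordP p) => E ->.
  by rewrite christoffel_l_lr mulr0.
by rewrite christoffel_r_rr mul0r.
Qed.

Lemma ricci_rl z A B : cotangent M z -> ricci g z (r A) (l B) = 0.
Proof.
move=> Mz; rewrite ricciE// !big_split_ord/=.
rewrite big1 => [|C _]; last first.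
  rewrite (_ : (fun y => _) = fun=> 0) ?partial_cst//.
  by apply/funext => y; rewrite christoffel_l_rl.
rewrite big1 => [|C _]; last first.
  rewrite (eq_on_partial (r C) oW Mz (fun y => @christoffel_r_rl _ _ _ _ _ tG tPhi y C A B)).
  have [d _ pr] := dGl B A C Mz.
  by rewrite partialN// pr oppr0.
rewrite big1 => [|C _]; last first.
  apply: big1 => p _; case: (split_ordP p) => E ->.
    by rewrite christoffel_l_rl mulr0.
  by rewrite christoffel_l_lr mul0r.
rewrite big1 ?addr0 ?subr0// => C _.
apply: big1 => p _; case: (split_ordP p) => E ->.
  by rewrite christoffel_l_rr mulr0.
by rewrite christoffel_r_rr mulr0.
Qed.

Lemma ricci_rr z A B : cotangent M z -> ricci g z (r A) (r B) = 0.
Proof.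
move=> Mz; rewrite ricciE// !big_split_ord/=.
rewrite big1 => [|C _]; last first.
  rewrite (_ : (fun y => _) = fun=> 0) ?partial_cst//.
  by apply/funext => y; rewrite christoffel_l_rr.
rewrite big1 => [|C _]; last first.
  rewrite (_ : (fun y => _) = fun=> 0) ?partial_cst//.
  by apply/funext => y; rewrite christoffel_r_rr.
rewrite big1 => [|C _]; last first.
  apply: big1 => p _; case: (split_ordP p) => E ->.
    by rewrite christoffel_l_rl mul0r.
  by rewrite christoffel_l_rr mul0r.
rewrite big1 ?addr0 ?subr0// => C _.
apply: big1 => p _; case: (split_ordP p) => E ->.
  by rewrite christoffel_l_rr mulr0.
by rewrite christoffel_r_rr mul0r.
Qed.

Lemma scalar_curvature_extension z : cotangent M z ->
  metric_trace (g z) (ricci g z) = 0.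
Proof.
move=> Mz; rewrite /metric_trace big1// => i _.
rewrite big_split_ord/=; case: (split_ordP i) => A ->.
  rewrite !big1 ?addr0// => B _; first by rewrite ricci_lr// mulr0.
  by rewrite invmx_extension_ll mul0r.
by rewrite !big1 ?addr0// => B _; rewrite ?ricci_rl ?ricci_rr// mulr0.
Qed.

(** The scalar curvature vanishes, because the Ricci tensor lives on the base
    indices, where the inverse metric is zero. *)
Lemma schouten_extension z : cotangent M z ->
  schouten g z = ((n + n)%:R - 2)^-1 *:
    block_mx (2 *: projective_schouten (lsubmx z)) 0 0 0.
Proof.
move=> Mz; rewrite /schouten scalar_curvature_extension// mul0r scale0r subr0.
congr (_ *: _); apply/matrixP => i j.
case: (split_ordP i) => A ->; case: (split_ordP j) => B ->.
- by rewrite block_mxEul ricci_ll// [RHS]mxE.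
- by rewrite block_mxEur ricci_lr// mxE.
- by rewrite block_mxEdl ricci_rl// mxE.
- by rewrite block_mxEdr ricci_rr// mxE.
Qed.

End Ricci.

(** * The connection of rank six and its curvature *)

Lemma sum_ord2 (V : nmodType) (F : 'I_2 -> V) : \sum_i F i = F 0 + F 1.
Proof.
rewrite !big_ord_recl big_ord0 addr0; congr (F _ + F _); exact: val_inj.
Qed.

Lemma ord2P (P : 'I_2 -> Prop) : P 0 -> P 1 -> forall i, P i.
Proof.
move=> P0 P1 [[|[|//]] h].
  by have <- : 0 = Ordinal h :> 'I_2 by exact: val_inj.
by have <- : 1 = Ordinal h :> 'I_2 by exact: val_inj.
Qed.

Notation ord6 k := (@Ordinal 6 k isT).

Lemma sum_ord6 (V : nmodType) (F : 'I_6 -> V) :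
  \sum_i F i = F (ord6 0) + F (ord6 1) + F (ord6 2) + F (ord6 3) + F (ord6 4)
    + F (ord6 5).
Proof.
rewrite !big_ord_recl big_ord0 addr0 !addrA.
by congr (F _ + F _ + F _ + F _ + F _ + F _); exact: val_inj.
Qed.

Lemma ord6P (P : 'I_6 -> Prop) :
  P (ord6 0) -> P (ord6 1) -> P (ord6 2) -> P (ord6 3) -> P (ord6 4) ->
  P (ord6 5) -> forall i, P i.
Proof.
move=> P0 P1 P2 P3 P4 P5 [[|[|[|[|[|[|//]]]]]] h];
  by rewrite (bool_irrelevance h isT).
Qed.

(** The matrix, in the direction $a$, of the system satisfied by
    $(\xi^0, \xi^1, \lambda, f, \mu_0, \mu_1)$: the rows are the right hand
    sides of
    $\partial_a \xi^B = \lambda \delta_a^B - \Gamma_a{}^B{}_C \xi^C$,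
    $\partial_a \lambda = - P_{aE} \xi^E$, $\partial_a f = \mu_a$ and
    $\partial_a \mu_B = Q_{CaB} \xi^C + \lambda \Phi_{aB} - P_{aB} f
    + \Gamma_a{}^C{}_B \mu_C$. It is linear in its data, so that its partial
    derivatives are again of this form. *)
Definition prolongation_mx (R : realType) (Ga : 'I_2 -> 'I_2 -> R)
    (ea Pa : 'I_2 -> R) (Qa : 'I_2 -> 'I_2 -> R) (Fa : 'I_2 -> R) : 'M[R]_6 :=
  \matrix_(i, j) nth 0 (nth [::] [::
    [:: - Ga 0 0; - Ga 0 1; ea 0; 0; 0; 0];
    [:: - Ga 1 0; - Ga 1 1; ea 1; 0; 0; 0];
    [:: - Pa 0; - Pa 1; 0; 0; 0; 0];
    [:: 0; 0; 0; 0; ea 0; ea 1];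
    [:: Qa 0 0; Qa 1 0; Fa 0; - Pa 0; Ga 0 0; Ga 1 0];
    [:: Qa 0 1; Qa 1 1; Fa 1; - Pa 1; Ga 0 1; Ga 1 1]] i) j.

(** The formula of [fibre_christoffel_cst] with the derivatives of the tensor as
    independent variables. *)
Definition christoffel_cst (R : realType) (F : 'I_2 -> 'I_2 -> R)
    (dF : 'I_2 -> 'I_2 -> 'I_2 -> R) (G : 'I_2 -> 'I_2 -> 'I_2 -> R)
    (A C B : 'I_2) : R :=
  2^-1 * (dF A B C + dF B A C - dF C A B) - \sum_E F C E * G A E B.

Definition vec6 (R : realType) (a b c d e f : R) : 'cV[R]_6 :=
  \col_i nth 0 [:: a; b; c; d; e; f] i.

Lemma vec6E (R : realType) (v : 'cV[R]_6) :
  v = vec6 (v (ord6 0) 0) (v (ord6 1) 0) (v (ord6 2) 0) (v (ord6 3) 0)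
        (v (ord6 4) 0) (v (ord6 5) 0).
Proof. by apply/matrixP => i j; rewrite ord1 mxE; elim/ord6P: i. Qed.

Lemma vec6B (R : realType) (a b c d e f a' b' c' d' e' f' : R) :
  vec6 a b c d e f - vec6 a' b' c' d' e' f'
  = vec6 (a - a') (b - b') (c - c') (d - d') (e - e') (f - f').
Proof. by apply/matrixP => i j; rewrite !mxE; elim/ord6P: i. Qed.

Lemma prolongation_mulmx (R : realType) (Ga : 'I_2 -> 'I_2 -> R)
    (ea Pa : 'I_2 -> R) (Qa : 'I_2 -> 'I_2 -> R) (Fa : 'I_2 -> R)
    (x y l f p q : R) :
  prolongation_mx Ga ea Pa Qa Fa *m vec6 x y l f p q
  = vec6 (ea 0 * l - (Ga 0 0 * x + Ga 0 1 * y))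
      (ea 1 * l - (Ga 1 0 * x + Ga 1 1 * y))
      (- (Pa 0 * x + Pa 1 * y))
      (ea 0 * p + ea 1 * q)
      (Qa 0 0 * x + Qa 1 0 * y + Fa 0 * l - Pa 0 * f + Ga 0 0 * p + Ga 1 0 * q)
      (Qa 0 1 * x + Qa 1 1 * y + Fa 1 * l - Pa 1 * f + Ga 0 1 * p + Ga 1 1 * q).
Proof.
apply/matrixP => i j; rewrite ord1 mxE sum_ord6 !mxE.
by elim/ord6P: i => /=; ring.
Qed.

(** In dimension two the Riemann tensor is a combination of the Schouten tensor
    and the identity (last two hypotheses), which makes the action of the
    curvature on $\xi$ cancel against the terms of $\lambda$ and $P$. What
    survives is the Cotton tensor [y0], [y1], in two places, and one further
    function [k]. *)
Lemma prolongation_curvature (R : realType) (G : 'I_2 -> 'I_2 -> 'I_2 -> R)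
    (dG : 'I_2 -> 'I_2 -> 'I_2 -> 'I_2 -> R) (P : 'I_2 -> 'I_2 -> R)
    (dP : 'I_2 -> 'I_2 -> 'I_2 -> R) (F : 'I_2 -> 'I_2 -> R)
    (dF : 'I_2 -> 'I_2 -> 'I_2 -> R) (ddF : 'I_2 -> 'I_2 -> 'I_2 -> 'I_2 -> R) :
  (forall B, G 1 B 0 = G 0 B 1) -> (forall E B, dG E 1 B 0 = dG E 0 B 1) ->
  P 1 0 = P 0 1 -> (forall E, dP E 1 0 = dP E 0 1) ->
  F 1 0 = F 0 1 -> (forall E, dF E 1 0 = dF E 0 1) ->
  (forall E D, ddF E D 1 0 = ddF E D 0 1) ->
  (forall A B, ddF 1 0 A B = ddF 0 1 A B) ->
  (forall C, dG 0 1 1 C = dG 1 0 1 C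
     - (G 0 1 0 * G 1 0 C + G 0 1 1 * G 1 1 C
        - (G 1 1 0 * G 0 0 C + G 1 1 1 * G 0 1 C)) - P 0 C) ->
  (forall C, dG 0 1 0 C = dG 1 0 0 C
     - (G 0 0 0 * G 1 0 C + G 0 0 1 * G 1 1 C
        - (G 1 0 0 * G 0 0 C + G 1 0 1 * G 0 1 C)) + P 1 C) ->
  let e A B : R := (A == B)%:R in
  let Q := christoffel_cst F dF G in
  let dQ D A C B := 2^-1 * (ddF D A B C + ddF D B A C - ddF D C A B)
    - \sum_E (dF D C E * G A E B + F C E * dG D A E B) in
  let T A := prolongation_mx (G A) (e A) (P A) (Q A) (F A) in
  let dT D A := prolongation_mx (dG D A) (fun=> 0) (dP D A) (dQ D A) (dF D A) in
  exists y0 y1 k : R, forall x0 x1 l f p q,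
  (dT 0 1 - dT 1 0 - (T 0 *m T 1 - T 1 *m T 0)) *m vec6 x0 x1 l f p q
  = vec6 0 0 (y0 * x0 + y1 * x1) 0 (k * x1 + y0 * f) (- k * x0 + y1 * f).
Proof.
move=> hG hdG hP hdP hF hdF hddF hS hR1 hR0 e Q dQ T dT.
(* The components of the Cotton tensor. *)
pose y E := - (dP 0 1 E - dP 1 0 E)
  - (P 0 0 * G 1 0 E + P 0 1 * G 1 1 E - (P 1 0 * G 0 0 E + P 1 1 * G 0 1 E)).
exists (y 0), (y 1), (dQ 0 1 1 0 - dQ 1 0 1 0
    + (Q 0 0 0 * G 1 0 1 + Q 0 1 0 * G 1 1 1 + F 0 0 * P 1 1
       - (G 0 0 0 * Q 1 1 0 + G 0 1 0 * Q 1 1 1))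
    - (Q 1 0 0 * G 0 0 1 + Q 1 1 0 * G 0 1 1 + F 1 0 * P 0 1
       - (G 1 0 0 * Q 0 1 0 + G 1 1 0 * Q 0 1 1))) => x0 x1 l f p q.
rewrite !mulmxBl -!mulmxA !prolongation_mulmx !vec6B.
rewrite /y /e /dQ /Q /christoffel_cst !sum_ord2 /=.
rewrite {y e dQ Q T dT}.
rewrite ?(hR1 0) ?(hR1 1) ?(hR0 0) ?(hR0 1).
rewrite ?(hG 0) ?(hG 1) ?(hdG 0 0) ?(hdG 0 1) ?(hdG 1 0) ?(hdG 1 1).
rewrite ?hP ?(hdP 0) ?(hdP 1) ?hF ?(hdF 0) ?(hdF 1).
rewrite ?(hddF 0 0) ?(hddF 0 1) ?(hddF 1 0) ?(hddF 1 1).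
rewrite ?(hS 0 0) ?(hS 0 1) ?(hS 1 1) ?(hR1 0) ?(hR1 1) ?(hR0 0) ?(hR0 1).
rewrite ?(hG 0) ?(hG 1) ?hP.
move: (G 0 0 0) (G 0 0 1) (G 1 0 1) (G 0 1 0) (G 0 1 1) (G 1 1 1)
  => g000 g001 g101 g010 g011 g111.
move: (dG 1 0 0 0) (dG 1 0 0 1) (dG 0 1 0 1) (dG 1 0 1 0) (dG 1 0 1 1) (dG 0 1 1 1)
  (dG 1 1 0 1) (dG 1 1 1 1) => d1 d2 d3 d4 d5 d6 d7 d8.
move: (P 0 0) (P 0 1) (P 1 1) (F 0 0) (F 0 1) (F 1 1) => p00 p01 p11 f00 f01 f11.
congr vec6.
- by ring.
- by ring.
- by ring.
- by ring.
- by field.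
- by field.
Qed.

(** For a connection preserving a volume form, $R_{01}{}^C{}_C = 0$ (the third
    hypothesis), so the four components $R_{01}{}^C{}_B$ are determined by the
    three of the symmetric Ricci tensor. *)
Lemma riemann_schouten (R : realType) (G : 'I_2 -> 'I_2 -> 'I_2 -> R)
    (dG : 'I_2 -> 'I_2 -> 'I_2 -> 'I_2 -> R) :
  (forall B, G 1 B 0 = G 0 B 1) -> (forall E B, dG E 1 B 0 = dG E 0 B 1) ->
  \sum_C dG 0 1 C C = \sum_C dG 1 0 C C ->
  let P A B := \sum_C dG C A C B
   - 2^-1 * (\sum_C dG A B C C + \sum_C dG B A C C)
   + \sum_C \sum_E G C C E * G A E B - \sum_C \sum_E G B C E * G A E C in
  (forall C, dG 0 1 1 C = dG 1 0 1 C
     - (G 0 1 0 * G 1 0 C + G 0 1 1 * G 1 1 C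
        - (G 1 1 0 * G 0 0 C + G 1 1 1 * G 0 1 C)) - P 0 C) /\
  (forall C, dG 0 1 0 C = dG 1 0 0 C
     - (G 0 0 0 * G 1 0 C + G 0 0 1 * G 1 1 C
        - (G 1 0 0 * G 0 0 C + G 1 0 1 * G 0 1 C)) + P 1 C).
Proof.
move=> hG hdG; rewrite !sum_ord2 => hs P.
have {}hs : dG 0 1 1 1 = dG 1 0 0 0 + dG 1 0 1 1 - dG 0 1 0 0.
  by rewrite -hs; ring.
rewrite ?(hdG 0 0) ?(hdG 1 1) in hs.
by split; apply: ord2P; rewrite /P !sum_ord2
  ?(hG 0) ?(hG 1) ?(hdG 0 0) ?(hdG 0 1) ?(hdG 1 0) ?(hdG 1 1) ?hs; field.
Qed.

Definition connection_curvature (R : realType) (n N : nat)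
    (A : 'I_n -> 'rV[R]_n -> 'M[R]_N) (a b : 'I_n) (x : 'rV[R]_n) : 'M[R]_N :=
  \matrix_(i, j) partial a (fun y => A b y i j) x
  - \matrix_(i, j) partial b (fun y => A a y i j) x
  - (A a x *m A b x - A b x *m A a x).

Lemma connection_curvature_anti (R : realType) (n N : nat)
    (A : 'I_n -> 'rV[R]_n -> 'M[R]_N) (a b : 'I_n) (x : 'rV[R]_n) :
  connection_curvature A b a x = - connection_curvature A a b x.
Proof. by rewrite /connection_curvature !opprB addrC. Qed.

Lemma curvature0_flat (R : realType) (n N : nat) (M : set 'rV[R]_n)
    (A : 'I_n -> 'rV[R]_n -> 'M[R]_N) :
  (forall x, M x -> forall a b, connection_curvature A a b x = 0) ->
  flat_connection M A.
Proof.
move=> K0 x Mx a b i j; have := K0 x Mx a b => /matrixP/(_ i j).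
rewrite /connection_curvature => H; apply/eqP; rewrite -subr_eq0; apply/eqP.
have entryE (X Y Z : 'M[R]_N) : (X - Y - Z) i j = X i j - Y i j - Z i j.
  by rewrite !mxE.
transitivity ((0 : 'M[R]_N) i j); last by rewrite mxE.
by rewrite -H entryE; congr (_ - _ - _); rewrite mxE.
Qed.

(** Compare the two mixed second derivatives of a parallel section. *)
Lemma parallel_section_curvature (R : realType) (n N : nat) (M : set 'rV[R]_n)
    (A : 'I_n -> 'rV[R]_n -> 'M[R]_N) (u : 'rV[R]_n -> 'cV[R]_N) (x : 'rV[R]_n)
    (a b : 'I_n) :
  open M -> (forall a i j, smooth_on M (fun y => A a y i j)) ->
  parallel_section M A u -> M x -> connection_curvature A a b x *m u x = 0.
Proof.
move=> oM sA pu Mx; apply/matrixP => i j0; rewrite ord1.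
have su k : smooth_on M (fun y => u y k 0) by exact: parallel_section_smooth sA pu.
have dA c k l : differentiable (fun y => A c y k l) x.
  exact: smooth_differentiable (sA c k l) Mx.
have du k : differentiable (fun y => u y k 0) x.
  exact: smooth_differentiable (su k) Mx.
have H c d : partial c (partial d (fun y => u y i 0)) x
    = ((\matrix_(i, j) partial c (fun y => A d y i j) x) *m u x) i 0
      + (A d x *m A c x *m u x) i 0.
  rewrite (eq_on_partial c oM Mx (fun y My => (pu y My i).2 d)).
  rewrite (_ : (fun y => _) = fun y => \sum_j A d y i j * u y j 0); last first.
    by apply/funext => y; rewrite mxE.
  have dAu j : differentiable (fun y => A d y i j * u y j 0) x.
    exact: differentiableM.
  rewrite (partial_sum dAu).2 -mulmxA !mxE -big_split/=; apply: eq_bigr => j _.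
  by rewrite partialM// (pu x Mx j).2 !mxE.
have := partialC a b oM Mx (su i); rewrite !H => E.
rewrite /connection_curvature !mulmxBl [RHS]mxE.
have subE (X Y Z W : 'cV[R]_N) :
  (X - Y - (Z - W)) i 0 = X i 0 + W i 0 - (Y i 0 + Z i 0).
  by rewrite !mxE; ring.
by rewrite subE E subrr.
Qed.

(** The trace of the connection is the logarithmic derivative of the parallel
    volume form, hence closed. *)
Lemma special_connection_trace (R : realType) (n : nat) (M : set 'rV[R]_n)
    (G : affine_connection R n) (x : 'rV[R]_n) (A B : 'I_n) :
  open M -> torsion_free_connection M G -> special_connection M G -> M x ->
  \sum_C partial A (fun y => G y B C C) x = \sum_C partial B (fun y => G y A C C) x.
Proof.
move=> oM tG [v sv hv] Mx.
have dv : differentiable v x by exact: smooth_differentiable sv Mx.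
have dG E C : differentiable (fun y => G y E C C) x.
  exact: smooth_differentiable (tG.1 E C C) Mx.
have pv y E : M y -> partial E v y = (\sum_C G y E C C) * v y.
  by move=> My; apply/eqP; rewrite -subr_eq0; apply/eqP; exact: (hv y My).2.
have H E D : partial E (partial D v) x
    = (\sum_C partial E (fun y => G y D C C) x) * v x
      + (\sum_C G x D C C) * ((\sum_C G x E C C) * v x).
  rewrite (eq_on_partial E oM Mx (fun y My => pv y D My)).
  have [ds ps] := partial_sum (dG D).
  by rewrite partialM// ps pv.
have := partialC A B oM Mx sv; rewrite !H => E.
have v0 := (hv x Mx).1.
apply: (mulIf v0); move: E.
set a := \sum_C partial A _ _; set b := \sum_C partial B _ _.
move: a b (\sum_C G x A C C) (\sum_C G x B C C) (v x) => a b c d w E.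
have -> : a * w = a * w + d * (c * w) - d * (c * w) by ring.
by rewrite E; ring.
Qed.

Section Prolongation.
Context (R : realType) (M : set 'rV[R]_2)
  (G : affine_connection R 2) (Phi : 'rV[R]_2 -> 'M[R]_2).
Hypotheses (oM : open M) (tG : torsion_free_connection M G)
  (spG : special_connection M G) (tPhi : symmetric_tensor M Phi).

(** The connection whose parallel sections are the almost Einstein scales. *)
Definition prolongation (A : 'I_2) (x : 'rV[R]_2) : 'M[R]_6 :=
  prolongation_mx (G x A) (fun B => (A == B)%:R) (projective_schouten G x A)
    (fun C B => fibre_christoffel_cst G Phi C A B x) (Phi x A).

Lemma smooth_projective_schouten A B :
  smooth_on M (fun x => projective_schouten G x A B).
Proof.
have sP E F H I : smooth_on M (partial I (fun y => G y E F H)).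
  by apply: smooth_partial; exact: tG.1.
have sGG E F H I J K : smooth_on M (fun x => G x E F H * G x I J K).
  by apply: smoothM => //; exact: tG.1.
apply: (@smooth_eq_on _ _ _ (fun x =>
  \sum_C partial C (fun y => G y A C B) x
   + - (2^-1 * (\sum_C partial A (fun y => G y B C C) x
             + \sum_C partial B (fun y => G y A C C) x))
   + \sum_C \sum_E G x C C E * G x A E B
   + - (\sum_C \sum_E G x B C E * G x A E C))) => //.
  by move=> x _; rewrite mxE.
apply: smoothD => //; last first.
  by apply: smoothN => //; do 2 (apply: smooth_sum => // ?).
apply: smoothD => //; last by do 2 (apply: smooth_sum => // ?).
apply: smoothD => //; first by apply: smooth_sum.
apply: smoothN => //; apply: smoothM => //; first exact: smooth_cst.
by apply: smoothD => //; apply: smooth_sum.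
Qed.

Lemma smooth_prolongation A i j : smooth_on M (fun x => prolongation A x i j).
Proof.
have sG C B : smooth_on M (fun x => G x A C B) by exact: tG.1.
have sF B : smooth_on M (fun x => Phi x A B) by exact: tPhi.1.
have sP B := smooth_projective_schouten A B.
have sQ C B := smooth_fibre_christoffel_cst oM tG tPhi C A B.
have sc (c : R) := @smooth_cst _ _ M c oM.
have -> : (fun x => prolongation A x i j) = fun x => nth 0 (nth [::] [::
    [:: - G x A 0 0; - G x A 0 1; (A == 0)%:R; 0; 0; 0];
    [:: - G x A 1 0; - G x A 1 1; (A == 1)%:R; 0; 0; 0];
    [:: - projective_schouten G x A 0; - projective_schouten G x A 1; 0; 0; 0; 0];
    [:: 0; 0; 0; 0; (A == 0)%:R; (A == 1)%:R];
    [:: fibre_christoffel_cst G Phi 0 A 0 x; fibre_christoffel_cst G Phi 1 A 0 x;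
        Phi x A 0; - projective_schouten G x A 0; G x A 0 0; G x A 1 0];
    [:: fibre_christoffel_cst G Phi 0 A 1 x; fibre_christoffel_cst G Phi 1 A 1 x;
        Phi x A 1; - projective_schouten G x A 1; G x A 0 1; G x A 1 1]] i) j.
  by apply/funext => x; rewrite mxE.
by elim/ord6P: i; elim/ord6P: j => /=; try exact: smoothN; try exact: sc.
Qed.

Lemma dfibre_christoffel_cst D C A B x : M x ->
  partial D (fibre_christoffel_cst G Phi C A B) x
  = 2^-1 * (partial D (partial A (fun y => Phi y B C)) x
            + partial D (partial B (fun y => Phi y A C)) x
            - partial D (partial C (fun y => Phi y A B)) x)
    - \sum_E (partial D (fun y => Phi y C E) x * G x A E B
              + Phi x C E * partial D (fun y => G y A E B) x).
Proof.
move=> Mx.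
have dP E F H : differentiable (partial E (fun y => Phi y F H)) x.
  exact: (tPhi.1 F H [:: E]).
have dF F H : differentiable (fun y => Phi y F H) x by exact: (tPhi.1 F H [::]).
have dG E F H : differentiable (fun y => G y E F H) x by exact: (tG.1 E F H [::]).
have dFG E : differentiable (fun y => Phi y C E * G y A E B) x.
  exact: differentiableM.
have [ds ps] := partial_sum dFG.
have dD : differentiable (fun y => partial A (fun y => Phi y B C) y
    + partial B (fun y => Phi y A C) y) x by exact: differentiableD.
have dB : differentiable (fun y => partial A (fun y => Phi y B C) y
    + partial B (fun y => Phi y A C) y - partial C (fun y => Phi y A B) y) x.
  exact: differentiableB.
rewrite /fibre_christoffel_cst partialD; last exact: differentiableN.
  rewrite (partialM _ (differentiable_cst (2^-1 : R) x) dB).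
  rewrite partial_cst mul0r add0r (partialN _ ds) ps.
  rewrite (partialD _ dD (differentiableN (dP C A B))).
  rewrite (partialD _ (dP A B C) (dP B A C)) (partialN _ (dP C A B)).
  congr (_ - _).
  by apply: eq_bigr => E _; rewrite partialM.
by apply: differentiableM => //; exact: differentiable_cst.
Qed.

Lemma partial_prolongation D A i j x : M x ->
  partial D (fun y => prolongation A y i j) x
  = prolongation_mx (fun C B => partial D (fun y => G y A C B) x) (fun=> 0)
     (fun B => partial D (fun y => projective_schouten G y A B) x)
     (fun C B => partial D (fibre_christoffel_cst G Phi C A B) x)
     (fun B => partial D (fun y => Phi y A B) x) i j.
Proof.
move=> Mx.
have dG C B : differentiable (fun y => G y A C B) x.
  exact: smooth_differentiable (tG.1 A C B) Mx.
have dP B : differentiable (fun y => projective_schouten G y A B) x.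
  exact: smooth_differentiable (smooth_projective_schouten A B) Mx.
have -> : (fun x => prolongation A x i j) = fun x => nth 0 (nth [::] [::
    [:: - G x A 0 0; - G x A 0 1; (A == 0)%:R; 0; 0; 0];
    [:: - G x A 1 0; - G x A 1 1; (A == 1)%:R; 0; 0; 0];
    [:: - projective_schouten G x A 0; - projective_schouten G x A 1; 0; 0; 0; 0];
    [:: 0; 0; 0; 0; (A == 0)%:R; (A == 1)%:R];
    [:: fibre_christoffel_cst G Phi 0 A 0 x; fibre_christoffel_cst G Phi 1 A 0 x;
        Phi x A 0; - projective_schouten G x A 0; G x A 0 0; G x A 1 0];
    [:: fibre_christoffel_cst G Phi 0 A 1 x; fibre_christoffel_cst G Phi 1 A 1 x;
        Phi x A 1; - projective_schouten G x A 1; G x A 0 1; G x A 1 1]] i) j.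
  by apply/funext => y; rewrite mxE.
rewrite mxE.
by elim/ord6P: i; elim/ord6P: j => //=; rewrite ?partial_cst// partialN.
Qed.

Let Gsym x B : M x -> G x 1 B 0 = G x 0 B 1.
Proof. exact: tG.2. Qed.

Let dGsym x D B : M x ->
  partial D (fun y => G y 1 B 0) x = partial D (fun y => G y 0 B 1) x.
Proof. by move=> Mx; apply: eq_on_partial oM Mx _ => y My; exact: Gsym. Qed.

Let Phisym x : M x -> Phi x 1 0 = Phi x 0 1.
Proof. by move=> Mx; rewrite -[in LHS](tPhi.2 x Mx) mxE. Qed.

Let dPhisym x D : M x ->
  partial D (fun y => Phi y 1 0) x = partial D (fun y => Phi y 0 1) x.
Proof. by move=> Mx; apply: eq_on_partial oM Mx Phisym. Qed.

Lemma schouten_sym x : M x ->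
  projective_schouten G x 1 0 = projective_schouten G x 0 1.
Proof.
move=> Mx; rewrite !mxE !sum_ord2 !Gsym// !dGsym//.
by field.
Qed.

Lemma riemann_schouten_at x : M x ->
  (forall C, partial 0 (fun y => G y 1 1 C) x = partial 1 (fun y => G y 0 1 C) x
     - (G x 0 1 0 * G x 1 0 C + G x 0 1 1 * G x 1 1 C
        - (G x 1 1 0 * G x 0 0 C + G x 1 1 1 * G x 0 1 C))
     - projective_schouten G x 0 C) /\
  (forall C, partial 0 (fun y => G y 1 0 C) x = partial 1 (fun y => G y 0 0 C) x
     - (G x 0 0 0 * G x 1 0 C + G x 0 0 1 * G x 1 1 C
        - (G x 1 0 0 * G x 0 0 C + G x 1 0 1 * G x 0 1 C))
     + projective_schouten G x 1 C).
Proof.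
move=> Mx.
have [h1 h2] := @riemann_schouten R (G x)
  (fun E A C B => partial E (fun y => G y A C B) x) (fun B => Gsym B Mx)
  (fun E B => dGsym E B Mx) (special_connection_trace 0 1 oM tG spG Mx).
by split=> C; rewrite [projective_schouten _ _ _ _]mxE; [exact: h1|exact: h2].
Qed.

Lemma prolongation_curvature_at x : M x -> exists y0 y1 k, forall v,
  connection_curvature prolongation 0 1 x *m v
  = vec6 0 0 (y0 * v (ord6 0) 0 + y1 * v (ord6 1) 0) 0
      (k * v (ord6 1) 0 + y0 * v (ord6 3) 0)
      (- k * v (ord6 0) 0 + y1 * v (ord6 3) 0).
Proof.
move=> Mx.
have dSsym E : partial E (fun y => projective_schouten G y 1 0) x
    = partial E (fun y => projective_schouten G y 0 1) x.
  by apply: eq_on_partial oM Mx _ => y My; exact: schouten_sym.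
have ddPhisym E D : partial E (partial D (fun y => Phi y 1 0)) x
    = partial E (partial D (fun y => Phi y 0 1)) x.
  by apply: eq_on_partial oM Mx _ => y My; exact: dPhisym.
have ddPhiC A B : partial 1 (partial 0 (fun y => Phi y A B)) x
    = partial 0 (partial 1 (fun y => Phi y A B)) x.
  by apply: partialC oM Mx _; exact: tPhi.1.
have [hR1 hR0] := riemann_schouten_at Mx.
have [y0 [y1 [k H]]] := @prolongation_curvature R (G x)
  (fun E A C B => partial E (fun y => G y A C B) x)
  (projective_schouten G x) (fun E A B => partial E (fun y => projective_schouten G y A B) x)
  (Phi x) (fun E A B => partial E (fun y => Phi y A B) x)
  (fun E D A B => partial E (partial D (fun y => Phi y A B)) x)
  (fun B => Gsym B Mx) (fun E B => dGsym E B Mx) (schouten_sym Mx) dSsym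
  (Phisym Mx) (fun E => dPhisym E Mx) ddPhisym ddPhiC hR1 hR0.
exists y0, y1, k => v.
apply: etrans (H (v (ord6 0) 0) (v (ord6 1) 0) (v (ord6 2) 0) (v (ord6 3) 0)
  (v (ord6 4) 0) (v (ord6 5) 0)).
have dE D A : \matrix_(i, j) partial D (fun y => prolongation A y i j) x
  = prolongation_mx (fun C B => partial D (fun y => G y A C B) x) (fun=> 0)
     (fun B => partial D (fun y => projective_schouten G y A B) x)
     (fun C B => partial D (fibre_christoffel_cst G Phi C A B) x)
     (fun B => partial D (fun y => Phi y A B) x).
  by apply/matrixP => i j; rewrite mxE partial_prolongation.
have dQ D A : (fun C B => partial D (fibre_christoffel_cst G Phi C A B) x)
    = fun C B => 2^-1 * (partial D (partial A (fun y => Phi y B C)) x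
            + partial D (partial B (fun y => Phi y A C)) x
            - partial D (partial C (fun y => Phi y A B)) x)
    - \sum_E (partial D (fun y => Phi y C E) x * G x A E B
              + Phi x C E * partial D (fun y => G y A E B) x).
  by apply/funext => C; apply/funext => B; exact: dfibre_christoffel_cst.
congr (_ *m _); last exact: vec6E.
by rewrite /connection_curvature (dE 0 1) (dE 1 0) (dQ 0 1) (dQ 1 0).
Qed.

End Prolongation.

(** * The almost Einstein equation on a fibrewise affine scale *)

(** The trace of the metric is the dimension, so a pure trace tensor has zero
    trace-free part. *)
Lemma trace_free_part_eq0 (R : realType) (m : nat) (g T : 'M[R]_m) :
  g^T = g -> g \in unitmx ->
  trace_free_part g T = 0 <-> exists c, T = c *: g.
Proof.
move=> gs gu; split=> [/subr0_eq ->|[c ->]]; first by eexists.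
rewrite /trace_free_part.
have -> : metric_trace g (c *: g) = c * m%:R.
  rewrite /metric_trace -[in RHS](mxtrace1 R m) -(mulVmx gu) /mxtrace mulr_sumr.
  apply: eq_bigr => i _; rewrite mxE mulr_sumr; apply: eq_bigr => j _.
  have gij : g j i = g i j by rewrite -[in LHS]gs mxE.
  by rewrite gij [in LHS]mxE mulrCA.
case: m g T gs gu => [|m] g T gs gu; first by apply/matrixP => -[].
by rewrite mulfK ?subrr// pnatr_eq0.
Qed.

Lemma constant_derive_increment (R : realType) (f : R -> R) (c : R) :
  (forall t : R, 0 <= t <= 1 -> is_derive t 1 f c) ->
  forall t : R, 0 <= t <= 1 -> f t = f 0 + c * t.
Proof.
move=> hf t t01.
have hl (s : R) : 0 <= s <= 1 -> is_derive s 1 (fun s => c * s) c.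
  by move=> _; apply: is_derive_eq; rewrite /GRing.scale/= mulr1.
have h1 := derive_le_increment hf hl (fun s _ => lexx c) t01.
have h2 := derive_le_increment hl hf (fun s _ => lexx c) t01.
by apply/eqP; rewrite eq_le; apply/andP; split; move: h1 h2; rewrite mulr0; lra.
Qed.

Lemma lsubmx_vertical (R : realType) (n : nat) (z : 'rV[R]_(n + n)) (t : R) :
  lsubmx (row_mx (lsubmx z) 0 + t *: row_mx 0 (rsubmx z)) = lsubmx z.
Proof. by rewrite scale_row_mx add_row_mx row_mxKl scaler0 addr0. Qed.

Lemma is_derive_vertical (R : realType) (n : nat) (f : 'rV[R]_(n + n) -> R)
    (z : 'rV[R]_(n + n)) (t : R) :
  let z' := row_mx (lsubmx z) 0 + t *: row_mx 0 (rsubmx z) in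
  differentiable f z' ->
  is_derive t 1 (fun s => f (row_mx (lsubmx z) 0 + s *: row_mx 0 (rsubmx z)))
    (\sum_C rsubmx z 0 C * partial (rshift n C) f z').
Proof.
move=> z' df; have := is_derive_line df; congr (is_derive _ _ _ _).
rewrite big_split_ord/= big1 ?add0r => [|C _]; last by rewrite row_mxEl mxE mul0r.
by apply: eq_bigr => C _; rewrite row_mxEr.
Qed.

(** The vertical derivatives are constant along the segment from the zero
    section, so the scale is affine along this segment. *)
Lemma vertical_affine (R : realType) (n : nat) (M : set 'rV[R]_n)
    (s : 'rV[R]_(n + n) -> R) (z : 'rV[R]_(n + n)) :
  smooth_on (cotangent M) s ->
  (forall z, cotangent M z ->
     forall A B, partial (rshift n A) (partial (rshift n B) s) z = 0) ->
  cotangent M z ->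
  s z = fibre_affine (fun x => s (row_mx x 0))
          (fun C x => partial (rshift n C) s (row_mx x 0)) z.
Proof.
move=> ss s0 Mz.
have Mzt (t : R) : cotangent M (row_mx (lsubmx z) 0 + t *: row_mx 0 (rsubmx z)).
  by rewrite /cotangent/= lsubmx_vertical.
have ds (t : R) := is_derive_vertical (smooth_differentiable ss (Mzt t)).
have cds C (t : R) : 0 <= t <= 1 -> partial (rshift n C) s
    (row_mx (lsubmx z) 0 + t *: row_mx 0 (rsubmx z))
    = partial (rshift n C) s (row_mx (lsubmx z) 0).
  move=> t01.
  rewrite (@constant_derive_increment _ (fun t => partial (rshift n C) s
    (row_mx (lsubmx z) 0 + t *: row_mx 0 (rsubmx z))) 0 _ t t01).
    by rewrite scale0r addr0 mul0r addr0.
  move=> r r01; have := is_derive_vertical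
    (smooth_differentiable (smooth_partial (rshift n C) ss) (Mzt r)).
  congr (is_derive _ _ _ _); apply: big1 => B _; rewrite s0 ?mulr0//.
have {}ds (t : R) : 0 <= t <= 1 -> is_derive t 1
    (fun t => s (row_mx (lsubmx z) 0 + t *: row_mx 0 (rsubmx z)))
    (\sum_C rsubmx z 0 C * partial (rshift n C) s (row_mx (lsubmx z) 0)).
  move=> t01; have := ds t; congr (is_derive _ _ _ _).
  by apply: eq_bigr => C _; rewrite cds.
have := constant_derive_increment ds (t := 1).
rewrite ler01 lexx scale0r scale1r !addr0 mulr1 add_row_mx addr0 add0r hsubmxK.
by move=> -> //; rewrite /fibre_affine; congr (_ + _); apply: eq_bigr => C _; rewrite mulrC.
Qed.

Lemma fibre_affine_inj (R : realType) (n : nat) (a a' : 'rV[R]_n -> R)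
    (b b' : 'I_n -> 'rV[R]_n -> R) (x : 'rV[R]_n) :
  (forall z, lsubmx z = x -> fibre_affine a b z = fibre_affine a' b' z) ->
  a x = a' x /\ forall C, b C x = b' C x.
Proof.
move=> E; have E0 : a x = a' x.
  have := E (row_mx x 0); rewrite /fibre_affine row_mxKl row_mxKr.
  rewrite !big1 ?addr0 => [|C _|C _]; [exact|by rewrite mxE mulr0..].
split=> // C; have := E (row_mx x (delta_mx 0 C)).
rewrite /fibre_affine row_mxKl row_mxKr E0 => /(_ erefl)/addrI.
rewrite (bigD1 C)//= [RHS](bigD1 C)//= !big1 ?addr0 => [|B BC|B BC].
- by rewrite mxE !eqxx !mulr1.
- by rewrite mxE (negbTE BC) andbF mulr0.
- by rewrite mxE (negbTE BC) andbF mulr0.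
Qed.

Section FibreAffineScale.
Context (R : realType) (n : nat) (M : set 'rV[R]_n)
  (G : affine_connection R n) (Phi : 'rV[R]_n -> 'M[R]_n)
  (f : 'rV[R]_n -> R) (xi : 'I_n -> 'rV[R]_n -> R) (s : 'rV[R]_(n + n) -> R).
Hypotheses (oM : open M) (tG : torsion_free_connection M G)
  (tPhi : symmetric_tensor M Phi) (sf : smooth_on M f)
  (sxi : forall C, smooth_on M (xi C))
  (sE : forall z, cotangent M z -> s z = fibre_affine f xi z).

Local Notation g := (modified_extension G Phi).
Local Notation l := (lshift n).
Local Notation r := (@rshift n n).

Let oW : open (cotangent M) := cotangent_open oM.

Lemma partial_scale_l A z : cotangent M z ->
  partial (l A) s z = fibre_affine (partial A f) (fun C => partial A (xi C)) z.
Proof.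
move=> Mz; rewrite (eq_on_partial (l A) oW Mz sE).
have [_ -> _//] := partial_fibre_affine (smooth_differentiable sf Mz)
  (fun C => smooth_differentiable (sxi C) Mz).
Qed.

Lemma partial_scale_r A z : cotangent M z -> partial (r A) s z = xi A (lsubmx z).
Proof.
move=> Mz; rewrite (eq_on_partial (r A) oW Mz sE).
have [_ _ ->//] := partial_fibre_affine (smooth_differentiable sf Mz)
  (fun C => smooth_differentiable (sxi C) Mz).
Qed.

Lemma hessian_rr z A B : cotangent M z -> hessian g s z (r A) (r B) = 0.
Proof.
move=> Mz; rewrite mxE (eq_on_partial (r A) oW Mz (partial_scale_r B)).
have [_ _ ->] := partial_lsubmx (smooth_differentiable (sxi B) Mz).
rewrite big_split_ord/= !big1 ?addr0 ?subr0// => C _.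
  by rewrite christoffel_r_rr mul0r.
by rewrite christoffel_l_rr mul0r.
Qed.

Lemma hessian_lr z A B : cotangent M z -> hessian g s z (l A) (r B)
  = partial A (xi B) (lsubmx z) + \sum_C G (lsubmx z) A B C * xi C (lsubmx z).
Proof.
move=> Mz; rewrite mxE (eq_on_partial (l A) oW Mz (partial_scale_r B)).
have [_ -> _] := partial_lsubmx (smooth_differentiable (sxi B) Mz).
rewrite big_split_ord/= big1 ?add0r => [|C _]; last by rewrite christoffel_l_lr mul0r.
rewrite -sumrN; congr (_ + _); apply: eq_bigr => C _.
by rewrite (christoffel_r_lr tG tPhi)// partial_scale_r// mulNr opprK.
Qed.

Lemma hessian_rl z A B : cotangent M z -> hessian g s z (r A) (l B)
  = partial B (xi A) (lsubmx z) + \sum_C G (lsubmx z) B A C * xi C (lsubmx z).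
Proof.
move=> Mz; rewrite mxE (eq_on_partial (r A) oW Mz (partial_scale_l B)).
have [_ _ ->] := partial_fibre_affine
  (smooth_differentiable (smooth_partial B sf) Mz)
  (fun C => smooth_differentiable (smooth_partial B (sxi C)) Mz).
rewrite big_split_ord/= big1 ?add0r => [|C _]; last by rewrite christoffel_l_rl mul0r.
rewrite -sumrN; congr (_ + _); apply: eq_bigr => C _.
by rewrite (christoffel_r_rl tG tPhi)// partial_scale_r// mulNr opprK.
Qed.

Lemma hessian_ll z A B : cotangent M z -> hessian g s z (l A) (l B)
  = fibre_affine
      (fun x => partial A (partial B f) x - \sum_C G x A C B * partial C f x
         - \sum_C fibre_christoffel_cst G Phi C A B x * xi C x)
      (fun D x => partial A (partial B (xi D)) x
         - \sum_C G x A C B * partial C (xi D) x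
         - \sum_C fibre_christoffel_lin G C A B D x * xi C x) z.
Proof.
move=> Mz; rewrite mxE (eq_on_partial (l A) oW Mz (partial_scale_l B)).
have [_ -> _] := partial_fibre_affine
  (smooth_differentiable (smooth_partial B sf) Mz)
  (fun C => smooth_differentiable (smooth_partial B (sxi C)) Mz).
rewrite big_split_ord/=.
under eq_bigr => C _ do rewrite (christoffel_l_ll tG tPhi)// partial_scale_l// fibre_affineZ.
under [X in _ - (_ + X)]eq_bigr => C _.
  rewrite (christoffel_r_ll tG tPhi)// partial_scale_r// mulrC fibre_affineZ; over.
rewrite !fibre_affine_sum fibre_affineD -mulN1r fibre_affineZ fibre_affineD.
apply: eq_fibre_affine => [|D].
  rewrite mulN1r opprD addrA; congr (_ - _ - _).
  by apply: eq_bigr => C _; rewrite mulrC.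
rewrite mulN1r opprD addrA; congr (_ - _ - _).
by apply: eq_bigr => C _; rewrite mulrC.
Qed.

Lemma extension_sym z : cotangent M z -> (g z)^T = g z.
Proof.
move=> Mz; rewrite /modified_extension tr_block_mx trmx1 trmx0; congr block_mx.
apply/matrixP => A B; rewrite !mxE; congr (- (2 * _) + _).
  by apply: eq_bigr => C _; rewrite (tG.2 _ B C A).
by rewrite -[in LHS](tPhi.2 _ Mz) mxE.
Qed.

Lemma extension_unitmx z : g z \in unitmx.
Proof.
have gE : g z = block_mx (ulsubmx (g z)) 1%:M 1%:M 0.
  by rewrite {2}/modified_extension block_mxKul.
have /mulmx1_unit[] // : g z *m block_mx 0 1%:M 1%:M (- ulsubmx (g z)) = 1%:M.
rewrite {1}gE mulmx_block !mulmx0 !mul0mx !mulmx1 !mul1mx !addr0 add0r.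
by rewrite subrr -scalar_mx_block.
Qed.

End FibreAffineScale.

Section AlmostEinstein.
Context (R : realType) (M : set 'rV[R]_2)
  (G : affine_connection R 2) (Phi : 'rV[R]_2 -> 'M[R]_2).
Hypotheses (oM : open M) (tG : torsion_free_connection M G)
  (spG : special_connection M G) (tPhi : symmetric_tensor M Phi).

Local Notation g := (modified_extension G Phi).
Local Notation l := (lshift 2).
Local Notation r := (@rshift 2 2).

(** The components of the almost Einstein equation for the scale
    $f + \xi^C p_C$, where [c] is the trace factor: base-fibre components, then
    the parts of the base-base components that are constant and linear along
    the fibres. *)
Definition einstein_equations (f : 'rV[R]_2 -> R) (xi : 'I_2 -> 'rV[R]_2 -> R)
    (x : 'rV[R]_2) (c : R) : Prop :=
  [/\ forall A B, partial A (xi B) x + \sum_C G x A B C * xi C x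
        = c * (A == B)%:R,
    forall A B, partial A (partial B f) x - \sum_C G x A C B * partial C f x
        - \sum_C fibre_christoffel_cst G Phi C A B x * xi C x
        + projective_schouten G x A B * f x = c * Phi x A B &
    forall A B D, partial A (partial B (xi D)) x
        - \sum_C G x A C B * partial C (xi D) x
        - \sum_C fibre_christoffel_lin G C A B D x * xi C x
        + projective_schouten G x A B * xi D x = c * (- 2 * G x A D B)].

Lemma schouten_extension2 z : cotangent M z ->
  schouten g z = block_mx (projective_schouten G (lsubmx z)) 0 0 0.
Proof.
move=> Mz; rewrite (schouten_extension oM tG tPhi Mz) scale_block_mx !scaler0.
by congr block_mx; rewrite scalerA -[RHS]scale1r; congr (_ *: _); field.
Qed.

(** The factor [c] at a point of the cotangent bundle depends only on the base
    point, as it is read off from the base-fibre components, which are constant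
    along the fibres. The base-base components are then an equality of two
    functions affine along the fibres. *)
Lemma einstein_equationsP (f : 'rV[R]_2 -> R) (xi : 'I_2 -> 'rV[R]_2 -> R)
    (s : 'rV[R]_(2 + 2) -> R) :
  smooth_on M f -> (forall C, smooth_on M (xi C)) ->
  (forall z, cotangent M z -> s z = fibre_affine f xi z) ->
  (forall z, cotangent M z ->
    trace_free_part (g z) (hessian g s z + s z *: schouten g z) = 0) <->
  (forall x, M x -> exists c, einstein_equations f xi x c).
Proof.
move=> sf sxi sE.
have hll := hessian_ll oM tG tPhi sf sxi sE.
have hlr := hessian_lr oM tG tPhi sf sxi sE.
have hrl := hessian_rl oM tG tPhi sf sxi sE.
have hrr := hessian_rr G Phi oM sf sxi sE.
have entryE (X Y : 'M[R]_(2 + 2)) c i j : (X + c *: Y) i j = X i j + c * Y i j.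
  by rewrite !mxE.
have scaleE (X : 'M[R]_(2 + 2)) c i j : (c *: X) i j = c * X i j by rewrite mxE.
have mx0E (A B : 'I_2) : (0 : 'M[R]_2) A B = 0 by rewrite mxE.
have eqP z : cotangent M z -> (trace_free_part (g z)
    (hessian g s z + s z *: schouten g z) = 0 <-> exists c,
    hessian g s z + s z *: schouten g z = c *: g z).
  move=> Mz; apply: trace_free_part_eq0; last exact: extension_unitmx.
  exact: (extension_sym tG tPhi Mz).
have gll z A B : g z (l A) (l B) = fibre_affine (fun x => Phi x A B)
    (fun C x => - 2 * G x A C B) z by exact: extension_llE.
have glr z A B : g z (l A) (r B) = (A == B)%:R.
  by have := extension_lr G Phi A B => /(congr1 (@^~ z)).
have grl z A B : g z (r A) (l B) = (A == B)%:R.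
  by have := extension_rl G Phi A B => /(congr1 (@^~ z)).
have grr z A B : g z (r A) (r B) = 0.
  by have := extension_rr G Phi A B => /(congr1 (@^~ z)).
have llE z A B : cotangent M z -> hessian g s z (l A) (l B)
    + s z * projective_schouten G (lsubmx z) A B
  = fibre_affine
      (fun x => partial A (partial B f) x - \sum_C G x A C B * partial C f x
         - \sum_C fibre_christoffel_cst G Phi C A B x * xi C x
         + projective_schouten G x A B * f x)
      (fun D x => partial A (partial B (xi D)) x
         - \sum_C G x A C B * partial C (xi D) x
         - \sum_C fibre_christoffel_lin G C A B D x * xi C x
         + projective_schouten G x A B * xi D x) z.
  move=> Mz; rewrite hll// sE// mulrC fibre_affineZ fibre_affineD.
  exact: eq_fibre_affine.
split=> [H x Mx|H z Mz].
  have Tz z : cotangent M z -> exists c, [/\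
      forall A B, hessian g s z (l A) (l B)
        + s z * projective_schouten G (lsubmx z) A B = c * g z (l A) (l B) &
      forall A B, hessian g s z (l A) (r B) = c * (A == B)%:R].
    move=> Mz; have [c] := (eqP z Mz).1 (H z Mz).
    rewrite schouten_extension2// => /matrixP E; exists c; split=> A B.
      by have := E (l A) (l B); rewrite entryE scaleE block_mxEul.
    have := E (l A) (r B); rewrite entryE scaleE block_mxEur mx0E mulr0 addr0.
    by rewrite glr.
  have Mz0 : cotangent M (row_mx x (0 : 'rV[R]_2)) by rewrite /cotangent/= row_mxKl.
  have [c [_ lr0]] := Tz _ Mz0; exists c.
  have LR A B : partial A (xi B) x + \sum_C G x A B C * xi C x = c * (A == B)%:R.
    by rewrite -lr0 hlr// row_mxKl.
  have fa A B := @fibre_affine_inj _ _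
    (fun x => partial A (partial B f) x - \sum_C G x A C B * partial C f x
         - \sum_C fibre_christoffel_cst G Phi C A B x * xi C x
         + projective_schouten G x A B * f x)
    (fun x => c * Phi x A B)
    (fun D x => partial A (partial B (xi D)) x
         - \sum_C G x A C B * partial C (xi D) x
         - \sum_C fibre_christoffel_lin G C A B D x * xi C x
         + projective_schouten G x A B * xi D x)
    (fun D x => c * (- 2 * G x A D B)) x.
  have hyp A B z : lsubmx z = x -> fibre_affine
    (fun x => partial A (partial B f) x - \sum_C G x A C B * partial C f x
         - \sum_C fibre_christoffel_cst G Phi C A B x * xi C x
         + projective_schouten G x A B * f x)
    (fun D x => partial A (partial B (xi D)) x
         - \sum_C G x A C B * partial C (xi D) x
         - \sum_C fibre_christoffel_lin G C A B D x * xi C x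
         + projective_schouten G x A B * xi D x) z
    = fibre_affine (fun x => c * Phi x A B) (fun D x => c * (- 2 * G x A D B)) z.
    move=> zx; have Mz : cotangent M z by rewrite /cotangent/= zx.
    have [c' [ll' lr']] := Tz _ Mz.
    have cc' : c' = c.
      have := lr' 0 0; rewrite hlr// zx LR eqxx !mulr1; exact: esym.
    by rewrite -llE// ll' gll cc' fibre_affineZ.
  split=> // A B; first exact: (fa A B (hyp A B)).1.
  exact: (fa A B (hyp A B)).2.
apply/(eqP z Mz); have [c [LR LL0 LL1]] := H _ Mz; exists c.
rewrite schouten_extension2//; apply/matrixP => i j; rewrite entryE scaleE.
case: (split_ordP i) => A ->; case: (split_ordP j) => B ->.
- rewrite block_mxEul gll llE// fibre_affineZ.
  by apply: eq_fibre_affine => [|D]; [exact: LL0|exact: LL1].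
- by rewrite block_mxEur mx0E mulr0 addr0 hlr// LR glr.
- by rewrite block_mxEdl mx0E mulr0 addr0 hrl// LR grl eq_sym.
- by rewrite block_mxEdr mx0E mulr0 addr0 hrr// grr mulr0.
Qed.

End AlmostEinstein.

(** * Almost Einstein scales as parallel sections *)

(** Schwarz's theorem for a vector field whose covariant derivative is pure
    trace; by the curvature identities it determines the derivative of the
    trace. *)
Lemma trace_derivative (R : realType) (G : 'I_2 -> 'I_2 -> 'I_2 -> R)
    (dG : 'I_2 -> 'I_2 -> 'I_2 -> 'I_2 -> R) (P : 'I_2 -> 'I_2 -> R)
    (v dl : 'I_2 -> R) (c : R) :
  (forall B, G 1 B 0 = G 0 B 1) -> (forall E B, dG E 1 B 0 = dG E 0 B 1) ->
  (forall C, dG 0 1 1 C = dG 1 0 1 C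
     - (G 0 1 0 * G 1 0 C + G 0 1 1 * G 1 1 C
        - (G 1 1 0 * G 0 0 C + G 1 1 1 * G 0 1 C)) - P 0 C) ->
  (forall C, dG 0 1 0 C = dG 1 0 0 C
     - (G 0 0 0 * G 1 0 C + G 0 0 1 * G 1 1 C
        - (G 1 0 0 * G 0 0 C + G 1 0 1 * G 0 1 C)) + P 1 C) ->
  let dv A B := c * (A == B)%:R - \sum_C G A B C * v C in
  let ddv A B D := dl A * (B == D)%:R
    - \sum_C (dG A B D C * v C + G B D C * dv A C) in
  (forall D, ddv 0 1 D = ddv 1 0 D) -> forall A, dl A = - \sum_E P A E * v E.
Proof.
move=> hG hdG hR1 hR0 dv ddv S; apply: ord2P.
- have := S 1; rewrite /ddv /dv !sum_ord2/= !hR1 (hG 0) (hG 1) => E.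
  by apply/eqP; rewrite -subr_eq0; apply/eqP; move/eqP: E; rewrite -subr_eq0 => /eqP <-; ring.
- have := S 0; rewrite /ddv /dv !sum_ord2/= !hR0 (hG 0) (hG 1) => E.
  by apply/eqP; rewrite -subr_eq0; apply/eqP; move/esym/eqP: E; rewrite -subr_eq0 => /eqP <-; ring.
Qed.

(** The part of the almost Einstein equation that is linear along the fibres
    follows from the others: it is the derivative of the equation on the vector
    field, with the Riemann tensor expressed through the Schouten tensor. *)
Lemma second_derivative_identity (R : realType) (G : 'I_2 -> 'I_2 -> 'I_2 -> R)
    (dG : 'I_2 -> 'I_2 -> 'I_2 -> 'I_2 -> R) (P : 'I_2 -> 'I_2 -> R)
    (v : 'I_2 -> R) (c : R) :
  (forall B, G 1 B 0 = G 0 B 1) -> (forall E B, dG E 1 B 0 = dG E 0 B 1) ->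
  P 1 0 = P 0 1 ->
  (forall C, dG 0 1 1 C = dG 1 0 1 C
     - (G 0 1 0 * G 1 0 C + G 0 1 1 * G 1 1 C
        - (G 1 1 0 * G 0 0 C + G 1 1 1 * G 0 1 C)) - P 0 C) ->
  (forall C, dG 0 1 0 C = dG 1 0 0 C
     - (G 0 0 0 * G 1 0 C + G 0 0 1 * G 1 1 C
        - (G 1 0 0 * G 0 0 C + G 1 0 1 * G 0 1 C)) + P 1 C) ->
  let dv A B := c * (A == B)%:R - \sum_C G A B C * v C in
  forall A B D,
    - (\sum_E P A E * v E) * (B == D)%:R
      - \sum_C (dG A B D C * v C + G B D C * dv A C)
      - \sum_C G A C B * dv C D
      - \sum_C (- (dG A B D C + dG B A D C - dG C A D B)
                + 2 * \sum_E G C D E * G A E B) * v C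
      + P A B * v D = c * (- 2 * G A D B).
Proof.
move=> hG hdG hP hR1 hR0 dv A B D.
have hR10 := hR1 0; rewrite hdG in hR10; have hR00 := hR0 0; rewrite hdG in hR00.
elim/ord2P: A; elim/ord2P: B; elim/ord2P: D; rewrite /dv !sum_ord2 /=
  ?(hdG 0 0) ?(hdG 0 1) ?(hdG 1 0) ?(hdG 1 1) ?(hR1 1) ?(hR0 1) ?hR10 ?hR00
  ?(hG 0) ?(hG 1) ?(hdG 1 0) ?(hdG 1 1) ?hP; ring.
Qed.

Section ParallelScale.
Context (R : realType) (M : set 'rV[R]_2)
  (G : affine_connection R 2) (Phi : 'rV[R]_2 -> 'M[R]_2).
Hypotheses (oM : open M) (tG : torsion_free_connection M G)
  (spG : special_connection M G) (tPhi : symmetric_tensor M Phi).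

Local Notation g := (modified_extension G Phi).
Local Notation l := (lshift 2).
Local Notation r := (@rshift 2 2).
Local Notation P := (projective_schouten G).
Local Notation Q := (fibre_christoffel_cst G Phi).

(** All vertical-vertical components of the metric, of its connection and of its
    Schouten tensor vanish, so the equation forces the vertical Hessian to
    vanish. *)
Lemma einstein_scale_affine (s : 'rV[R]_(2 + 2) -> R) :
  smooth_on (cotangent M) s ->
  (forall z, cotangent M z ->
    trace_free_part (g z) (hessian g s z + s z *: schouten g z) = 0) ->
  exists f xi, [/\ smooth_on M f, forall C, smooth_on M (xi C) &
    forall z, cotangent M z -> s z = fibre_affine f xi z].
Proof.
move=> ss H.
have s0 z : cotangent M z ->
    forall A B, partial (r A) (partial (r B) s) z = 0.
  move=> Mz A B.
  have := H z Mz; rewrite trace_free_part_eq0; last exact: extension_unitmx.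
    2: exact: (extension_sym tG tPhi Mz).
  case=> c; rewrite (schouten_extension2 oM tG tPhi Mz).
  have entryE (X Y : 'M[R]_(2 + 2)) d i j : (X + d *: Y) i j = X i j + d * Y i j.
    by rewrite !mxE.
  have scaleE (X : 'M[R]_(2 + 2)) d i j : (d *: X) i j = d * X i j by rewrite mxE.
  move=> /matrixP/(_ (r A) (r B)); rewrite entryE scaleE block_mxEdr.
  have -> : g z (r A) (r B) = 0.
    by have := extension_rr G Phi A B => /(congr1 (@^~ z)).
  have -> : (0 : 'M[R]_2) A B = 0 by rewrite mxE.
  rewrite !mulr0 addr0 [LHS]mxE big_split_ord/= !big1 ?addr0 ?subr0// => C _.
    by rewrite christoffel_r_rr mul0r.
  by rewrite christoffel_l_rr mul0r.
have rowE (x : 'rV[R]_2) : row_mx x 0 = x *m row_mx 1%:M 0 :> 'rV[R]_(2 + 2).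
  by rewrite mul_mx_row mulmx1 mulmx0.
have Mrow x : M x -> cotangent M (x *m row_mx 1%:M 0).
  by move=> Mx; rewrite -rowE /cotangent/= row_mxKl.
have sm t : smooth_on (cotangent M) t -> smooth_on M (fun x => t (row_mx x 0)).
  move=> st; rewrite (_ : (fun x => _) = fun x => t (x *m row_mx 1%:M 0)).
    exact: smooth_mulmx oM Mrow st.
  by apply/funext => x; rewrite rowE.
exists (fun x => s (row_mx x 0)), (fun C x => partial (r C) s (row_mx x 0)).
split=> [|C|z]; first exact: sm.
  by apply: sm; exact: smooth_partial.
exact: vertical_affine.
Qed.

Let Gsym B x : M x -> G x 1 B 0 = G x 0 B 1.
Proof. exact: tG.2. Qed.

Let dGsym E B x : M x ->
  partial E (fun y => G y 1 B 0) x = partial E (fun y => G y 0 B 1) x.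
Proof. by move=> Mx; apply: eq_on_partial oM Mx _ => y My; exact: tG.2. Qed.

Lemma prolongation_action A x (v : 'cV[R]_6) :
  prolongation G Phi A x *m v
  = let w i := v i 0 in let ea (B : 'I_2) : R := (A == B)%:R in
    let xi (C : 'I_2) := [:: w (ord6 0); w (ord6 1)]`_C in
    let mu (C : 'I_2) := [:: w (ord6 4); w (ord6 5)]`_C in
    let row4 B := \sum_C Q C A B x * xi C + Phi x A B * w (ord6 2)
      - P x A B * w (ord6 3) + \sum_C G x A C B * mu C in
    vec6 (w (ord6 2) * ea 0 - \sum_C G x A 0 C * xi C)
      (w (ord6 2) * ea 1 - \sum_C G x A 1 C * xi C)
      (- \sum_E P x A E * xi E) (mu A) (row4 0) (row4 1).
Proof.
rewrite [in LHS](vec6E v) prolongation_mulmx /= !sum_ord2/=.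
congr vec6; [by rewrite mulrC|by rewrite mulrC| |by rewrite addrA..].
by elim/ord2P: A; rewrite /= ?mul1r ?mul0r ?addr0 ?add0r.
Qed.

Definition scale_field (u : 'rV[R]_2 -> 'cV[R]_6) (C : 'I_2) (x : 'rV[R]_2) : R :=
  [:: u x (ord6 0) 0; u x (ord6 1) 0]`_C.

Definition scale_gradient (u : 'rV[R]_2 -> 'cV[R]_6) (C : 'I_2) (x : 'rV[R]_2) : R :=
  [:: u x (ord6 4) 0; u x (ord6 5) 0]`_C.

(** The system of [prolongation_mx] in tensor notation. *)
Definition prolonged_equations (u : 'rV[R]_2 -> 'cV[R]_6) (x : 'rV[R]_2) : Prop :=
  [/\ forall A B, partial A (scale_field u B) x
        = u x (ord6 2) 0 * (A == B)%:R - \sum_C G x A B C * scale_field u C x,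
    forall A, partial A (fun y => u y (ord6 2) 0) x
        = - \sum_E P x A E * scale_field u E x,
    forall A, partial A (fun y => u y (ord6 3) 0) x = scale_gradient u A x &
    forall A B, partial A (scale_gradient u B) x
        = \sum_C Q C A B x * scale_field u C x + Phi x A B * u x (ord6 2) 0
          - P x A B * u x (ord6 3) 0 + \sum_C G x A C B * scale_gradient u C x].

Lemma prolonged_equationsP (u : 'rV[R]_2 -> 'cV[R]_6) x :
  (forall A i, partial A (fun y => u y i 0) x = (prolongation G Phi A x *m u x) i 0)
  <-> prolonged_equations u x.
Proof.
split=> [H|[H1 H2 H3 H4] A].
  split=> [A|A|A|A]; rewrite ?H ?prolongation_action ?mxE//.
    apply: ord2P; rewrite /scale_field/=; under eq_fun do rewrite /=;
    by rewrite H prolongation_action mxE.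
  apply: ord2P; rewrite /scale_gradient/=; under eq_fun do rewrite /=;
  by rewrite H prolongation_action mxE.
rewrite prolongation_action; elim/ord6P; rewrite mxE/=.
- exact: (H1 A 0).
- exact: (H1 A 1).
- exact: H2.
- exact: H3.
- exact: (H4 A 0).
- exact: (H4 A 1).
Qed.

Lemma parallel_prolonged_equations (u : 'rV[R]_2 -> 'cV[R]_6) :
  parallel_section M (prolongation G Phi) u <->
  (forall i x, M x -> differentiable (fun y => u y i 0) x) /\
  (forall x, M x -> prolonged_equations u x).
Proof.
split=> [pu|[du H] x Mx i].
  split=> [i x Mx|x Mx]; first exact: (pu x Mx i).1.
  by apply/prolonged_equationsP => A i; exact: (pu x Mx i).2.
by split=> [|A]; [exact: du|have /prolonged_equationsP := H x Mx; exact].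
Qed.

Lemma smooth_scale_field (u : 'rV[R]_2 -> 'cV[R]_6) C :
  parallel_section M (prolongation G Phi) u -> smooth_on M (scale_field u C).
Proof.
move=> pu; have su := @parallel_section_smooth _ _ _ _ _ u _ oM
  (smooth_prolongation oM tG tPhi) pu.
by elim/ord2P: C; exact: su.
Qed.

Let second_derivative (v : 'I_2 -> 'rV[R]_2 -> R) (c : 'rV[R]_2 -> R) :
  smooth_on M c -> (forall C, smooth_on M (v C)) ->
  (forall x, M x -> forall A B, partial A (v B) x
     = c x * (A == B)%:R - \sum_C G x A B C * v C x) ->
  forall x, M x -> forall A B D, partial A (partial B (v D)) x
    = partial A c x * (B == D)%:R
      - \sum_C (partial A (fun y => G y B D C) x * v C x
                + G x B D C * (c x * (A == C)%:R - \sum_E G x A C E * v E x)).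
Proof.
move=> sc sv H x Mx A B D.
have dv C : differentiable (v C) x := smooth_differentiable (sv C) Mx.
have dG C : differentiable (fun y => G y B D C) x.
  exact: smooth_differentiable (tG.1 B D C) Mx.
have dc : differentiable c x := smooth_differentiable sc Mx.
have dGv C : differentiable (fun y => G y B D C * v C y) x by exact: differentiableM.
have [ds ps] := partial_sum dGv.
have dcst : differentiable (fun y : 'rV[R]_2 => (B == D)%:R : R) x.
  exact: differentiable_cst.
rewrite (eq_on_partial A oM Mx (fun y My => H y My B D)) partialD; last 2 first.
- exact: differentiableM.
- exact: differentiableN.
rewrite (partialM A dc dcst) partial_cst mulr0 addr0 (partialN _ ds) ps.
by congr (_ - _); apply: eq_bigr => C _; rewrite (partialM A (dG C) (dv C)) H.
Qed.

Lemma parallel_einstein_equations (u : 'rV[R]_2 -> 'cV[R]_6) :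
  parallel_section M (prolongation G Phi) u -> forall x, M x ->
  einstein_equations G Phi (fun x => u x (ord6 3) 0) (scale_field u) x
    (u x (ord6 2) 0).
Proof.
move=> pu x Mx; have [du H] := (parallel_prolonged_equations u).1 pu.
have [H1 H2 H3 H4] := H x Mx.
split=> [A B|A B|A B D].
- by rewrite H1 subrK.
- rewrite (eq_on_partial A oM Mx (fun y My => let: And4 _ _ h _ := H y My in h B)).
  rewrite H4 [X in _ - X - _ + _](_ : _ = \sum_C G x A C B * scale_gradient u C x).
    2: by apply: eq_bigr => C _; rewrite H3.
  set a := \sum_C _; set b := \sum_C _.
  move: a b (Phi x A B) (P x A B) (u x _ 0) (u x _ 0) => a b c d e f; ring.
- have su := @parallel_section_smooth _ _ _ _ _ u _ oM
    (smooth_prolongation oM tG tPhi) pu.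
  have [hR1 hR0] := riemann_schouten_at oM tG spG Mx.
  rewrite (@second_derivative (scale_field u) (fun y => u y (ord6 2) 0))//; last 2 first.
  + by move=> C; exact: smooth_scale_field.
  + by move=> y My; have [] := H y My.
  have := @second_derivative_identity R (G x)
    (fun E A C B => partial E (fun y => G y A C B) x) (P x)
    (fun C => scale_field u C x) (u x (ord6 2) 0)
    (fun B => Gsym B Mx) (fun E B => dGsym E B Mx) (schouten_sym oM tG Mx) hR1 hR0 A B D.
  rewrite H2 => <-; congr (_ - _ - _ + _).
  by apply: eq_bigr => C _; rewrite H1.
Qed.

(** The unknowns added to [f] and [xi] are the factor [c], read off from a
    diagonal component of the covariant derivative of [xi], and the gradient of
    [f]. *)
Lemma einstein_equations_parallel f xi :
  smooth_on M f -> (forall C, smooth_on M (xi C)) ->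
  (forall x, M x -> exists c, einstein_equations G Phi f xi x c) ->
  exists u, [/\ parallel_section M (prolongation G Phi) u,
    forall x, f x = u x (ord6 3) 0 & forall C x, xi C x = scale_field u C x].
Proof.
move=> sf sxi H.
pose c x := partial 0 (xi 0) x + \sum_C G x 0 0 C * xi C x.
have Hc x : M x -> einstein_equations G Phi f xi x (c x).
  move=> Mx; have [d [h1 h2 h3]] := H x Mx.
  by have -> : c x = d; [rewrite /c h1 eqxx mulr1|split].
have sc : smooth_on M c.
  apply: smoothD => //; first exact: smooth_partial.
  by apply: smooth_sum => // C; apply: smoothM => //; exact: tG.1.
pose u x := vec6 (xi 0 x) (xi 1 x) (c x) (f x) (partial 0 f x) (partial 1 f x).
have uE k : (fun x => u x k 0) = fun x => [:: xi 0 x; xi 1 x; c x; f x;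
    partial 0 f x; partial 1 f x]`_k by apply/funext => x; rewrite mxE.
have xiE C : scale_field u C = xi C.
  by elim/ord2P: C; apply/funext => x; rewrite /scale_field /u !mxE.
have gE C : scale_gradient u C = partial C f.
  by elim/ord2P: C; apply/funext => x; rewrite /scale_gradient /u !mxE.
have LR x : M x -> forall A B, partial A (xi B) x
    = c x * (A == B)%:R - \sum_C G x A B C * xi C x.
  by move=> Mx A B; have [h _ _] := Hc x Mx; rewrite -h addrK.
exists u; split=> [|x|C x]; last by rewrite xiE.
  2: by rewrite mxE.
apply/parallel_prolonged_equations; split=> [i x Mx|x Mx].
  rewrite uE; elim/ord6P: i => /=;
    apply: (smooth_differentiable _ Mx) => //; exact: smooth_partial.
have [h1 h2 h3] := Hc x Mx.
split=> [A B|A|A|A B].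
- by rewrite xiE LR// [u x _ _]mxE; under [in RHS]eq_bigr do rewrite xiE.
- rewrite uE/=; under eq_bigr do rewrite xiE.
  have [hR1 hR0] := riemann_schouten_at oM tG spG Mx.
  apply: (@trace_derivative R (G x)
    (fun E A C B => partial E (fun y => G y A C B) x) (P x)
    (fun C => xi C x) (fun A => partial A c x) (c x)
    (fun B => Gsym B Mx) (fun E B => dGsym E B Mx) hR1 hR0) => D.
  have sd A' B' := second_derivative sc sxi LR Mx A' B' D.
  exact: etrans (esym (sd 0 1)) (etrans (partialC 0 1 oM Mx (sxi D)) (sd 1 0)).
- by rewrite uE gE.
- rewrite gE.
  rewrite [X in X + _ - _](_ : _ = \sum_C Q C A B x * xi C x).
    2: by apply: eq_bigr => C _; rewrite xiE.
  rewrite [X in _ + X](_ : _ = \sum_C G x A C B * partial C f x).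
    2: by apply: eq_bigr => C _; rewrite gE.
  rewrite [u x (ord6 2) 0]mxE [u x (ord6 3) 0]mxE/=.
  have := h2 A B.
  set a := \sum_C _; set b := \sum_C _.
  move: (partial A _ x) a b (Phi x A B) (P x A B) (c x) (f x) => z a b p q d e E.
  by rewrite [p * d]mulrC -E; ring.
Qed.

End ParallelScale.

(** * Dimension of a space with given coordinates *)

Lemma has_dimension_linear (R : realType) (V : lmodType R) (S : set V) (d : nat)
    (f : 'rV[R]_d -> V) :
  linear f -> injective f -> range f = S -> has_dimension S d.
Proof.
move=> lf fI fS.
pose flin := GRing.isLinear.Build R 'rV[R]_d V *:%R f lf.
pose F : {linear 'rV[R]_d -> V} := HB.pack f flin.
by exists F.
Qed.

Definition linear_closed_set (R : realType) (U : lmodType R) (X : set U) : Prop :=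
  forall (a : R) u v, X u -> X v -> X (a *: u + v).

(** The inverse of [ev] on [X], followed by [h], is the required linear
    parametrization. *)
Lemma has_dimension_of_coordinates (R : realType) (U V : lmodType R) (X : set U)
    (h : U -> V) (d : nat) (ev : U -> 'rV[R]_d) :
  linear_closed_set X -> linear h -> linear ev ->
  (forall u, X u -> h u = 0 -> u = 0) ->
  (forall u, X u -> ev u = 0 -> u = 0) ->
  (forall v, exists2 u, X u & ev u = v) ->
  has_dimension (h @` X) d.
Proof.
move=> lX lh lev hI evI evS.
have [g gP] : exists g, forall v, X (g v) /\ ev (g v) = v.
  have [|g gP] := @choice _ _ (fun v u => X u /\ ev u = v); last by exists g.
  by move=> v; have [u] := evS v; exists u.
have subX u v : X u -> X v -> X (v - u).
  by move=> Xu Xv; rewrite addrC -scaleN1r; exact: lX.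
have subE (W : lmodType R) (k : U -> W) : linear k -> forall u v, k (v - u) = k v - k u.
  by move=> lk u v; rewrite addrC -scaleN1r lk scaleN1r addrC.
have evinj u v : X u -> X v -> ev u = ev v -> u = v.
  move=> Xu Xv E; apply/esym/eqP; rewrite -subr_eq0; apply/eqP.
  by apply: evI; [exact: subX|rewrite subE// E subrr].
have lg : linear g.
  move=> a v w; have [Xv ev_v] := gP v; have [Xw ev_w] := gP w.
  have [Xavw ev_avw] := gP (a *: v + w).
  by apply: evinj; [|exact: lX|rewrite lev ev_avw ev_v ev_w].
apply: (@has_dimension_linear _ _ _ _ (h \o g)).
- by move=> a v w /=; rewrite lg lh.
- move=> v w /= E; rewrite -[v](gP v).2 -[w](gP w).2; congr ev.
  apply/esym/eqP; rewrite -subr_eq0; apply/eqP.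
  by apply: hI; [apply: subX; exact: (gP _).1|rewrite subE// E subrr].
- apply/seteqP; split=> [_ [v _ <-]|_ [u Xu <-]].
    by exists (g v) => //; exact: (gP v).1.
  by exists (ev u) => //=; congr h; apply: evinj => //; [exact: (gP _).1|exact: (gP _).2].
Qed.

Lemma has_dimension0 (R : realType) (U V : lmodType R) (X : set U)
    (h : U -> V) :
  X 0 -> linear h -> (forall u, X u -> u = 0) -> has_dimension (h @` X) 0.
Proof.
move=> X0 lh X_eq0.
apply: (@has_dimension_of_coordinates _ _ _ X h 0 (fun=> 0)) => //.
- by move=> a u v /X_eq0 -> /X_eq0 ->; rewrite scaler0 addr0.
- by move=> a v w; rewrite scaler0 addr0.
- by move=> u Xu _; exact: X_eq0.
- by move=> u Xu _; exact: X_eq0.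
- by move=> v; exists 0 => //; apply/matrixP => i [].
Qed.

(** The image of the linear form [ev] is zero or the whole line. *)
Lemma has_dimension_le1 (R : realType) (U V : lmodType R) (X : set U)
    (h : U -> V) (ev : U -> R) :
  X 0 -> linear_closed_set X -> linear h ->
  (forall (a : R) u v, ev (a *: u + v) = a * ev u + ev v) ->
  (forall u, X u -> h u = 0 -> u = 0) ->
  (forall u, X u -> ev u = 0 -> u = 0) ->
  has_dimension (h @` X) 0 \/ has_dimension (h @` X) 1.
Proof.
move=> X0 lX lh lev hI evI.
have [[u Xu u0]|X_0] := pselect (exists2 u, X u & ev u != 0); [right|left].
  apply: (@has_dimension_of_coordinates _ _ _ X h 1 (fun u => (ev u)%:M)) => //.
  - by move=> a v w; rewrite lev raddfD/= -scale_scalar_mx.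
  - move=> v Xv /matrixP/(_ 0 0); rewrite !mxE eqxx => E; exact: evI.
  - move=> v; exists ((v 0 0 / ev u) *: u).
      by have := lX (v 0 0 / ev u) _ _ Xu X0; rewrite addr0.
    have ev0 : ev 0 = 0.
      by have := lev 1 0 0; rewrite scaler0 addr0 mul1r => /(congr1 (fun t => t - ev 0)); rewrite subrr addrK.
    rewrite -[_ *: u]addr0 lev ev0 addr0 divfK//.
    by apply/matrixP => i j; rewrite !ord1 mxE eqxx.
apply: has_dimension0 => // u Xu.
by apply: evI => //; apply/eqP/negPn/negP => u0; apply: X_0; exists u.
Qed.

(** * The integrability conditions *)

(** Extension by zero outside [M] makes a section determined by its restriction
    to [M]. *)
Definition supported_parallel_sections (R : realType) (n N : nat)
    (M : set 'rV[R]_n) (A : 'I_n -> 'rV[R]_n -> 'M[R]_N) :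
    set ('rV[R]_n -> 'cV[R]_N) :=
  [set u | parallel_section M A u /\ forall x, ~ M x -> u x = 0].

Lemma parallel_section_eq_on (R : realType) (n N : nat) (M : set 'rV[R]_n)
    (A : 'I_n -> 'rV[R]_n -> 'M[R]_N) (u v : 'rV[R]_n -> 'cV[R]_N) :
  open M -> (forall x, M x -> u x = v x) ->
  parallel_section M A u -> parallel_section M A v.
Proof.
move=> oM uv pu x Mx i; have [du Du] := pu x Mx i.
have [dv Dv] := eq_on_differentiable oM Mx
  (fun y My => congr1 (fun w : 'cV[R]_N => w i 0) (uv y My)) du.
by split=> // a; rewrite Dv Du uv.
Qed.

Lemma restrict_parallel_section (R : realType) (n N : nat) (M : set 'rV[R]_n)
    (A : 'I_n -> 'rV[R]_n -> 'M[R]_N) (u : 'rV[R]_n -> 'cV[R]_N) :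
  open M -> parallel_section M A u ->
  exists2 v, supported_parallel_sections M A v & forall x, M x -> v x = u x.
Proof.
move=> oM pu; pose v x := if pselect (M x) then u x else 0.
have vE x : M x -> v x = u x by move=> Mx; rewrite /v; case: pselect.
exists v => //; split; last by move=> x nMx; rewrite /v; case: pselect.
by apply: parallel_section_eq_on oM _ pu => x Mx; rewrite vE.
Qed.

Lemma supported_parallel_sections_linear (R : realType) (n N : nat)
    (M : set 'rV[R]_n) (A : 'I_n -> 'rV[R]_n -> 'M[R]_N) :
  linear_closed_set (supported_parallel_sections M A).
Proof.
move=> a u v [pu u0] [pv v0]; split=> [x Mx i|x nMx]; last first.
  by have -> : (a *: u + v) x = a *: u x + v x by []; rewrite u0// v0// scaler0 addr0.
have [du Du] := pu x Mx i; have [dv Dv] := pv x Mx i.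
have E : (fun y => (a *: u + v) y i 0) = fun y => a * u y i 0 + v y i 0.
  by apply/funext => y; have -> : (a *: u + v) y = a *: u y + v y by []; rewrite !mxE.
have dc : differentiable (fun _ : 'rV[R]_n => a) x by exact: differentiable_cst.
have dau : differentiable (fun y => a * u y i 0) x by exact: differentiableM.
rewrite E; split=> [|b]; first exact: differentiableD.
rewrite (partialD b dau dv) (partialM b dc du) partial_cst mul0r add0r Du Dv.
have -> : (a *: u + v) x = a *: u x + v x by [].
by rewrite mulmxDr -scalemxAr [in RHS]mxE [in RHS]mxE.
Qed.

Lemma supported_parallel_sections0 (R : realType) (n N : nat)
    (M : set 'rV[R]_n) (A : 'I_n -> 'rV[R]_n -> 'M[R]_N) :
  supported_parallel_sections M A 0.
Proof.
split=> // x Mx i.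
have -> : (fun y => (0 : 'rV[R]_n -> 'cV[R]_N) y i 0) = fun=> 0.
  by apply/funext => y; have -> : (0 : 'rV[R]_n -> 'cV[R]_N) y = 0 by []; rewrite mxE.
split=> [|a]; first exact: differentiable_cst.
by rewrite partial_cst; have -> : (0 : 'rV[R]_n -> 'cV[R]_N) x = 0 by []; rewrite mulmx0 mxE.
Qed.

Lemma supported_parallel_sections_eq0 (R : realType) (n N : nat)
    (M : set 'rV[R]_n) (A : 'I_n -> 'rV[R]_n -> 'M[R]_N) u x0 :
  convex_set M -> (forall a i j, smooth_on M (fun y => A a y i j)) ->
  supported_parallel_sections M A u -> M x0 -> u x0 = 0 -> u = 0.
Proof.
move=> cM sA [pu u0] Mx0 ux0; apply/funext => x.
have [Mx|nMx] := pselect (M x); last exact: u0.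
apply: (parallel_section_unique cM _ pu Mx0 ux0 Mx) => a i j y My.
exact: smooth_differentiable (sA a i j) My.
Qed.

Section ScalesAsSections.
Context (R : realType) (M : set 'rV[R]_2)
  (G : affine_connection R 2) (Phi : 'rV[R]_2 -> 'M[R]_2).
Hypotheses (oM : open M) (tG : torsion_free_connection M G)
  (spG : special_connection M G) (tPhi : symmetric_tensor M Phi).

Local Notation sections := (supported_parallel_sections M (prolongation G Phi)).

Definition scale_of_section (u : 'rV[R]_2 -> 'cV[R]_6) : 'rV[R]_(2 + 2) -> R^o :=
  fibre_affine (fun x => u x (ord6 3) 0) (scale_field u).

Lemma scale_fieldD a (u v : 'rV[R]_2 -> 'cV[R]_6) C x :
  scale_field (a *: u + v) C x = a * scale_field u C x + scale_field v C x.
Proof.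
have E : (a *: u + v) x = a *: u x + v x by [].
by elim/ord2P: C; rewrite /scale_field/= E !mxE.
Qed.

Lemma scale_of_section_linear : linear scale_of_section.
Proof.
move=> a u v; apply/funext => z.
transitivity (a * scale_of_section u z + scale_of_section v z) => //.
rewrite /scale_of_section fibre_affineZ fibre_affineD.
apply: eq_fibre_affine => [|C]; last exact: scale_fieldD.
have E x : (a *: u + v) x = a *: u x + v x by [].
by rewrite E !mxE.
Qed.

(** The components $\lambda$ and $\mu$ are derivatives of $\xi$ and $f$, which
    are the coefficients of the scale. *)
Lemma scale_of_section_eq0 u : sections u -> scale_of_section u = 0 -> u = 0.
Proof.
move=> [pu u0] E; apply/funext => x.
have [Mx|nMx] := pselect (M x); last exact: u0.
have [f0 xi0] : (forall y, u y (ord6 3) 0 = 0) /\ (forall y C, scale_field u C y = 0).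
  have H y := @fibre_affine_inj R 2 (fun x => u x (ord6 3) 0) (fun=> 0)
    (scale_field u) (fun _ _ => 0) y.
  have Z y : u y (ord6 3) 0 = 0 /\ forall C, scale_field u C y = 0.
    apply: H => z _; rewrite /fibre_affine [in RHS]big1 ?addr0 => [|C _]; last by rewrite mul0r.
    exact: (congr1 (@^~ z) E).
  by split=> y; have [] := Z y.
have [_ /(_ x Mx)[h1 _ h3 _]] := (parallel_prolonged_equations M G Phi u).1 pu.
have xiE C : scale_field u C = fun=> 0 by apply/funext => y; exact: xi0.
have fE : (fun y => u y (ord6 3) 0) = fun=> 0 by apply/funext => y; exact: f0.
have l0 : u x (ord6 2) 0 = 0.
  have := h1 0 0; rewrite xiE partial_cst eqxx mulr1 big1 ?subr0 => [->//|C _].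
  by rewrite xi0 mulr0.
have m0 C : scale_gradient u C x = 0 by rewrite -h3 fE partial_cst.
apply/matrixP => i j; rewrite [RHS]mxE ord1; elim/ord6P: i.
- exact: xi0 x 0.
- exact: xi0 x 1.
- exact: l0.
- exact: f0.
- exact: m0 0.
- exact: m0 1.
Qed.

Lemma almost_einstein_scalesE :
  almost_einstein_scales (cotangent M) (modified_extension G Phi)
  = scale_of_section @` sections.
Proof.
apply/seteqP; split=> [s [ss Hs s0]|_ [u [pu u0] <-]].
  have [f [xi [sf sxi sE]]] := einstein_scale_affine oM tG tPhi ss Hs.
  have H := (einstein_equationsP oM tG tPhi sf sxi sE).1 Hs.
  have [u' [pu' fE xiE]] := einstein_equations_parallel oM tG spG sf sxi H.
  have [u [pu u0] uE] := restrict_parallel_section oM pu'.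
  exists u => //; apply/funext => z.
  have [Mz|nMz] := pselect (cotangent M z).
    rewrite sE//; apply: eq_fibre_affine => [|C]; first by rewrite fE uE.
    by rewrite xiE /scale_field uE.
  rewrite s0// /scale_of_section /fibre_affine u0// mxE big1 ?addr0// => C _.
  by elim/ord2P: C; rewrite /scale_field u0//= mxE mul0r.
have sf : smooth_on M (fun x => u x (ord6 3) 0).
  exact: parallel_section_smooth oM (smooth_prolongation oM tG tPhi) pu.
have sxi C := smooth_scale_field oM tG tPhi C pu.
split=> [|z Mz|z nMz].
- exact: smooth_fibre_affine.
- apply: (einstein_equationsP oM tG tPhi sf sxi (s := scale_of_section u) _).2 Mz => //.
  move=> x Mx; exists (u x (ord6 2) 0).
  exact (parallel_einstein_equations oM tG spG tPhi pu Mx).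
- rewrite /scale_of_section /fibre_affine u0// mxE big1 ?addr0// => C _.
  by elim/ord2P: C; rewrite /scale_field u0//= mxE mul0r.
Qed.

Definition scale_curvature (x : 'rV[R]_2) : 'M[R]_6 :=
  connection_curvature (prolongation G Phi) 0 1 x.

(** The components of the Cotton tensor of the projective structure, read off
    from the action of the curvature on the vector field. *)
Definition cotton (E : 'I_2) (x : 'rV[R]_2) : R :=
  [:: scale_curvature x (ord6 2) (ord6 0); scale_curvature x (ord6 2) (ord6 1)]`_E.

(** The remaining component of the curvature, a linear differential operator of
    second order in [Phi]. *)
Definition extension_obstruction (x : 'rV[R]_2) : R :=
  scale_curvature x (ord6 4) (ord6 1).

(** The curvature is determined by the three components that
    [prolongation_curvature] leaves, and these are entries of its matrix, hence
    smooth functions. *)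
Lemma scale_curvature_action x (v : 'cV[R]_6) : M x ->
  scale_curvature x *m v
  = let y := cotton ^~ x in let k := extension_obstruction x in
    vec6 0 0 (y 0 * v (ord6 0) 0 + y 1 * v (ord6 1) 0) 0
      (k * v (ord6 1) 0 + y 0 * v (ord6 3) 0)
      (- k * v (ord6 0) 0 + y 1 * v (ord6 3) 0).
Proof.
move=> Mx; have [y0 [y1 [k H]]] := prolongation_curvature_at oM tG spG tPhi Mx.
have KE i j : scale_curvature x i j
    = (scale_curvature x *m delta_mx j (0 : 'I_1)) i 0 by rewrite -colE [RHS]mxE.
have y0E : scale_curvature x (ord6 2) (ord6 0) = y0.
  by rewrite KE H !mxE/= mulr1 mulr0 addr0.
have y1E : scale_curvature x (ord6 2) (ord6 1) = y1.
  by rewrite KE H !mxE/= mulr1 mulr0 add0r.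
have kE : scale_curvature x (ord6 4) (ord6 1) = k.
  by rewrite KE H !mxE/= mulr1 mulr0 addr0.
by rewrite /cotton /extension_obstruction /= y0E y1E kE; exact: H.
Qed.

Lemma smooth_scale_curvature i j : smooth_on M (fun x => scale_curvature x i j).
Proof.
have sA A k l := smooth_prolongation oM tG tPhi A k l.
have sAA A B : smooth_on M
    (fun x => \sum_k prolongation G Phi A x i k * prolongation G Phi B x k j).
  by apply: smooth_sum => // k; exact: smoothM.
apply: (@smooth_eq_on _ _ _ (fun x =>
  partial 0 (fun y => prolongation G Phi 1 y i j) x
  + - partial 1 (fun y => prolongation G Phi 0 y i j) x
  + - (\sum_k prolongation G Phi 0 x i k * prolongation G Phi 1 x k j
       + - \sum_k prolongation G Phi 1 x i k * prolongation G Phi 0 x k j))) => //.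
  move=> x Mx; rewrite /scale_curvature /connection_curvature.
  have entryE (X Y Z W : 'M[R]_6) : (X - Y - (Z - W)) i j = X i j - Y i j - (Z i j - W i j).
    by rewrite !mxE.
  rewrite entryE; congr (_ - _ - (_ - _)).
  - by rewrite mxE.
  - by rewrite mxE.
  - by rewrite [RHS]mxE.
  - by rewrite [RHS]mxE.
apply: smoothD => //; first apply: smoothD => //.
- exact: smooth_partial.
- by apply: smoothN => //; exact: smooth_partial.
- by apply: smoothN => //; apply: smoothD => //; exact: smoothN.
Qed.

(** A parallel section is annihilated by the curvature. *)
Lemma scale_integrability u x : parallel_section M (prolongation G Phi) u -> M x ->
  let y := cotton ^~ x in let k := extension_obstruction x in
  let xi := scale_field u ^~ x in
  [/\ y 0 * xi 0 + y 1 * xi 1 = 0, k * xi 1 + y 0 * u x (ord6 3) 0 = 0 &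
    - k * xi 0 + y 1 * u x (ord6 3) 0 = 0].
Proof.
move=> pu Mx y k xi.
have := parallel_section_curvature 0 1 oM (smooth_prolongation oM tG tPhi) pu Mx.
rewrite [LHS]scale_curvature_action// => /matrixP H.
have H2 := H (ord6 2) 0; have H4 := H (ord6 4) 0; have H5 := H (ord6 5) 0.
rewrite !mxE/= in H2; rewrite !mxE/= in H4; rewrite !mxE/= in H5.
by split.
Qed.

End ScalesAsSections.

(** * The possible dimensions *)

Section Cases.
Context (R : realType) (M : set 'rV[R]_2) (G : affine_connection R 2).
Hypotheses (oM : open M) (cM : convex_set M) (tG : torsion_free_connection M G)
  (spG : special_connection M G).

Let zero_tensor : 'rV[R]_2 -> 'M[R]_2 := fun=> 0.

Let symmetric_zero_tensor : symmetric_tensor M zero_tensor.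
Proof.
split=> [A B|x _]; last by rewrite /zero_tensor trmx0.
have -> : (fun x => zero_tensor x A B) = fun=> 0.
  by apply/funext => x; rewrite /zero_tensor mxE.
exact: smooth_cst.
Qed.

Let zero_tensor_christoffel C A B x : fibre_christoffel_cst G zero_tensor C A B x = 0.
Proof.
have E D F : (fun y => zero_tensor y D F) = fun=> 0.
  by apply/funext => y; rewrite /zero_tensor mxE.
rewrite /fibre_christoffel_cst !E !partial_cst addr0 subr0 mulr0 sub0r big1 ?oppr0//.
by move=> D _; rewrite /zero_tensor mxE mul0r.
Qed.

(** The equations on the vector field and its divergence involve neither the
    remaining unknowns nor the tensor [Phi]. Hence this part of the section,
    completed by zero, is parallel for [Phi = 0], and uniqueness applies to
    it. *)
Lemma scale_field_eq0 Phi u x1 :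
  parallel_section M (prolongation G Phi) u -> M x1 ->
  (forall C, scale_field u C x1 = 0) -> u x1 (ord6 2) 0 = 0 ->
  forall x, M x -> (forall C, scale_field u C x = 0) /\ u x (ord6 2) 0 = 0.
Proof.
move=> pu Mx1 xi0 l0.
(* The part of the section on which the equations decouple. *)
pose w x := vec6 (u x (ord6 0) 0) (u x (ord6 1) 0) (u x (ord6 2) 0) 0 0 0.
have wE k : (fun x => w x k 0) = fun x =>
    [:: u x (ord6 0) 0; u x (ord6 1) 0; u x (ord6 2) 0; 0; 0; 0]`_k.
  by apply/funext => x; rewrite mxE.
have wxi C : scale_field w C = scale_field u C.
  by elim/ord2P: C; apply/funext => x; rewrite /scale_field /w !mxE.
have wmu C : scale_gradient w C = fun=> 0.
  by elim/ord2P: C; apply/funext => x; rewrite /scale_gradient /w !mxE.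
have pw : parallel_section M (prolongation G zero_tensor) w.
  have [du H] := (parallel_prolonged_equations M G Phi u).1 pu.
  apply/parallel_prolonged_equations; split=> [i x Mx|x Mx].
    rewrite wE; elim/ord6P: i => /=; try exact: differentiable_cst; exact: du.
  have [h1 h2 _ _] := H x Mx; split=> [A B|A|A|A B].
  - by rewrite wxi h1 [w x _ _]mxE; congr (_ - _); apply: eq_bigr => C _; rewrite wxi.
  - by rewrite wE/= h2; congr (- _); apply: eq_bigr => C _; rewrite wxi.
  - by rewrite wE wmu/= partial_cst.
  - rewrite wmu partial_cst big1 => [|C _]; last by rewrite zero_tensor_christoffel mul0r.
    rewrite [zero_tensor x A B]mxE [w x _ _]mxE/= mul0r [w x _ _]mxE/= mulr0.
    by rewrite big1 ?addr0 ?subr0// => C _; rewrite wmu mulr0.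
have w1 : w x1 = 0.
  have := xi0 0; have := xi0 1; rewrite /scale_field/= => u1 u0.
  apply/matrixP => i j; rewrite ord1 !mxE.
  by elim/ord6P: i => /=.
have w0 x : M x -> w x = 0.
  apply: (parallel_section_unique cM _ pw Mx1 w1) => A i j y.
  exact: smooth_differentiable (smooth_prolongation oM tG symmetric_zero_tensor A i j).
move=> x Mx; split=> [C|].
  by rewrite -wxi; elim/ord2P: C; rewrite /scale_field/= w0// mxE.
by have := congr1 (fun t : 'cV[R]_6 => t (ord6 2) 0) (w0 x Mx); rewrite !mxE.
Qed.

Section FixedTensor.
Context (Phi : 'rV[R]_2 -> 'M[R]_2).
Hypothesis tPhi : symmetric_tensor M Phi.

Local Notation sections := (supported_parallel_sections M (prolongation G Phi)).

Let smooth_cotton C : smooth_on M (cotton G Phi C).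
Proof. by elim/ord2P: C; exact: smooth_scale_curvature. Qed.

Let smooth_section u i : sections u -> smooth_on M (fun x => u x i 0).
Proof.
by move=> [pu _]; exact: parallel_section_smooth oM (smooth_prolongation oM tG tPhi) pu.
Qed.

Lemma section_eq0 u x1 : sections u -> M x1 ->
  (forall C, scale_field u C x1 = 0) -> u x1 (ord6 2) 0 = 0 ->
  u x1 (ord6 3) 0 = 0 -> (forall C, scale_gradient u C x1 = 0) -> u = 0.
Proof.
move=> su Mx1 xi0 l0 f0 mu0.
apply: (supported_parallel_sections_eq0 cM _ su Mx1).
  by move=> A i j; exact: smooth_prolongation.
apply/matrixP => i j; rewrite ord1 [RHS]mxE; elim/ord6P: i => //.
- exact: xi0 0.
- exact: xi0 1.
- exact: mu0 0.
- exact: mu0 1.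
Qed.

(** At a point where the Cotton tensor $y$ does not vanish the integrability
    conditions leave a section one degree of freedom. The condition
    $y_E \xi^E = 0$ determines $\xi$ from its component [b]; if $\xi$ vanishes
    at the point, the derivative of this condition there is $\lambda y = 0$.
    Then $\xi$ and $\lambda$ vanish everywhere, the remaining conditions become
    $y f = 0$, and the value and the derivative of this one give $f = 0$ and
    $\mu = 0$ at the point. *)
Lemma section_eq0_cotton u x1 a b : sections u -> M x1 -> a != b ->
  cotton G Phi a x1 != 0 -> scale_field u b x1 = 0 -> u = 0.
Proof.
move=> su Mx1 ab ya xib; have [pu _] := su.
have [_ H] := (parallel_prolonged_equations M G Phi u).1 pu.
have sxi C := smooth_scale_field oM tG tPhi C pu.
have ysum x : M x -> \sum_E cotton G Phi E x * scale_field u E x = 0.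
  by move=> Mx; rewrite sum_ord2; have [] := scale_integrability oM tG spG tPhi pu Mx.
have xia : scale_field u a x1 = 0.
  have := ysum _ Mx1; rewrite (bigD1 a)//= big1 ?addr0 => [|E Ea].
    by move/eqP; rewrite mulf_eq0 (negbTE ya)/= => /eqP.
  have -> : E = b by apply/eqP; move: a b E ab Ea {ya xib}; do 3 elim/ord2P.
  by rewrite xib mulr0.
have xi0 C : scale_field u C x1 = 0.
  have [->//|Ca] := eqVneq C a.
  by have -> : C = b by apply/eqP; move: a b C ab Ca {ya xia xib}; do 3 elim/ord2P.
have l0 : u x1 (ord6 2) 0 = 0.
  have dy E : differentiable (cotton G Phi E) x1 := smooth_differentiable (smooth_cotton E) Mx1.
  have dxi E : differentiable (scale_field u E) x1 := smooth_differentiable (sxi E) Mx1.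
  have dyxi E : differentiable (fun x => cotton G Phi E x * scale_field u E x) x1.
    exact: differentiableM.
  have := eq_on_partial a oM Mx1 ysum; rewrite (partial_sum dyxi).2 partial_cst.
  rewrite (bigD1 a)//= big1 ?addr0 => [|E Ea].
    rewrite (partialM a (dy a) (dxi a)) xi0 mulr0 add0r; have [-> _ _ _] := H _ Mx1.
    rewrite eqxx mulr1 [X in _ - X]big1 ?subr0 => [|C _]; last by rewrite xi0 mulr0.
    by move/eqP; rewrite mulf_eq0 (negbTE ya)/= => /eqP.
  rewrite (partialM a (dy E) (dxi E)) xi0 mulr0 add0r; have [-> _ _ _] := H _ Mx1.
  rewrite eq_sym (negbTE Ea) mulr0 sub0r big1 ?oppr0 ?mulr0// => C _.
  by rewrite xi0 mulr0.
have xil0 := scale_field_eq0 pu Mx1 xi0 l0.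
have yf x : M x -> cotton G Phi a x * u x (ord6 3) 0 = 0.
  move=> Mx; have [xix _] := xil0 x Mx.
  have [_] := scale_integrability oM tG spG tPhi pu Mx.
  by rewrite /= !xix !mulr0 !add0r => y0 y1; move: a {ab ya xia}; elim/ord2P.
have f0 : u x1 (ord6 3) 0 = 0.
  by have /eqP := yf _ Mx1; rewrite mulf_eq0 (negbTE ya)/= => /eqP.
apply: (section_eq0 su Mx1) => // C.
have dy : differentiable (cotton G Phi a) x1 := smooth_differentiable (smooth_cotton a) Mx1.
have df := smooth_differentiable (smooth_section (ord6 3) su) Mx1.
have := eq_on_partial C oM Mx1 yf; rewrite (partialM C dy df) partial_cst f0 mulr0 add0r.
have [_ _ -> _] := H _ Mx1.
by move/eqP; rewrite mulf_eq0 (negbTE ya)/= => /eqP.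
Qed.

Let scales := almost_einstein_scales (cotangent M) (modified_extension G Phi).

Lemma dimension_le1_of_cotton x1 a : M x1 -> cotton G Phi a x1 != 0 ->
  has_dimension scales 0 \/ has_dimension scales 1.
Proof.
move=> Mx1 ya; rewrite /scales almost_einstein_scalesE//.
have [b ab] : exists b, a != b.
  by elim/ord2P: a {ya}; [exists 1|exists 0].
apply: (has_dimension_le1 (ev := fun u => scale_field u b x1)) => //.
- exact: supported_parallel_sections0.
- exact: supported_parallel_sections_linear.
- exact: scale_of_section_linear.
- by move=> c u v; exact: scale_fieldD.
- by move=> u; exact: scale_of_section_eq0.
- by move=> u su; exact: section_eq0_cotton su Mx1 ab ya.
Qed.

Hypothesis cotton0 : forall x, M x -> forall C, cotton G Phi C x = 0.

(** Without Cotton tensor the integrability condition is $k \xi = 0$; its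
    derivative at a zero of $\xi$ where $k$ does not vanish is
    $k \lambda = 0$. *)
Lemma field_eq0_obstruction u x1 : parallel_section M (prolongation G Phi) u ->
  M x1 -> extension_obstruction G Phi x1 != 0 ->
  forall x, M x -> (forall C, scale_field u C x = 0) /\ u x (ord6 2) 0 = 0.
Proof.
move=> pu Mx1 k1.
have kxi C x : M x -> extension_obstruction G Phi x * scale_field u C x = 0.
  move=> Mx; have [_] := scale_integrability oM tG spG tPhi pu Mx.
  rewrite /= !cotton0// !mul0r !addr0 => h1 h0; elim/ord2P: C => //.
  by apply/eqP; rewrite -oppr_eq0 -mulNr h0.
have xi0 C : scale_field u C x1 = 0.
  by have /eqP := kxi C _ Mx1; rewrite mulf_eq0 (negbTE k1)/= => /eqP.
apply: (scale_field_eq0 pu Mx1 xi0).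
have dk : differentiable (extension_obstruction G Phi) x1.
  exact: (smooth_differentiable (smooth_scale_curvature oM tG tPhi _ _) Mx1).
have dxi : differentiable (scale_field u 0) x1.
  exact: smooth_differentiable (smooth_scale_field oM tG tPhi 0 pu) Mx1.
have := eq_on_partial 0 oM Mx1 (kxi 0); rewrite (partialM 0 dk dxi) partial_cst.
have [_ /(_ _ Mx1)[-> _ _ _]] := (parallel_prolonged_equations M G Phi u).1 pu.
rewrite xi0 mulr0 add0r eqxx mulr1 big1 ?subr0 => [|C _]; last by rewrite xi0 mulr0.
by move/eqP; rewrite mulf_eq0 (negbTE k1)/= => /eqP.
Qed.

Lemma prolongation_flat :
  (forall x, M x -> extension_obstruction G Phi x = 0) ->
  flat_connection M (prolongation G Phi).
Proof.
move=> k0; apply: curvature0_flat => x Mx.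
have K0 : connection_curvature (prolongation G Phi) 0 1 x = 0.
  apply/matrixP => i j; transitivity ((scale_curvature G Phi x *m delta_mx j (0 : 'I_1)) i 0).
    by rewrite -colE [RHS]mxE.
  rewrite (scale_curvature_action oM tG spG tPhi _ Mx)/= k0// !cotton0// !mul0r oppr0 !mul0r !addr0.
  by rewrite !mxE; elim/ord6P: i.
elim/ord2P; elim/ord2P => //; try by rewrite /connection_curvature !subrr.
by rewrite connection_curvature_anti K0 oppr0.
Qed.

Lemma dimension6_of_flat x0 : M x0 ->
  (forall x, M x -> extension_obstruction G Phi x = 0) -> has_dimension scales 6.
Proof.
move=> Mx0 k0; rewrite /scales almost_einstein_scalesE//.
have sA := smooth_prolongation oM tG tPhi.
apply: (has_dimension_of_coordinates (ev := fun u => (u x0)^T)) => //.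
- exact: supported_parallel_sections_linear.
- exact: scale_of_section_linear.
- by move=> c u v; rewrite -linearP.
- by move=> u; exact: scale_of_section_eq0.
- move=> u su /(congr1 trmx); rewrite trmxK trmx0.
  exact: supported_parallel_sections_eq0 cM sA su Mx0.
- move=> v; have [u' [pu' u'0]] := flat_parallel_section v^T oM cM sA (prolongation_flat k0) Mx0.
  have [u su uE] := restrict_parallel_section oM pu'.
  by exists u => //; rewrite uE// u'0 trmxK.
Qed.

End FixedTensor.

Let prolongation_entry_zero_tensor A (i j : 'I_6) : (i < 3)%N || (2 < j)%N ->
  forall Phi x, prolongation G Phi A x i j = prolongation G zero_tensor A x i j.
Proof. by elim/ord6P: i; elim/ord6P: j => //= _ Phi x; rewrite !mxE. Qed.

(** The first three rows of the connection do not involve [Phi], and their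
    entries outside the first three columns vanish. *)
Lemma cotton_zero_tensor Phi C x : cotton G Phi C x = cotton G zero_tensor C x.
Proof.
suff E (j : 'I_6) : (j < 2)%N -> scale_curvature G Phi x (ord6 2) j
    = scale_curvature G zero_tensor x (ord6 2) j.
  by elim/ord2P: C; rewrite /cotton/= E.
move=> j2; rewrite /scale_curvature /connection_curvature.
have entryE (X Y Z W : 'M[R]_6) i k : (X - Y - (Z - W)) i k = X i k - Y i k - (Z i k - W i k).
  by rewrite !mxE.
have pE A B : (\matrix_(i, j) partial A (fun y => prolongation G Phi B y i j) x) (ord6 2) j
    = (\matrix_(i, j) partial A (fun y => prolongation G zero_tensor B y i j) x) (ord6 2) j.
  have F : (fun y => prolongation G Phi B y (ord6 2) j)
      = fun y => prolongation G zero_tensor B y (ord6 2) j.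
    by apply/funext => y; exact: prolongation_entry_zero_tensor.
  by rewrite [LHS]mxE [RHS]mxE F.
have mE A B : (prolongation G Phi A x *m prolongation G Phi B x) (ord6 2) j
    = (prolongation G zero_tensor A x *m prolongation G zero_tensor B x) (ord6 2) j.
  rewrite [LHS]mxE [RHS]mxE; apply: eq_bigr => k _.
  rewrite (prolongation_entry_zero_tensor A (i := ord6 2))//.
  have [k3|k3] := ltnP k 3; first by rewrite (prolongation_entry_zero_tensor B) ?k3.
  have -> : prolongation G zero_tensor A x (ord6 2) k = 0.
    by move: k k3; elim/ord6P => //= _; rewrite mxE.
  by rewrite !mul0r.
by rewrite !entryE (pE 0 1) (pE 1 0) (mE 0 1) (mE 1 0).
Qed.

(** For [Phi = 0] the entries of the connection that couple $\mu$ to $\xi$ and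
    $\lambda$ vanish. *)
Lemma obstruction_zero_tensor x : extension_obstruction G zero_tensor x = 0.
Proof.
rewrite /extension_obstruction /scale_curvature /connection_curvature.
have entryE (X Y Z W : 'M[R]_6) i k : (X - Y - (Z - W)) i k = X i k - Y i k - (Z i k - W i k).
  by rewrite !mxE.
have pE A B : (\matrix_(i, j) partial A (fun y => prolongation G zero_tensor B y i j) x)
    (ord6 4) (ord6 1) = 0.
  rewrite mxE (_ : (fun y => _) = fun=> 0) ?partial_cst//.
  by apply/funext => y; rewrite mxE/= zero_tensor_christoffel.
have mE A B : (prolongation G zero_tensor A x *m prolongation G zero_tensor B x)
    (ord6 4) (ord6 1) = 0.
  have e40 : prolongation G zero_tensor A x (ord6 4) (ord6 0) = 0.
    by rewrite mxE/= zero_tensor_christoffel.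
  have e41 : prolongation G zero_tensor A x (ord6 4) (ord6 1) = 0.
    by rewrite mxE/= zero_tensor_christoffel.
  have e42 : prolongation G zero_tensor A x (ord6 4) (ord6 2) = 0.
    by rewrite mxE/= /zero_tensor mxE.
  have f31 : prolongation G zero_tensor B x (ord6 3) (ord6 1) = 0 by rewrite mxE.
  have f41 : prolongation G zero_tensor B x (ord6 4) (ord6 1) = 0.
    by rewrite mxE/= zero_tensor_christoffel.
  have f51 : prolongation G zero_tensor B x (ord6 5) (ord6 1) = 0.
    by rewrite mxE/= zero_tensor_christoffel.
  by rewrite [LHS]mxE sum_ord6 e40 e41 e42 f31 f41 f51 !mul0r !mulr0 !addr0.
by rewrite entryE !pE !mE !subrr.
Qed.

(** The sections are those with $\xi = 0$ and $\lambda = 0$. The equations for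
    $f$ and $\mu$ are then those of [Phi = 0], whose connection is flat, so the
    values of $f$ and $\mu$ at a point are arbitrary. *)
Lemma dimension3_of_obstruction Phi x1 : symmetric_tensor M Phi ->
  (forall x, M x -> forall C, cotton G Phi C x = 0) ->
  M x1 -> extension_obstruction G Phi x1 != 0 ->
  has_dimension (almost_einstein_scales (cotangent M) (modified_extension G Phi)) 3.
Proof.
move=> tPhi cotton0 Mx1 k1; rewrite almost_einstein_scalesE//.
pose ev (u : 'rV[R]_2 -> 'cV[R]_6) : 'rV[R]_3 :=
  \row_j [:: u x1 (ord6 3) 0; u x1 (ord6 4) 0; u x1 (ord6 5) 0]`_j.
apply: (has_dimension_of_coordinates (ev := ev)) => //.
- exact: supported_parallel_sections_linear.
- exact: scale_of_section_linear.
- move=> c u v; apply/matrixP => i j; rewrite !mxE.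
  by case: j => [[|[|[|//]]] h].
- by move=> u; exact: scale_of_section_eq0.
- move=> u su /matrixP ev0; have [pu _] := su.
  have [xi0 l0] := field_eq0_obstruction tPhi cotton0 pu Mx1 k1 Mx1.
  apply: (section_eq0 tPhi su Mx1) => //.
    by have := ev0 0 (@Ordinal 3 0 isT); rewrite !mxE.
  elim/ord2P; rewrite /scale_gradient/=.
    by have := ev0 0 (@Ordinal 3 1 isT); rewrite !mxE.
  by have := ev0 0 (@Ordinal 3 2 isT); rewrite !mxE.
move=> v; pose w0 := vec6 0 0 0 (v 0 (@Ordinal 3 0 isT)) (v 0 (@Ordinal 3 1 isT))
  (v 0 (@Ordinal 3 2 isT)).
have flat : flat_connection M (prolongation G zero_tensor).
  apply: prolongation_flat => // x Mx; last exact: obstruction_zero_tensor.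
  by move=> C; rewrite -(cotton_zero_tensor Phi) cotton0.
have [w [pw w1]] := flat_parallel_section w0 oM cM
  (smooth_prolongation oM tG symmetric_zero_tensor) flat Mx1.
have [dw H] := (parallel_prolonged_equations M G zero_tensor w).1 pw.
have w1xi C : scale_field w C x1 = 0.
  by elim/ord2P: C; rewrite /scale_field w1 !mxE.
have w1l : w x1 (ord6 2) 0 = 0 by rewrite w1 mxE.
have wxi := scale_field_eq0 pw Mx1 w1xi w1l.
have pPhi : parallel_section M (prolongation G Phi) w.
  apply/parallel_prolonged_equations; split=> // x Mx.
  have [h1 h2 h3 h4] := H x Mx; split=> // A B; rewrite h4.
  have [xi0 l0] := wxi x Mx; rewrite l0 !mulr0; congr (_ + _ - _ + _).
  by apply: eq_bigr => C _; rewrite xi0 !mulr0.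
have [u su uE] := restrict_parallel_section oM pPhi.
exists u => //; apply/matrixP => i j; rewrite ord1 mxE !uE// w1.
by case: j => [[|[|[|//]]] h] /=; rewrite mxE/= (bool_irrelevance h isT).
Qed.

End Cases.

(* The statement is local on the surface: [M] is a convex coordinate domain,
   for instance an arbitrarily small ball around a given point. *)
Theorem theorem4p3 (R : realType) (M : set 'rV[R]_2)
    (P : set (affine_connection R 2)) (D : affine_connection R 2)
    (Phi : 'rV[R]_2 -> 'M[R]_2) :
  open M -> convex_set M ->
  projective_structure M P -> P D -> special_connection M D ->
  symmetric_tensor M Phi ->
  exists2 d : nat, d \in [:: 0; 1; 3; 6]%N &
    has_dimension
      (almost_einstein_scales (cotangent M) (modified_extension D Phi)) d.

Proof.
move=> oM cM [G0 tG0 ->] [tD _] spD tPhi.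
have [[x0 Mx0]|M0] := pselect (exists x0, M x0); last first.
  have zero u : supported_parallel_sections M (prolongation D Phi) u -> u = 0.
    move=> [_ u0]; apply/funext => x.
    by rewrite u0// => Mx; apply: M0; exists x.
  rewrite almost_einstein_scalesE//.
  exists 0%N => //; apply: has_dimension0 zero; last exact: scale_of_section_linear.
  exact: supported_parallel_sections0.
have [[x1 [a [Mx1 ya]]]|no_cotton] := pselect (exists x a, M x /\ cotton D Phi a x != 0).
  have [d0|d1] := dimension_le1_of_cotton oM cM tD spD tPhi Mx1 ya; first by exists 0%N.
  by exists 1%N.
have cotton0 x : M x -> forall C, cotton D Phi C x = 0.
  by move=> Mx C; apply/eqP/negPn/negP => y0; apply: no_cotton; exists x, C.
have [[x1 Mx1 k1]|no_k] := pselect (exists2 x, M x & extension_obstruction D Phi x != 0).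
  by exists 3; last exact: dimension3_of_obstruction Mx1 k1.
exists 6 => //; apply: dimension6_of_flat Mx0 _ => // x Mx.
by apply/eqP/negPn/negP => k0; apply: no_k; exists x.
Qed.
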